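(* Let $k$ be a perfect field with algebraic closure $\bar k$ and $G_k=\mathrm{Gal}(\bar k/k)$. Let $f\in k[x_1^{\pm1},y^{\pm1}]$ be a Laurent polynomial defining a smooth curve $C_{0,k}:f=0$ in $\mathbb G_{m,k}^2$, and let $$\cdots\xrightarrow{s_{n+1}}C_{n+1}\xrightarrow{s_n}C_n\xrightarrow{s_{n-1}}\cdots\xrightarrow{s_1}C_1$$ be a Galois-equivariant Baker's resolution of $C_0=C_{0,k}\times_k\bar k$ (as defined in the context), where $s_n$ is the morphism resolving the $G_k$-invariant set $\mathcal S_n\subseteq\bigsqcup_{\alpha\in\Sigma_n}\mathrm{Sing}(\bar C_\alpha)$, and suppose $\mathcal S_n\neq\varnothing$ for every $n$ such that $C_n$ is not outer regular. Put $C_{n,k}=C_n/G_k$, a projective curve over $k$ birational to $C_{0,k}$ with $C_{n,k}\times_k\bar k\simeq C_n$. Then for all sufficiently large $n$ the curve $C_{n,k}$ is outer regular, i.e. $\bar C_\gamma$ is regular for every $\gamma\in\Sigma_n$.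
   Context: In the following construction $k$ denotes an algebraically closed field; in the claim it is applied with $\bar k$ in place of $k$. Conventions. A curve is a (not necessarily connected) scheme of finite type over the base field, equidimensional of dimension $1$; $\mathbb N=\mathbb Z_{\ge 0}$; $\mathrm{Reg}(X),\mathrm{Sing}(X)$ are the sets of regular and singular points of $X$. $f\in k[x_1^{\pm1},y^{\pm1}]$ is such that $C_0: f=0$ in $\mathbb G_m^2=\mathrm{Spec}\,k[x_1^{\pm1},y^{\pm1}]$ is a smooth curve. For $M=(a_{ij})\in \mathrm{SL}_r(\mathbb Z)$, $(X_1,\dots,X_r)\bullet M$ is the tuple with $j$-th entry $\prod_i X_i^{a_{ij}}$; $M$ is attached to a primitive vector $v$ if its last row is $v$. For primitive $v\in\mathbb Z^{m+1}$ and a nonzero Laurent polynomial $g$ in $x_1,\dots,x_m,y$, $\mathrm{ord}_v(g)$ is the minimum of the scalar product $v\cdot i$ over exponents $i$ of monomials of $g$. For an edge $\ell$ of an integral polygon $P$, its normal vector is the primitive $(a,b)\in\mathbb Z^2$ such that for some $c\in\mathbb Z$ the function $ai+bj+c$ vanishes on $\ell$ and is $\ge0$ on $P$; a segment $P$ is considered to have two edges, both equal to $P$, with opposite normal vectors. Charts. $\Omega_m$ is the set of pairs $\alpha=(v,(g_2,\dots,g_m))$ with $v\in\mathbb Z^{m+1}$ primitive and $g_i\in k[x_1^{\pm1},y^{\pm1}]$. For $\alpha\in\Omega_m$, $C_{0,\alpha}=D(g_2\cdots g_m)\subseteq C_0$, embedded in $\mathbb G_m^{m+1}=\mathrm{Spec}\,k[x_1^{\pm1},\dots,x_m^{\pm1},y^{\pm1}]$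 by $x_i=g_i$ $(i\ge2)$. $\Omega$ is the set of $\alpha\in\bigsqcup_m\Omega_m$ with $C_{0,\alpha}$ dense in $C_0$. For $\alpha\in\Omega\cap\Omega_m$ and $M$ attached to $v$, the substitution $(x_1,\dots,x_m,y)=(X_1,\dots,X_m,Y)\bullet M$ embeds $\mathbb G_m^{m+1}$ into $\mathbb T_v=\mathrm{Spec}\,k[X_1^{\pm1},\dots,X_m^{\pm1},Y]$; $C_\alpha$ is the closure of $C_{0,\alpha}$ in $\mathbb T_v$ and $\bar C_\alpha$ the scheme-theoretic intersection $C_\alpha\cap\{Y=0\}$ (independent of $M$ up to isomorphism). For $\alpha=0$ put $C_\alpha=C_{0,\alpha}=C_0$. The dense opens $C_{0,\alpha}$ of $C_\alpha$ and $C_0$ give natural birational maps $s_{\alpha\alpha'}:C_\alpha\dashrightarrow C_{\alpha'}$ for $\alpha,\alpha'\in\Omega\sqcup\{0\}$. Admissible sets. A finite $\Sigma\subset\Omega$ is admissible if each $\alpha=(v,(g_2,\dots,g_m))\in\Sigma$ is equipped with a matrix $M_\alpha$ attached to $v$, an index $j_\alpha\in\{1,\dots,m\}$ and $\mathcal F_\alpha\in k[X_{j_\alpha},Y]$, $Y\nmid\mathcal F_\alpha$, such that, with $\mathfrak a_\alpha$ the ideal of the closure in $\mathbb T_v$ (coordinates given by $M_\alpha$) of $\{x_i=g_i,\ 2\le i\le m\}\subset\mathbb G_m^{m+1}$ and $R_\alpha=k[X_1^{\pm1},\dots,X_m^{\pm1},Y]/\mathfrak a_\alpha$: $Y$ is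 not invertible in $R_\alpha$, there is an embedding $R_\alpha\hookrightarrow k(X_{j_\alpha},Y)$ with $X_{j_\alpha}\mapsto X_{j_\alpha}$, $Y\mapsto Y$, and $C_\alpha=\mathrm{Spec}\,R_\alpha/(\mathcal F_\alpha)$; and moreover the curve $\bigcup_{\alpha\in\Sigma}C_\alpha\cup C_0$, obtained by glueing $C_\alpha$ and $C_{\alpha'}$ along the largest opens on which $s_{\alpha\alpha'}$ is an open immersion, is projective, with $C_\alpha\cap C_{\alpha'}=C_{0,\alpha}\cap C_{0,\alpha'}$ for distinct $\alpha,\alpha'\in\Sigma\sqcup\{0\}$. Put $f|_\alpha(X_{j_\alpha})=\mathcal F_\alpha(X_{j_\alpha},0)$; then $\bar C_\alpha=\mathrm{Spec}\,D_\alpha/(f|_\alpha)$ where $D_\alpha=R_\alpha/(Y)$ is a localisation of $k[X_{j_\alpha}]$. Points of $\bar C_\alpha$ are regarded as points of the glued curve. First step. $\Sigma_1=\{(v_\ell,())\mid \ell\text{ an edge of the Newton polygon of }f\}$, $v_\ell$ the normal vector of $\ell$; for $\alpha=(v_\ell,())$, $M_\alpha$ is any matrix attached to $v_\ell$, $j_\alpha=1$, and $\mathcal F_\alpha\in k[X_1,Y]$, $Y\nmid\mathcal F_\alpha$, equals $f((X_1,Y)\bullet M_\alpha)$ up to a Laurent monomial. $C_1$ is the glued curve of $\Sigma_1$. Elementary step at $(\alpha,\mathcal S)$. Let $\Sigma_n$ be admissible with glued curve $C_n$, $\alpha=(v,(g_2,\dots,g_m))\in\Sigma_n$, $\mathcal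 S\subseteq\mathrm{Sing}(\bar C_\alpha)$; rename the variable $Y$ of the chart $\alpha$ to $\tilde Y$. For $p\in\mathcal S$ let $\bar{\mathcal G}_p=X_{j_\alpha}-X_{j_\alpha}(p)$ and choose $\tilde{\mathcal G}_p\in k[X_{j_\alpha},\tilde Y]$ with $\tilde{\mathcal G}_p-\bar{\mathcal G}_p\in\tilde Yk[\tilde Y]$ and $\tilde{\mathcal G}_p\nmid\mathcal F_\alpha$. Let $g_p\in k[x_1,\dots,x_m,y]$ be the polynomial divisible by no variable that equals $\tilde{\mathcal G}_p((x_1,\dots,x_m,y)\bullet M_\alpha^{-1})$ up to a Laurent monomial (coefficient $1$). Put $g_{\mathcal S}=\prod_{p\in\mathcal S} g_p$, $\tilde{\mathcal G}_{\mathcal S}=\prod_{p\in\mathcal S}\tilde{\mathcal G}_p$. For primitive $\beta=(\beta_1,\beta_2)\in\mathbb N\times\mathbb Z_+$ and $g\in k[x_1,\dots,x_m,y]$ put $\beta\circ_g\alpha=((v_1\beta_2,\dots,v_m\beta_2,\beta_1+\mathrm{ord}_v(g)\beta_2,v_{m+1}\beta_2),(g_2,\dots,g_m,g_{m+1}))$, $g_{m+1}=g(x_1,g_2,\dots,g_m,y)$. Let $\tilde\alpha=(0,1)\circ_{g_{\mathcal S}}\alpha$, with $j_{\tilde\alpha}=j_\alpha$, $\mathcal F_{\tilde\alpha}=\mathcal F_\alpha$ and $M_{\tilde\alpha}$ obtained from $M_\alpha$ by inserting a new $(m+1)$-th row $(0,\dots,0,1,0)$ and a new $(m+1)$-th column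 $(n_1,\dots,n_m,1,\mathrm{ord}_v(g_{\mathcal S}))$, where $g_{\mathcal S}=X_1^{n_1}\cdots X_m^{n_m}\tilde Y^{\mathrm{ord}_v(g_{\mathcal S})}\tilde{\mathcal G}_{\mathcal S}$ via $M_\alpha$. For $p\in\mathcal S$ define $M_{\alpha_p}$ in the same way from $g_p,\tilde{\mathcal G}_p$; write $\tilde{\mathcal G}_p=X_{j_\alpha}+c_p(\tilde Y)$ and $\mathcal F_{\alpha,p}(\tilde X_{m+1},\tilde Y)=\mathcal F_\alpha(\tilde X_{m+1}-c_p(\tilde Y),\tilde Y)$. Let $\Sigma_p=\{\gamma=\beta\circ_{g_p}\alpha\mid\beta\in\mathbb Z_+^2\text{ primitive},\ C_{0,\gamma}\subsetneq C_\gamma\}$ (equivalently, $\beta$ is the normal vector of an edge of the Newton polygon of $\mathcal F_{\alpha,p}$), with data, for a chosen matrix $M_\beta\in\mathrm{SL}_2(\mathbb Z)$ attached to $\beta$: $M_\gamma=(I_m\oplus M_\beta)M_{\alpha_p}$, $j_\gamma=m+1$, and $\mathcal F_\gamma\in k[X_{m+1},Y]$, $Y\nmid\mathcal F_\gamma$, equal to $\mathcal F_{\alpha,p}((X_{m+1},Y)\bullet M_\beta)$ up to a Laurent monomial. The step replaces $\alpha$ by $\{\tilde\alpha\}\cup\bigcup_{p\in\mathcal S}\Sigma_p$. Baker's resolution. Starting from $\Sigma_1$, choose for every $n$ a set $\mathcal S_n\subseteq\bigsqcup_{\alpha\in\Sigma_n}\mathrm{Sing}(\bar C_\alpha)$;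 $\Sigma_{n+1}$ is obtained from $\Sigma_n$ by performing the elementary step at $(\alpha,\mathcal S_n\cap\bar C_\alpha)$ for every $\alpha\in\Sigma_n$ with $\mathcal S_n\cap\bar C_\alpha\ne\varnothing$. Each $\Sigma_n$ is admissible; $C_n$ is its glued curve, and $s_n:C_{n+1}\to C_n$ (the morphism resolving $\mathcal S_n$) is the unique morphism extending the birational maps $s_{\gamma\alpha'}$, $\gamma\in\Sigma_{n+1}\sqcup\{0\}$, $\alpha'\in\Sigma_n\sqcup\{0\}$. $C_n$ is outer regular if $\bar C_\gamma$ is regular for all $\gamma\in\Sigma_n$. Galois-equivariance. When $f$ has coefficients in a perfect field $k$ and the construction is done over $\bar k$, $G_k$ acts on $\Omega$ by $(v,(g_i))^\sigma=(v,(g_i^\sigma))$, $\sigma$ acting on coefficients. A Baker's resolution of $C_0$ is called Galois-equivariant here if every $\Sigma_n$ satisfies: (d) $\Sigma_n$ is stable under $G_k$ and $M_{\alpha^\sigma}=M_\alpha$, $j_{\alpha^\sigma}=j_\alpha$, $\mathcal F_{\alpha^\sigma}=\mathcal F_\alpha^\sigma$ for all $\sigma\in G_k$, $\alpha\in\Sigma_n$ (so $G_k$ acts on $C_n$ and on $\bigsqcup_{\alpha\in\Sigma_n}\bar C_\alpha$), and every $\mathcal S_n$ is $G_k$-invariant. The curve $C_n/G_k$ over $k$ is called outer regular if $C_n$ is. *)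

(* Defs.v *)
From HB Require Import structures.
From mathcomp Require Import all_boot all_order all_algebra all_field.
From mathcomp Require Import finmap.
From mathcomp.multinomials Require Import mpoly.

Set Implicit Arguments.
Unset Strict Implicit.
Unset Printing Implicit Defensive.

Import GRing.Theory Num.Theory.
Local Open Scope ring_scope.

(* Perfect fields, algebraic closures, Galois groups *)

Definition perfect_field (k : fieldType) : Prop :=
  forall p : {poly k}, irreducible_poly p -> separable_poly p.

Definition algebraic_closure (k : fieldType) (K : closedFieldType)
    (iota : {rmorphism k -> K}) : Prop :=
  forall x : K, algebraicOver iota x.

Definition in_galois (k : fieldType) (K : closedFieldType)
    (iota : {rmorphism k -> K}) (sigma : {rmorphism K -> K}) : Prop :=
  bijective sigma /\ forall a, sigma (iota a) = iota a.

(* Laurent polynomials, as finitely supported functions of the exponent *)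

Definition laurent (K : fieldType) (n : nat) : Type :=
  {fsfun 'rV[int]_n -> K with 0}.

Definition map_laurent (k K : fieldType) (n : nat) (phi : k -> K)
    (f : laurent k n) : laurent K n :=
  [fsfun u in finsupp f => phi (f u)].

Definition monom (L : fieldType) (n : nat) (x : 'I_n -> L) (u : 'rV[int]_n) : L :=
  \prod_i x i ^ u 0 i.

Definition leval (K L : fieldType) (n : nat) (phi : K -> L) (f : laurent K n)
    (x : 'I_n -> L) : L :=
  \sum_(u <- finsupp f) phi (f u) * monom x u.

(* The value at x of the partial derivative of f in the i-th variable. *)
Definition lderiv_at (K : fieldType) (n : nat) (f : laurent K n) (i : 'I_n)
    (x : 'I_n -> K) : K :=
  \sum_(u <- finsupp f) (f u *~ u 0 i) * monom x (u - delta_mx 0 i).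

(* Over an algebraically closed K: f = 0 is a smooth curve in G_m^2. *)
Definition smooth_curve (K : closedFieldType) (f : laurent K 2) : Prop :=
  (exists u, f u != 0) /\
  forall P : 'I_2 -> K, (forall i, P i != 0) -> leval id f P = 0 ->
    exists i, lderiv_at f i P != 0.

(* (x_1, ..., x_n) . M *)
Definition act (L : fieldType) (n : nat) (x : 'I_n -> L) (M : 'M[int]_n) :
    'I_n -> L :=
  fun j => \prod_i x i ^ M i j.

Definition attached (n : nat) (M : 'M[int]_n.+1) (v : 'rV[int]_n.+1) : Prop :=
  \det M = 1 /\ row ord_max M = v.

Definition primitive2 (b : 'rV[int]_2) : bool := coprimez (b 0 0) (b 0 1).

Definition dot (n : nat) (v u : 'rV[int]_n) : int := \sum_i v 0 i * u 0 i.

(* b is the normal vector of an edge of the Newton polygon of f: the face of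
   the polygon on which b takes its minimal value -c is not a point. When the
   polygon is a segment both of its normal vectors qualify. *)
Definition edge_normal (K : fieldType) (f : laurent K 2) (b : 'rV[int]_2) : Prop :=
  primitive2 b /\
  exists c : int,
    (forall u, f u != 0 -> 0 <= dot b u + c) /\
    exists u u', [/\ u != u', f u != 0, f u' != 0,
                     dot b u + c = 0 & dot b u' + c = 0].

(* Junk value 0 when g = 0. *)
Definition ordv (K : fieldType) (n : nat) (v : 'rV[int]_n) (g : {mpoly K[n]}) : int :=
  let s := [seq \sum_i v 0 i * (w i : nat)%:Z | w : 'X_{1..n} <- msupp g] in
  foldr Num.min (head 0 s) s.

(* k(x_1, ..., x_n) *)
Definition ratfun (K : fieldType) (n : nat) : fieldType :=
  {fraction {mpoly K[n]}}.

Definition rX (K : fieldType) (n : nat) (i : 'I_n) : ratfun K n :=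
  tofrac ('X_i : {mpoly K[n]}).

Definition rC (K : fieldType) (n : nat) (c : K) : ratfun K n :=
  tofrac (mpolyC n c).

(* Elements of k[X, Y] are seen as elements of k[Y][X]. *)

Definition eval2 (K L : fieldType) (phi : K -> L) (F : {poly {poly K}})
    (a b : L) : L :=
  (map_poly (fun q : {poly K} => (map_poly phi q).[b]) F).[a].

Definition dvdY (K : fieldType) (F : {poly {poly K}}) : Prop :=
  exists Q : {poly {poly K}}, F = ('X : {poly K})%:P * Q.

(* An equipped chart, with m = cdim + 1: the m+1 coordinates x_1, ..., x_m, y,
   resp. X_1, ..., X_m, Y, are indexed by 'I_cdim.+2 with y, Y at ord_max.
   The g_i of all charts occurring in a resolution are polynomials in x_1, y. *)
Record chart (K : fieldType) := Chart {
  cdim : nat;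
  cvec : 'rV[int]_cdim.+2;
  cg : cdim.-tuple {mpoly K[2]};
  cM : 'M[int]_cdim.+2;
  cj : 'I_cdim.+1;
  cF : {poly {poly K}} }.

Definition xindex (d : nat) (j : 'I_d.+1) : 'I_d.+2 := widen_ord (leqnSn _) j.

(* (x_1, g_2, ..., g_m, y) *)
Definition czs (K : fieldType) (a : chart K) : (cdim a).+2.-tuple {mpoly K[2]} :=
  [tuple of 'X_0 :: rcons (cg a) 'X_1].

(* The coordinates X_1, ..., X_m, Y of T_v as functions on C_{0,alpha}, lifted
   to k(x_1, y). *)
Definition cXs (K : fieldType) (a : chart K) : 'I_(cdim a).+2 -> ratfun K 2 :=
  act (fun i => tofrac (tnth (czs a) i)) (invmx (cM a)).

(* The ideal of the closure C_alpha of C_{0,alpha} in T_v, contracted to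
   k[X_1, ..., X_m, Y]: the kernel of the restriction to the coordinate ring
   k[x_1^+-1, y^+-1, (g_2 ... g_m)^-1] / (f) of C_{0,alpha}. *)
Definition Cideal (K : fieldType) (f : laurent K 2) (a : chart K)
    (h : {mpoly K[(cdim a).+2]}) : Prop :=
  exists (N : nat) (q : {mpoly K[2]}),
    mmap (@rC K 2) (@cXs K a) h * tofrac (\prod_i tnth (czs a) i) ^+ N
    = leval (@rC K 2) f (@rX K 2) * tofrac q.

(* The ideal of the scheme-theoretic intersection of C_alpha with Y = 0. *)
Definition Cbar_ideal (K : fieldType) (f : laurent K 2) (a : chart K)
    (h : {mpoly K[(cdim a).+2]}) : Prop :=
  exists h0 q : {mpoly K[(cdim a).+2]}, Cideal f h0 /\ h = h0 + 'X_ord_max * q.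

Definition point (K : fieldType) (a : chart K) : Type := 'rV[K]_(cdim a).+2.

Definition mevalp (K : fieldType) (n : nat) (P : 'rV[K]_n) (h : {mpoly K[n]}) : K :=
  h.@[fun i => P 0 i].

(* Closed points of the closed subscheme of T_v; their Y-coordinate is 0. *)
Definition in_Cbar (K : fieldType) (f : laurent K 2) (a : chart K)
    (P : point a) : Prop :=
  (forall i : 'I_(cdim a).+2, i != ord_max -> P 0 i != 0) /\
  forall h, Cbar_ideal f h -> mevalp P h = 0.

(* bar C_alpha is zero-dimensional, so its local ring at P is regular when its
   maximal ideal is generated by 0 elements, i.e. is zero. *)
Definition regular_at (K : fieldType) (f : laurent K 2) (a : chart K)
    (P : point a) : Prop :=
  forall h : {mpoly K[(cdim a).+2]}, mevalp P h = 0 ->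
    exists u, mevalp P u != 0 /\ Cbar_ideal f (u * h).

Definition in_Sing (K : fieldType) (f : laurent K 2) (a : chart K)
    (P : point a) : Prop :=
  in_Cbar f P /\ ~ regular_at f P.

Definition Cbar_regular (K : fieldType) (f : laurent K 2) (a : chart K) : Prop :=
  forall P : point a, in_Cbar f P -> regular_at f P.

(* C_{0,alpha} is closed in the torus Y != 0 of T_v, so that the complement of
   C_{0,alpha} in C_alpha is the set of points of bar C_alpha. *)
Definition C0_proper (K : fieldType) (f : laurent K 2) (a : chart K) : Prop :=
  exists P : point a, in_Cbar f P.

Definition chart_set (K : fieldType) : Type := chart K -> Prop.

Definition outer_regular (K : fieldType) (f : laurent K 2)
    (Sigma : chart_set K) : Prop :=
  forall a, Sigma a -> Cbar_regular f a.

(* H1 = H2 up to a Laurent monomial in two variables *)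
Definition eq_upto_monom (K : fieldType) (H1 H2 : ratfun K 2) : Prop :=
  exists (c : K) (w : 'rV[int]_2), c != 0 /\ H1 = rC 2 c * monom (@rX K 2) w * H2.

Definition first_chart (K : fieldType) (b : 'rV[int]_2) (M : 'M[int]_2)
    (F : {poly {poly K}}) : chart K :=
  @Chart K 0 b [tuple] M ord0 F.

Definition first_step (K : fieldType) (f : laurent K 2) (Sigma : chart_set K) : Prop :=
  exists (M : 'rV[int]_2 -> 'M[int]_2) (F : 'rV[int]_2 -> {poly {poly K}}),
    (forall b, edge_normal f b ->
      [/\ attached (M b) b, ~ dvdY (F b) &
          eq_upto_monom (eval2 (@rC K 2) (F b) (rX K 0) (rX K 1))
                        (leval (@rC K 2) f (act (@rX K 2) (M b)))]) /\
    forall a, Sigma a <->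
      exists b, edge_normal f b /\ a = first_chart b (M b) (F b).

(* The position of the coordinate x_(m+1) among x_1, ..., x_(m+1), y. *)
Definition newi (d : nat) : 'I_d.+3 := inord d.+1.

(* beta o_g v, where o = ord_v(g) *)
Definition circ_vec (d : nat) (b : 'rV[int]_2) (o : int) (v : 'rV[int]_d.+2) :
    'rV[int]_d.+3 :=
  \row_j if unlift (newi d) j is Some j' then v 0 j' * b 0 1
         else b 0 0 + o * b 0 1.

(* M with a new row (0, ..., 0, 1, 0) and a new column (n_1, ..., n_m, 1, n_(m+1))
   inserted at position m+1. *)
Definition ext_mx (d : nat) (M : 'M[int]_d.+2) (n : 'rV[int]_d.+2) : 'M[int]_d.+3 :=
  \matrix_(i, j)
    match unlift (newi d) i, unlift (newi d) j with
    | None, _ => (j == newi d)%:R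
    | Some i', None => n 0 i'
    | Some i', Some j' => M i' j'
    end.

(* I_m (+) Mb *)
Definition dsum_mx (d : nat) (Mb : 'M[int]_2) : 'M[int]_d.+3 :=
  \matrix_(i, j)
    if (d < i)%N && (d < j)%N then Mb (inord (i - d.+1)) (inord (j - d.+1))
    else (i == j)%:R.

Definition ext_g (K : fieldType) (a : chart K) (g : {mpoly K[(cdim a).+2]}) :
    (cdim a).+1.-tuple {mpoly K[2]} :=
  [tuple of rcons (cg a) (g \mPo czs a)].

Definition tilde_chart (K : fieldType) (a : chart K) (g : {mpoly K[(cdim a).+2]})
    (n : 'rV[int]_(cdim a).+2) : chart K :=
  @Chart K (cdim a).+1
    (circ_vec (\row_i (if i == 0 then 0 else 1)) (ordv (cvec a) g) (cvec a))
    (ext_g g) (ext_mx (cM a) n) (widen_ord (leqnSn _) (cj a)) (cF a).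

Definition beta_chart (K : fieldType) (a : chart K) (g : {mpoly K[(cdim a).+2]})
    (n : 'rV[int]_(cdim a).+2) (b : 'rV[int]_2) (Mb : 'M[int]_2)
    (F : {poly {poly K}}) : chart K :=
  @Chart K (cdim a).+1
    (circ_vec b (ordv (cvec a) g) (cvec a))
    (ext_g g) (dsum_mx _ Mb *m ext_mx (cM a) n) ord_max F.

(* g is divisible by no variable and is G((x_1, ..., x_m, y) . M^-1) up to a
   Laurent monomial of coefficient 1. *)
Definition is_g_of (K : fieldType) (a : chart K) (G : {poly {poly K}})
    (g : {mpoly K[(cdim a).+2]}) : Prop :=
  let X := act (@rX K _) (invmx (cM a)) in
  (forall i, ~ exists q, g = 'X_i * q) /\
  exists w, tofrac g
    = monom (@rX K _) w * eval2 (@rC K _) G (X (xindex (cj a))) (X ord_max).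

(* g = X_1^(n_1) ... X_m^(n_m) Y^(ord_v g) G via M *)
Definition is_exponent_of (K : fieldType) (a : chart K) (G : {poly {poly K}})
    (g : {mpoly K[(cdim a).+2]}) (n : 'rV[int]_(cdim a).+2) : Prop :=
  n 0 ord_max = ordv (cvec a) g /\
  mmap (@rC K _) (act (@rX K _) (cM a)) g
    = monom (@rX K _) n
      * eval2 (@rC K _) G (rX K (xindex (cj a))) (rX K ord_max).

(* T is a set by which an elementary step at (a, S) may replace the chart a.
   Here G p = X + c_p(Y) is the polynomial chosen at p. *)
Definition elementary_step (K : fieldType) (f : laurent K 2) (a : chart K)
    (S : seq 'rV[K]_(cdim a).+2) (T : chart_set K) : Prop :=
  exists (c : point a -> {poly K})
         (g : point a -> {mpoly K[(cdim a).+2]})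
         (n : point a -> 'rV[int]_(cdim a).+2)
         (nS : 'rV[int]_(cdim a).+2)
         (M : point a -> 'rV[int]_2 -> 'M[int]_2)
         (F : point a -> 'rV[int]_2 -> {poly {poly K}}),
  let G p : {poly {poly K}} := 'X + (c p)%:P in
  let gS := \prod_(p <- S) g p in
  let GS := \prod_(p <- S) G p in
  let gamma p b := beta_chart (g p) (n p) b (M p b) (F p b) in
  let positive (b : 'rV[int]_2) := [&& primitive2 b, 0 < b 0 0 & 0 < b 0 1] in
  let in_Sigma p b := positive b /\ C0_proper f (gamma p b) in
  [/\ forall p, p \in S ->
        [/\ (c p).[0] = - p 0 (xindex (cj a)),
            ~ (exists Q, cF a = Q * G p),
            is_g_of (G p) (g p) &
            is_exponent_of (G p) (g p) (n p)],
      is_exponent_of GS gS nS,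
      forall p b, p \in S -> positive b -> attached (M p b) b,
      forall p b, p \in S -> in_Sigma p b ->
        ~ dvdY (F p b) /\
        eq_upto_monom (eval2 (@rC K 2) (F p b) (rX K 0) (rX K 1))
          (eval2 (@rC K 2) (cF a \Po ('X - (c p)%:P))
            (act (@rX K 2) (M p b) 0) (act (@rX K 2) (M p b) 1)) &
      forall e, T e <->
        e = tilde_chart gS nS \/
        exists p b, [/\ p \in S, in_Sigma p b & e = gamma p b]].

(* A finite subset of the disjoint union of the bar C_alpha. *)
Definition center (K : fieldType) : Type :=
  forall a : chart K, seq 'rV[K]_(cdim a).+2.

Definition resolution_step (K : fieldType) (f : laurent K 2)
    (Sigma : chart_set K) (S : center K) (Sigma' : chart_set K) : Prop :=
  exists T : chart K -> chart_set K,
    (forall a, Sigma a -> S a != [::] -> elementary_step f (S a) (T a)) /\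
    forall e, Sigma' e <->
      exists a, Sigma a /\ (if S a == [::] then e = a else T a e).

(* Sigma n and S n are meaningful for n >= 1, and S n on the charts of Sigma n. *)
Definition baker_resolution (K : fieldType) (f : laurent K 2)
    (Sigma : nat -> chart_set K) (S : nat -> center K) : Prop :=
  [/\ first_step f (Sigma 1%N),
      forall n a, (0 < n)%N -> Sigma n a ->
        uniq (S n a) /\ forall P, P \in S n a -> in_Sing f P &
      forall n, (0 < n)%N -> resolution_step f (Sigma n) (S n) (Sigma n.+1)].

Definition conj_chart (K : fieldType) (sigma : {rmorphism K -> K}) (a : chart K) :
    chart K :=
  @Chart K (cdim a) (cvec a) [tuple of map (map_mpoly sigma) (cg a)]
    (cM a) (cj a) (map_poly (map_poly sigma) (cF a)).

Definition galois_equivariant (k : fieldType) (K : closedFieldType)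
    (iota : {rmorphism k -> K})
    (Sigma : nat -> chart_set K) (S : nat -> center K) : Prop :=
  forall n (sigma : {rmorphism K -> K}) a,
    (0 < n)%N -> in_galois iota sigma -> Sigma n a ->
    Sigma n (conj_chart sigma a) /\
    forall P, P \in S n a -> map_mx sigma P \in S n (conj_chart sigma a).

(* Main.v *)
Require Import Defs.
From HB Require Import structures.
From Stdlib Require Import Classical IndefiniteDescription.
From Stdlib Require List.
From mathcomp Require Import all_boot all_order all_algebra all_field.
From mathcomp Require Import finmap.
From mathcomp.multinomials Require Import mpoly.
From mathcomp Require Import ring lra zify.

(* A singular point of bar C_a is given by a multiple root x of F(X, 0), where
   F = F_a. Let r be its multiplicity and N the least exponent such that Y^N lies
   in the ideal (F, F_X, Y F_Y) of the local ring of the plane at (x, 0).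
   Such an N exists on the charts of the first step: the greatest common divisor
   of F, F_X, Y F_Y over k(Y) is a power of X, as any other root would produce a
   singular point of C_0 in the torus, and Bezout's identity puts some nonzero
   R(Y) X^e into the ideal. In an elementary step, an edge with normal
   vector (b1, b2) of the Newton polygon of F(X - c(Y), Y) at its origin has
   roots of multiplicity at most r / b2. If r does not drop then b2 = 1 and
   Y^(r b1) is divided out of F; since the logarithmic derivatives of the old and
   of the new equation are combinations of each other, up to the factor Y^b1
   coming from X, the exponent N drops by (r - 1) b1 > 0. Points that are not
   blown up keep F and x. So (r, N) decreases lexicographically along every
   branch of the finitely branching tree of centres, which is therefore finite. *)

(** The number of coordinates of a chart grows with every step, whereas (r, N) is read in a plane.
    All charts are therefore placed in one field, k(x_1, y): their coordinates are Laurent monomials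
    in x_1, g_2, ..., g_m, y, and passing to a new chart becomes an equality of rational functions.
    The invariant [chart_inv] keeps every coordinate a germ at the point (x, 0) of the (X_j,
    Y)-plane, so that no glueing enters. Identities at a generic point are specialized by
    [transport]. The ideal contains Y F_Y rather than F_Y because monomial substitutions transform X
    d/dX and Y d/dY linearly with determinant 1, in every characteristic. F_X stays without a factor
    because X is translated by c(Y) before the substitution; passing from F_X to a logarithmic
    derivative costs one factor X, which becomes Y^b1 times a unit. Hence the gain is r b1 - b1,
    which is positive exactly when r >= 2; for r = 1 the point is already regular. *)

Set Implicit Arguments.
Unset Strict Implicit.
Unset Printing Implicit Defensive.

(* Koenig's lemma by induction on the key. A vertex that is not hit has a single
   continuation, so that before the first hit a branch can be followed in time. *)
Section FiniteTree.

Variables (T K : Type) (key : T -> K) (R : K -> K -> Prop).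
Variables (live hit : nat -> T -> Prop) (step : nat -> T -> T -> Prop).

Hypothesis Rwf : well_founded R.
Hypothesis step_idle : forall n u v v',
  ~ hit n u -> step n u v -> step n u v' -> v = v'.
Hypothesis key_idle : forall n u v, ~ hit n u -> step n u v -> key v = key u.
Hypothesis key_hit : forall n u v, hit n u -> step n u v -> R (key v) (key u).
Hypothesis fin_hit : forall n u, hit n u ->
  exists s : seq T, forall v, step n u v -> List.In v s.

Inductive descends (n : nat) (u : T) : nat -> T -> Prop :=
| descends_refl : descends n u n u
| descends_step m v w : descends n u m v -> step m v w -> descends n u m.+1 w.

Lemma descends_leq n u m v : descends n u m v -> n <= m.
Proof. by elim=> // {}m {}v w _ /leqW. Qed.

Lemma descends_split n u m v : descends n u m v ->
  (n = m /\ u = v) \/ exists w, step n u w /\ descends n.+1 w m v.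
Proof.
elim=> [|{}m {}v w _ [[<- <-]|[w' [h1 h2]]] h]; first by left.
- by right; exists w; split=> //; constructor.
- by right; exists w'; split=> //; apply: descends_step h2 h.
Qed.

Lemma seq_bound (Q : T -> nat -> Prop) (s : seq T) :
    (forall v, List.In v s -> exists N, forall m, N <= m -> Q v m) ->
  exists N, forall v, List.In v s -> forall m, N <= m -> Q v m.
Proof.
elim: s => [|v s IH] h; first by exists 0.
have [N hN] := h v (or_introl (erefl v)).
have [N' hN'] := IH (fun v' hv => h v' (or_intror hv)).
exists (maxn N N') => v' [<-|hv'] m; rewrite geq_max => /andP[h1 h2].
  exact: hN.
exact: hN'.
Qed.

Lemma eventually_not_hit n u :
  exists N, forall m, N <= m -> forall v, descends n u m v -> ~ hit m v.
Proof.
move: {2}(key u) (erefl (key u)) => k; elim/(well_founded_ind Rwf): k n u => k IH n u ku.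
(* Stated for every vertex with key [k]: it is used again at the hit vertex reached after [d] idle
   steps, which preserve the key. *)
have hit_case n' u' : key u' = k -> hit n' u' ->
    exists N, forall m, N <= m -> forall v, descends n' u' m v -> ~ hit m v.
  move=> ku' hu; have [s hs] := fin_hit hu.
  have [N hN] : exists N, forall w, List.In w s -> forall m, N <= m ->
      step n' u' w -> forall v, descends n'.+1 w m v -> ~ hit m v.
    apply: seq_bound => w _; have [huw|nuw] := classic (step n' u' w); last by exists 0.
    have [|N hN] := IH (key w) _ n'.+1 w erefl; first by rewrite -ku'; apply: key_hit huw.
    by exists N => m /hN h _.
  exists (maxn N n'.+1) => m; rewrite geq_max => /andP[h1 h2] v.
  case/descends_split=> [[E _]|[w [huw hw]]]; first by rewrite E ltnn in h2.
  exact: hN (hs w huw) _ h1 huw _ hw.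
have [[d [v [hv hh]]]|nohit] :=
    classic (exists d v, descends n u (n + d) v /\ hit (n + d) v); last first.
  exists n => m le_nm v hv hh; apply: nohit; exists (m - n), v.
  by rewrite subnKC.
elim: d n u ku v hv hh => [|d IHd] n u ku v hv hh.
  apply: hit_case => //; rewrite addn0 in hv hh.
  by case/descends_split: hv => [[_ ->] //|[w [_ /descends_leq]]]; rewrite ltnn.
have [hu|hu] := classic (hit n u); first exact: hit_case.
case/descends_split: hv => [[E _]|[w [huw hw]]].
  by move/eqP: E; rewrite -[X in X == _]addn0 eqn_add2l.
rewrite addnS -addSn in hw hh.
have [|N hN] := IHd n.+1 w _ v hw hh; first by rewrite (key_idle hu huw).
exists (maxn N n.+1) => m; rewrite geq_max => /andP[h1 h2] v'.
case/descends_split=> [[E _]|[w' [huw' hw']]]; first by rewrite E ltnn in h2.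
by rewrite (step_idle hu huw' huw) in hw'; apply: hN hw'.
Qed.

Lemma finite_tree n0 (s : seq T) :
    (forall u, live n0 u -> List.In u s) ->
    (forall n v, n0 <= n -> live n.+1 v -> exists u, live n u /\ step n u v) ->
  exists N, forall n, N <= n -> forall u, live n u -> ~ hit n u.
Proof.
move=> hs hlive.
have hdesc d v : live (n0 + d) v -> exists2 u, List.In u s & descends n0 u (n0 + d) v.
  elim: d v => [|d IH] v; first by rewrite addn0 => /hs; exists v => //; constructor.
  rewrite addnS => /hlive[|w [/IH[u hu hd] hw]]; first exact: leq_addr.
  by exists u => //; apply: descends_step hd hw.
have [N hN] : exists N, forall u, List.In u s -> forall m, N <= m ->
    forall v, descends n0 u m v -> ~ hit m v.
  by apply: seq_bound => u _; apply: eventually_not_hit.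
exists (maxn N n0) => n; rewrite geq_max => /andP[h1 h2] v hv.
have [|u hu hd] := hdesc (n - n0) v; first by rewrite subnKC.
by apply: hN hu _ h1 _ _; rewrite subnKC in hd.
Qed.

End FiniteTree.

Import GRing.Theory Num.Theory.
Local Open Scope ring_scope.

(** * Evaluation of bivariate polynomials and germs *)

Lemma frac_reprE (R : idomainType) (x : {fraction R}) :
  (frac (repr x)).2 != 0 /\ x * tofrac (frac (repr x)).2 = tofrac (frac (repr x)).1.
Proof.
split; first exact: denom_ratioP.
rewrite -[x in LHS]reprK; unlock tofrac.
rewrite -[LHS]FracField.pi_mul; apply/eqP; rewrite FracField.equivf_def.
rewrite /FracField.mulf /= !numden_Ratio ?mulf_neq0 ?oner_neq0 ?denom_ratioP //.
by rewrite !mulr1 reprK mulrC.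
Qed.

HB.instance Definition _ (K : fieldType) (n : nat) :=
  GRing.RMorphism.copy (@rC K n) (@tofrac {mpoly K[n]} \o @mpolyC n K).

Section Ev2.
Variables (K : fieldType) (R : comNzRingType) (phi : {rmorphism K -> R}).
Implicit Types A : {poly {poly K}}.

(** Convertible with [eval2], but with values in any commutative ring, since [emb] evaluates in a
    polynomial ring. *)
Definition ev2 (a b : R) A : R :=
  (map_poly (fun q : {poly K} => (map_poly phi q).[b]) A).[a].

HB.instance Definition _ a b := GRing.RMorphism.copy (ev2 a b)
  (horner_eval a \o map_poly (horner_eval b \o map_poly phi)).

Lemma ev2C a b q : ev2 a b q%:P = (map_poly phi q).[b].
Proof.
by rewrite /ev2 (map_polyC (horner_eval b \o map_poly phi)) hornerC.
Qed.

Lemma ev2CC a b c : ev2 a b c%:P%:P = phi c.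
Proof. by rewrite ev2C map_polyC hornerC. Qed.

Lemma ev2X a b : ev2 a b 'X = a.
Proof. by rewrite /ev2 (map_polyX (horner_eval b \o map_poly phi)) hornerX. Qed.

Lemma ev2Y a b : ev2 a b ('X%:P) = b.
Proof. by rewrite ev2C map_polyX hornerX. Qed.

Lemma ev2B a b A B : ev2 a b (A - B) = ev2 a b A - ev2 a b B.
Proof. by apply: (@addIr _ (ev2 a b B)); rewrite -rmorphD !subrK. Qed.

Lemma poly2_ind (P : {poly {poly K}} -> Prop) :
    (forall c : K, P c%:P%:P) -> P 'X -> P ('X%:P) ->
    (forall A B, P A -> P B -> P (A + B)) ->
    (forall A B, P A -> P B -> P (A * B)) ->
  forall A, P A.
Proof.
move=> PC PX PY PD PM; elim/poly_ind => [|A q IHA]; first exact: (PC 0).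
apply: (PD); first exact: PM.
elim/poly_ind: q => [|q c IHq]; first exact: (PC 0).
by rewrite polyCD polyCM; apply: (PD) => //; apply: PM.
Qed.
End Ev2.

Lemma ev2_morph (K : fieldType) (R R' : comNzRingType) (phi : {rmorphism K -> R})
    (psi : {rmorphism R -> R'}) (phi' : {rmorphism K -> R'}) a b A :
  (forall c, phi' c = psi (phi c)) ->
  psi (ev2 phi a b A) = ev2 phi' (psi a) (psi b) A.
Proof.
move=> E; elim/poly2_ind: A => [c|||A B IHA IHB|A B IHA IHB].
- by rewrite !ev2CC E.
- by rewrite !ev2X.
- by rewrite !ev2Y.
- by rewrite !rmorphD IHA IHB.
- by rewrite !rmorphM IHA IHB.
Qed.

(* For ev0 : R -> K evaluation at a point, the fractions ev h / ev s with
   ev0 s <> 0 are the germs at that point, and [germ l v] says that l is one of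
   them and takes the value v there. *)
Section Germ.
Variables (K L : fieldType) (R : comNzRingType).
Variables (ev : {rmorphism R -> L}) (ev0 : {rmorphism R -> K}).

Definition germ (l : L) (v : K) : Prop :=
  exists h s, [/\ ev0 s != 0, l * ev s = ev h & ev0 h = v * ev0 s].

Lemma germ_ev h : germ (ev h) (ev0 h).
Proof. by exists h, 1; rewrite !rmorph1 !mulr1 oner_neq0. Qed.

Lemma germ1 : germ 1 1.
Proof. by have := germ_ev 1; rewrite !rmorph1. Qed.

Lemma germ0 : germ 0 0.
Proof. by have := germ_ev 0; rewrite !rmorph0. Qed.

Lemma germD l v l' v' : germ l v -> germ l' v' -> germ (l + l') (v + v').
Proof.
move=> [h [s [s0 e e0]]] [h' [s' [s0' e' e0']]].
exists (h * s' + h' * s), (s * s'); rewrite !rmorphD !rmorphM /= mulf_neq0 //.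
by rewrite -e -e' e0 e0'; split=> //; ring.
Qed.

Lemma germM l v l' v' : germ l v -> germ l' v' -> germ (l * l') (v * v').
Proof.
move=> [h [s [s0 e e0]]] [h' [s' [s0' e' e0']]].
exists (h * h'), (s * s'); rewrite !rmorphM /= mulf_neq0 //.
by rewrite -e -e' e0 e0'; split=> //; ring.
Qed.

Lemma germN l v : germ l v -> germ (- l) (- v).
Proof.
move=> [h [s [s0 e e0]]].
by exists (- h), s; rewrite !rmorphN /= -e e0; split=> //; ring.
Qed.

Lemma germB l v l' v' : germ l v -> germ l' v' -> germ (l - l') (v - v').
Proof. by move=> h /germN; apply: germD. Qed.

Lemma germX l v n : germ l v -> germ (l ^+ n) (v ^+ n).
Proof.
by move=> h; elim: n => [|n IH]; [exact: germ1|rewrite !exprS; apply: germM].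
Qed.

(** Unlike [germV], this needs no control of the kernel of [ev]: the quotient [l] is given
    beforehand by the equation [l * b = a]. *)
Lemma germ_div l b a vb va :
  l * b = a -> germ b vb -> vb != 0 -> germ a va -> germ l (va / vb).
Proof.
move=> E [h [s [s0 e e0]]] vb0 [h' [s' [s0' e' e0']]].
exists (h' * s), (h * s'); rewrite !rmorphM /= -e -e' -E e0 e0'.
rewrite !mulf_neq0 //; split=> //; first by ring.
by field.
Qed.

Hypothesis ker_ev : forall h, ev h = 0 -> ev0 h = 0.

Lemma germ_inj l v v' : germ l v -> germ l v' -> v = v'.
Proof.
move=> /germB h /h {h} [h [s [s0 e e0]]].
apply/eqP; rewrite -subr_eq0 -(mulIr_eq0 _ (mulIf s0)) -e0.
by rewrite subrr mul0r in e; rewrite ker_ev.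
Qed.

Lemma germ_neq0 l v : germ l v -> v != 0 -> l != 0.
Proof.
move=> h; apply: contraNneq => E; rewrite E in h.
exact/eqP/(germ_inj h germ0).
Qed.

Lemma germV l v : germ l v -> v != 0 -> germ l^-1 v^-1.
Proof.
move=> h v0; rewrite -[v^-1]mul1r; apply: (germ_div _ h v0 germ1).
by rewrite mulVf // (germ_neq0 h v0).
Qed.

Lemma germXz l v (z : int) : germ l v -> v != 0 -> germ (l ^ z) (v ^ z).
Proof.
move=> h v0; case: z => n; first exact: germX.
by rewrite NegzE -!exprnN; apply: germV; [exact: germX|exact: expf_neq0].
Qed.
End Germ.

(** * Laurent monomials and Laurent functions *)

Section LaurentMonomials.
Variables (L : fieldType) (n : nat).
Implicit Types (x : 'I_n -> L) (u : 'rV[int]_n) (M : 'M[int]_n).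

Lemma monom_neq0 x u : (forall i, x i != 0) -> monom x u != 0.
Proof. by move=> x0; apply/prodf_neq0 => i _; apply: expfz_neq0. Qed.

Lemma act_neq0 x M : (forall i, x i != 0) -> forall i, act x M i != 0.
Proof. by move=> x0 j; apply/prodf_neq0 => i _; apply: expfz_neq0. Qed.

Lemma monom0 x : monom x 0 = 1.
Proof. by rewrite /monom big1 // => i _; rewrite mxE. Qed.

Lemma monomD x u v : (forall i, x i != 0) ->
  monom x (u + v) = monom x u * monom x v.
Proof.
move=> x0; rewrite -big_split; apply: eq_bigr => i _ /=.
by rewrite mxE expfzDr.
Qed.

Lemma monomN x u : (forall i, x i != 0) -> monom x (- u) = (monom x u)^-1.
Proof.
move=> x0; apply: (mulIf (monom_neq0 u x0)).
by rewrite -monomD // addNr monom0 mulVf // monom_neq0.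
Qed.

Lemma monom_actE x M u : (forall i, x i != 0) ->
  monom (act x M) u = monom x (u *m M^T).
Proof.
move=> x0; rewrite /monom /act.
under eq_bigr => j _ do rewrite (big_morph (fun l => l ^ u 0 j)
  (fun a b => expfzMl a b (u 0 j)) (exp1rz _ (u 0 j))).
rewrite exchange_big; apply: eq_bigr => i _ /=.
rewrite !mxE (big_morph (fun z => x i ^ z) (fun a b => expfzDr a b (x0 i)) (expr0z (x i))).
by apply: eq_bigr => j _; rewrite mxE mulrC exprz_exp.
Qed.

Lemma monomE_act x M j : act x M j = monom x (col j M)^T.
Proof. by apply: eq_bigr => i _; rewrite !mxE. Qed.

Lemma act_mul x M M' : (forall i, x i != 0) ->
  act (act x M) M' =1 act x (M *m M').
Proof.
move=> x0 j; rewrite !monomE_act monom_actE //.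
by congr monom; rewrite colE -trmx_mul colE mulmxA.
Qed.

Lemma act1 x : act x 1%:M =1 x.
Proof.
move=> j; rewrite /act (bigD1 j) //= mxE eqxx expr1z big1 ?mulr1 // => i ne.
by rewrite mxE (negPf ne).
Qed.

Lemma eq_act x y M : x =1 y -> act x M =1 act y M.
Proof. by move=> E j; apply: eq_bigr => i _; rewrite E. Qed.

Lemma eq_monom x y u : x =1 y -> monom x u = monom y u.
Proof. by move=> E; apply: eq_bigr => i _; rewrite E. Qed.
End LaurentMonomials.

Lemma act2E (L : fieldType) (x : 'I_2 -> L) M j : act x M j = x 0 ^ M 0 j * x 1 ^ M 1 j.
Proof.
rewrite /act !big_ord_recl big_ord0 mulr1.
by congr (_ ^ M _ j * _ ^ M _ j); try congr x; apply: val_inj.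
Qed.

Lemma monom2E (L : fieldType) (x : 'I_2 -> L) u : monom x u = x 0 ^ u 0 0 * x 1 ^ u 0 1.
Proof.
rewrite /monom !big_ord_recl big_ord0 mulr1.
by congr (_ ^ u _ _ * _ ^ u _ _); try congr x; apply: val_inj.
Qed.

(* Laurent polynomials as functions on the torus points over all extensions of
   K, so that an identity at the generic point can be specialized. *)
Section LaurentFunctions.
Variables (K : fieldType) (n : nat).

Definition torus_fun := forall L : fieldType, {rmorphism K -> L} -> ('I_n -> L) -> L.

(** The same [N] and [q] serve all [L], [phi] and [z]; this uniformity is what [transport]
    exploits. *)
Definition laurent_fun (F : torus_fun) : Prop :=
  exists (N : nat) (q : {mpoly K[n]}), forall L phi z, (forall i, z i != 0) ->
    F L phi z * (\prod_i z i) ^+ N = mmap phi z q.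

Lemma mmap_prodX (L : fieldType) (phi : {rmorphism K -> L}) (z : 'I_n -> L) N :
  mmap phi z ((\prod_i 'X_i) ^+ N) = (\prod_i z i) ^+ N.
Proof.
rewrite rmorphXn rmorph_prod; congr (_ ^+ _).
by apply: eq_bigr => i _; rewrite /= mmapX mmap1U.
Qed.

Lemma laurent_fun_const (c : K) : laurent_fun (fun L phi z => phi c).
Proof. by exists 0, (mpolyC n c) => L phi z z0; rewrite mulr1 mmapC. Qed.

Lemma laurent_fun_var i : laurent_fun (fun L phi z => z i).
Proof. by exists 0, 'X_i => L phi z z0; rewrite mulr1 mmapX mmap1U. Qed.

Lemma laurent_funD F G : laurent_fun F -> laurent_fun G ->
  laurent_fun (fun L phi z => F L phi z + G L phi z).
Proof.
move=> [N [q hq]] [N' [q' hq']].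
exists (N + N')%N, (q * (\prod_i 'X_i) ^+ N' + q' * (\prod_i 'X_i) ^+ N) => L phi z z0.
by rewrite rmorphD !rmorphM /= !mmap_prodX -hq // -hq' // exprD; ring.
Qed.

Lemma laurent_funM F G : laurent_fun F -> laurent_fun G ->
  laurent_fun (fun L phi z => F L phi z * G L phi z).
Proof.
move=> [N [q hq]] [N' [q' hq']].
exists (N + N')%N, (q * q') => L phi z z0.
by rewrite rmorphM /= -hq // -hq' // exprD; ring.
Qed.

Lemma eq_laurent_fun (F G : torus_fun) :
    (forall L phi z, (forall i, z i != 0) -> F L phi z = G L phi z) ->
  laurent_fun F -> laurent_fun G.
Proof. by move=> E [N [q hq]]; exists N, q => L phi z z0; rewrite -E // hq. Qed.

Lemma laurent_fun_sum (I : Type) (r : seq I) (F : I -> torus_fun) :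
    (forall i, laurent_fun (F i)) ->
  laurent_fun (fun L phi z => \sum_(i <- r) F i L phi z).
Proof.
move=> hF; elim: r => [|i r IH].
  apply: eq_laurent_fun (laurent_fun_const 0) => L phi z _.
  by rewrite big_nil rmorph0.
apply: eq_laurent_fun (laurent_funD (hF i) IH) => L phi z _.
by rewrite big_cons.
Qed.

Lemma laurent_fun_monom u : laurent_fun (fun L phi z => monom z u).
Proof.
(* A shift large enough to make all exponents [u 0 i + N] nonnegative. *)
pose N := (\sum_i `|u 0%R i|)%N.
exists N, 'X_[[multinom `|(u 0 i + N%:Z)%R|%N | i < n]] => L phi z z0.
rewrite mmapX /mmap1 /monom -prodrXl -big_split; apply: eq_bigr => i _ /=.
rewrite mnmE !exprnP -expfzDr //; congr (_ ^ _).
have hle : (`|u 0%R i| <= N)%N by rewrite /N (bigD1 i) //= leq_addr.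
by lia.
Qed.

Lemma laurent_fun_leval (f : laurent K n) M :
  laurent_fun (fun L phi z => leval phi f (act z M)).
Proof.
apply: laurent_fun_sum => u; apply: laurent_funM.
  exact: laurent_fun_const.
apply: eq_laurent_fun (laurent_fun_monom (u *m M^T)) => L phi z z0.
by rewrite monom_actE.
Qed.

Lemma laurent_fun_act i M : laurent_fun (fun L phi z => act z M i).
Proof.
apply: eq_laurent_fun (laurent_fun_monom (col i M)^T) => L phi z z0.
by rewrite monomE_act.
Qed.

Lemma laurent_fun_ev2 (A : {poly {poly K}}) F G :
    laurent_fun F -> laurent_fun G ->
  laurent_fun (fun L phi z => ev2 phi (F L phi z) (G L phi z) A).
Proof.
move=> hF hG; elim/poly2_ind: A => [c|||A B IHA IHB|A B IHA IHB].
- by apply: eq_laurent_fun (laurent_fun_const c) => L phi z _; rewrite ev2CC.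
- by apply: eq_laurent_fun hF => L phi z _; rewrite ev2X.
- by apply: eq_laurent_fun hG => L phi z _; rewrite ev2Y.
- by apply: eq_laurent_fun (laurent_funD IHA IHB) => L phi z _; rewrite rmorphD.
- by apply: eq_laurent_fun (laurent_funM IHA IHB) => L phi z _; rewrite rmorphM.
Qed.

Lemma laurent_fun_mmap (q : {mpoly K[n]}) M :
  laurent_fun (fun L phi z => mmap phi (act z M) q).
Proof.
elim/mpolyind: q => [|c m q _ _ IH].
  by apply: eq_laurent_fun (laurent_fun_const 0) => L phi z _; rewrite !rmorph0.
pose u : 'rV[int]_n := \row_i (m i : int).
have hm : laurent_fun (fun L phi z => phi c * monom z (u *m M^T)).
  exact: laurent_funM (laurent_fun_const c) (laurent_fun_monom _).
apply: eq_laurent_fun (laurent_funD hm IH) => L phi z z0.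
rewrite rmorphD /= mmapZ mmapX -monom_actE //; congr (_ * _ + _).
by apply: eq_bigr => i _; rewrite mxE.
Qed.

Lemma rX_neq0 i : rX K i != 0 :> ratfun K n.
Proof. by rewrite tofrac_eq0 -msupp_eq0 msuppX. Qed.

Lemma mmap_rX (q : {mpoly K[n]}) : mmap (@rC K n) (@rX K n) q = tofrac q.
Proof.
elim/mpolyind: q => [|c m q _ _ IH]; first by rewrite !rmorph0.
rewrite !rmorphD /= IH; congr (_ + _).
rewrite mmapZ -mul_mpolyC rmorphM; congr (_ * _).
by rewrite mmapX mpolyXE_id rmorph_prod; apply: eq_bigr => i _; rewrite rmorphXn.
Qed.

(** After multiplication by a common power of the product of the variables, both sides are values of
    polynomials. Evaluation at the generic point is injective on polynomials, so these two coincide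
    and the identity holds at every torus point over every extension. *)
Lemma transport (F G : torus_fun) : laurent_fun F -> laurent_fun G ->
    F _ (@rC K n) (@rX K n) = G _ (@rC K n) (@rX K n) ->
  forall (L : fieldType) (phi : {rmorphism K -> L}) z, (forall i, z i != 0) -> F L phi z = G L phi z.
Proof.
move=> [N [q hq]] [N' [q' hq']] E L phi z z0.
have Pz0 : \prod_i z i != 0 by apply/prodf_neq0.
apply: (mulIf (expf_neq0 (N + N') Pz0)).
have -> : F L phi z * (\prod_i z i) ^+ (N + N')
    = mmap phi z (q * (\prod_i 'X_i) ^+ N').
  by rewrite rmorphM /= mmap_prodX -hq // exprD mulrA.
have -> : G L phi z * (\prod_i z i) ^+ (N + N')
    = mmap phi z (q' * (\prod_i 'X_i) ^+ N).
  by rewrite rmorphM /= mmap_prodX -hq' // addnC exprD mulrA.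
congr (mmap _ _ _); apply/eqP; rewrite -tofrac_eq -!mmap_rX !rmorphM /= !mmap_prodX.
rewrite -hq; last exact: rX_neq0.
rewrite -hq'; last exact: rX_neq0.
by rewrite E -!mulrA -!exprD addnC.
Qed.

(** Linear independence of Laurent monomials, reduced to that of ordinary monomials by shifting all
    exponents by [N]. Exponents may repeat in the family, hence the sum over a fibre of [u]. *)
Lemma laurent_coef (I : finType) (c : I -> K) (u : I -> 'rV[int]_n) :
    \sum_i rC n (c i) * monom (@rX K n) (u i) = 0 ->
  forall w, \sum_(i | u i == w) c i = 0.
Proof.
move=> E w; pose N := (\sum_i \sum_j `|u i 0%R j|)%N.
pose m (i : I) : 'X_{1..n} := [multinom `|(u i 0 j + N%:Z)%R|%N | j < n].
have hN i j : (`|u i 0%R j| <= N)%N.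
  by rewrite /N (bigD1 i) //= (bigD1 j) //= -addnA leq_addr.
have {}E : \sum_i c i *: 'X_[m i] = 0 :> {mpoly K[n]}.
  apply/eqP; rewrite -tofrac_eq0 rmorph_sum /=; apply/eqP.
  transitivity ((\sum_i rC n (c i) * monom (@rX K n) (u i)) * (\prod_j rX K j) ^+ N).
    rewrite mulr_suml; apply: eq_bigr => i _; rewrite -mul_mpolyC rmorphM -mulrA; congr (_ * _).
    rewrite mpolyXE_id rmorph_prod /monom -prodrXl -big_split; apply: eq_bigr => j _ /=.
    rewrite rmorphXn /= mnmE !exprnP -[tofrac _]/(rX K j) -expfzDr ?rX_neq0 //.
    by congr (_ ^ _); move: (hN i j); lia.
  by rewrite E mul0r.
have [/existsP[i0 /eqP E0]|] := boolP [exists i, u i == w]; last first.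
  by rewrite negb_exists => /forallP h; apply: big1 => i; rewrite (negPf (h i)).
transitivity (mcoeff (m i0) (\sum_i c i *: 'X_[m i])); last by rewrite E mcoeff0.
rewrite raddf_sum /= big_mkcond; apply: eq_bigr => i _.
rewrite mcoeffZ mcoeffX; have -> : (m i == m i0) = (u i == w).
  rewrite -E0; apply/eqP/eqP=> [Em|Eu]; last by congr [multinom _ | j < n]; rewrite /m Eu.
  apply/rowP=> j; have := congr1 (fun M : 'X_{1..n} => M j) Em; rewrite !mnmE.
  by move: (u i 0 j : int) (u i0 0 j : int) (hN i j) (hN i0 j) => a b; lia.
by case: eqP; rewrite ?mulr1 ?mulr0.
Qed.
End LaurentFunctions.

(** * Derivations of rational function fields *)

Definition derivation (L : fieldType) (D : L -> L) : Prop :=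
  (forall a b, D (a + b) = D a + D b) /\ (forall a b, D (a * b) = D a * b + a * D b).

(** Here x = a / b = a' / b', and [da], [db], ... stand for the derivatives of a, b, .... The
    hypothesis is the derivative of a b' = a' b, and (da - x db) / b is the usual quotient rule with
    a eliminated. *)
Lemma quotient_rule (F : fieldType) (x b b' da db da' db' : F) :
    b != 0 -> b' != 0 -> da * b' + x * b * db' = da' * b + x * b' * db ->
  (da' - x * db') / b' = (da - x * db) / b.
Proof.
move=> b0 b0' E; apply: (mulIf b0); apply: (mulIf b0'); rewrite mulfVK // mulrAC mulfVK //.
by rewrite !mulrBl [X in X - _](_ : _ = da * b' + x * b * db' - x * b' * db); [ring|rewrite E; ring].
Qed.

Lemma quotient_ruleD (F : fieldType) (x x' b b' da db da' db' : F) :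
    b != 0 -> b' != 0 ->
  (da * b' + x * b * db' + (da' * b + x' * b' * db) - (x + x') * (db * b' + b * db')) / (b * b')
  = (da - x * db) / b + (da' - x' * db') / b'.
Proof. by move=> b0 b0'; field; apply/andP. Qed.

Lemma quotient_ruleM (F : fieldType) (x x' b b' da db da' db' : F) :
    b != 0 -> b' != 0 ->
  (da * (x' * b') + x * b * da' - x * x' * (db * b' + b * db')) / (b * b')
  = (da - x * db) / b * x' + x * ((da' - x' * db') / b').
Proof. by move=> b0 b0'; field; apply/andP. Qed.

Section FractionDerivation.
Variables (R : idomainType) (d : R -> R).
Hypothesis dD : forall a b, d (a + b) = d a + d b.
Hypothesis dM : forall a b, d (a * b) = d a * b + a * d b.

Definition frac_deriv (x : {fraction R}) : {fraction R} :=
  let r := frac (repr x) in (tofrac (d r.1) - x * tofrac (d r.2)) / tofrac r.2.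

Lemma frac_derivE x a b : b != 0 -> x * tofrac b = tofrac a ->
  frac_deriv x = (tofrac (d a) - x * tofrac (d b)) / tofrac b.
Proof.
move=> b0 E; rewrite /frac_deriv; have [b0' E'] := frac_reprE x.
set r := frac (repr x) in b0' E' *.
have Eab : a * r.2 = r.1 * b.
  by apply/eqP; rewrite -tofrac_eq !rmorphM /= -E -E'; apply/eqP; ring.
have {Eab}/(congr1 (@tofrac R)) := congr1 d Eab.
rewrite !dM !rmorphD !rmorphM /= -E -E' => Eab.
rewrite -tofrac_eq0 in b0; rewrite -tofrac_eq0 in b0'.
exact: quotient_rule.
Qed.

Lemma frac_deriv_tofrac a : frac_deriv (tofrac a) = tofrac (d a).
Proof.
have d1 : d 1 = 0.
  by have := dM 1 1; rewrite !mulr1 mul1r -[X in X = _]addr0 => /addrI.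
rewrite (@frac_derivE _ a 1) ?oner_neq0 ?rmorph1 ?mulr1 //.
by rewrite d1 rmorph0 mulr0 subr0 divr1.
Qed.

Lemma frac_derivation : derivation frac_deriv.
Proof.
split=> x y; have [b0 Ex] := frac_reprE x; have [b0' Ey] := frac_reprE y.
all: move: (frac (repr x)) (frac (repr y)) b0 Ex b0' Ey => [a b] [a' b'] /= b0 Ex b0' Ey.
all: rewrite (frac_derivE b0 Ex) (frac_derivE b0' Ey).
  rewrite (@frac_derivE _ (a * b' + a' * b) (b * b')) ?mulf_neq0 //.
    rewrite !(dD, dM) !rmorphD !rmorphM /= -Ex -Ey.
    by apply: quotient_ruleD; rewrite tofrac_eq0.
  by rewrite !rmorphD !rmorphM /= -Ex -Ey; ring.
rewrite (@frac_derivE _ (a * a') (b * b')) ?mulf_neq0 //.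
  rewrite !dM !rmorphD !rmorphM /= -Ex -Ey.
  by apply: quotient_ruleM; rewrite tofrac_eq0.
by rewrite !rmorphM /= -Ex -Ey; ring.
Qed.
End FractionDerivation.

Section Derivations.
Variables (K L : fieldType) (phi : {rmorphism K -> L}) (D : L -> L).
Hypotheses (Dder : derivation D) (Dphi : forall c, D (phi c) = 0).

Let DD := Dder.1.
Let DM := Dder.2.

Lemma deriv_opp a : D (- a) = - D a.
Proof.
have D0 : D 0 = 0 by have := Dphi 0; rewrite rmorph0.
by apply/eqP; rewrite -addr_eq0 -DD addNr D0.
Qed.

Lemma deriv_horner (q : {poly K}) b :
  D (map_poly phi q).[b] = (map_poly phi q^`()).[b] * D b.
Proof.
elim/poly_ind: q => [|q c IH].
  by rewrite deriv0 !map_poly0 !horner0 mul0r; have := Dphi 0; rewrite rmorph0.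
rewrite derivD derivM derivX derivC addr0 mulr1 !rmorphD !rmorphM /= map_polyX map_polyC.
by rewrite !hornerE DD DM IH Dphi; ring.
Qed.

Lemma deriv_ev2 (A : {poly {poly K}}) a b :
  D (ev2 phi a b A) = ev2 phi a b A^`() * D a + ev2 phi a b (map_poly (@deriv K) A) * D b.
Proof.
elim/poly_ind: A => [|A q IH].
  by rewrite deriv0 !map_poly0 !rmorph0 !mul0r addr0; have := Dphi 0; rewrite rmorph0.
have -> : map_poly (@deriv K) (A * 'X + q%:P) = map_poly (@deriv K) A * 'X + (q^`())%:P.
  apply/polyP=> i; rewrite coef_map_id0 ?deriv0 // !coefD !coefMX !coefC derivD.
  by case: eqP => _; rewrite ?deriv0 // coef_map_id0 ?deriv0.
rewrite derivD derivM derivX derivC addr0 mulr1 !rmorphD !rmorphM /= ev2X.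
by rewrite !ev2C DD DM IH deriv_horner; ring.
Qed.

(** For D = X_i d/dX_i the Laurent monomials are eigenvectors and [m] is the exponent of X_i. Since
    eigenvalues add under products, the chain rule for a monomial substitution has the entries of
    its matrix as coefficients. *)
Definition eigen (l : L) (m : int) : Prop := D l = m%:~R * l.

Lemma eigenM l l' m m' : eigen l m -> eigen l' m' -> eigen (l * l') (m + m').
Proof. by move=> h h'; rewrite /eigen DM h h' intrD; ring. Qed.

Lemma eigen1 : eigen 1 0.
Proof. by have := Dphi 1; rewrite rmorph1 /eigen mul0r. Qed.

Lemma eigenV l m : l != 0 -> eigen l m -> eigen l^-1 (- m).
Proof.
move=> l0 h; have := eigen1; rewrite /eigen -{1}(mulfV l0) DM h mul0r => E.
apply: (mulfI l0); rewrite (_ : l * D l^-1 = - (m%:~R * l * l^-1)); last first.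
  by apply/eqP; rewrite -addr_eq0 addrC E.
by rewrite intrN; ring.
Qed.

Lemma eigenXz l m (z : int) : l != 0 -> eigen l m -> eigen (l ^ z) (m * z).
Proof.
move=> l0 h.
have hn n : eigen (l ^+ n) (m * n%:Z).
  elim: n => [|n IH]; first by rewrite mulr0; apply: eigen1.
  by rewrite exprS (_ : m * _ = m + m * n%:Z); [apply: eigenM|lia].
case: z => n; first exact: hn.
by rewrite NegzE -exprnN mulrN; apply: eigenV; rewrite ?expf_neq0.
Qed.

Lemma eigen_monom n (z : 'I_n -> L) (m : 'I_n -> int) u :
    (forall i, z i != 0) -> (forall i, eigen (z i) (m i)) ->
  eigen (monom z u) (\sum_i m i * u 0 i).
Proof.
move=> z0 h; apply: (big_ind2 eigen) => [|*|i _]; first exact: eigen1.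
  exact: eigenM.
exact: eigenXz.
Qed.
End Derivations.

Lemma log_derivation (K : fieldType) n (i : 'I_n) :
  exists D : ratfun K n -> ratfun K n,
    [/\ derivation D, forall c, D (rC n c) = 0
      & forall j, eigen D (rX K j) (i == j)%:Z].
Proof.
pose d (p : {mpoly K[n]}) := 'X_i * mderiv i p.
have dD a b : d (a + b) = d a + d b by rewrite /d mderivD mulrDr.
have dM a b : d (a * b) = d a * b + a * d b by rewrite /d mderivM; ring.
exists (frac_deriv d); split; first exact: frac_derivation.
  by move=> c; rewrite frac_deriv_tofrac // /d mderivC mulr0 rmorph0.
move=> j; rewrite /eigen frac_deriv_tofrac // /d mderivX mnm1E.
have [<-|ne] := eqVneq i j; last first.
  by rewrite scale0r mulr0 rmorph0 mul0r.
rewrite scale1r (_ : (_ - _)%MM = 0%MM) ?mpolyX0 ?mulr1 ?mul1r //.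
by apply/mnmP=> l; rewrite mnmBE subnn mnm0E.
Qed.

Lemma eigen_act_rX (K : fieldType) n (i : 'I_n) D (M : 'M[int]_n) j :
    derivation D -> (forall c : K, D (rC n c) = 0) ->
    (forall j, eigen D (rX K j) (i == j)%:Z) ->
  eigen D (act (@rX K n) M j) (M i j).
Proof.
move=> h1 h2 h3; rewrite monomE_act.
have -> : M i j = \sum_k (i == k)%:Z * (col j M)^T 0 k.
  rewrite (bigD1 i) //= eqxx mul1r !mxE big1 ?addr0 // => k /negPf ne.
  by rewrite eq_sym ne mul0r.
exact: (eigen_monom h1 h2 _ (@rX_neq0 K n) h3).
Qed.

(** * Exponents of bivariate polynomials *)

Lemma ev2_comp (K : fieldType) (R : comNzRingType) (phi : {rmorphism K -> R}) a b
    (A B : {poly {poly K}}) :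
  ev2 phi a b (A \Po B) = ev2 phi (ev2 phi a b B) b A.
Proof.
elim/poly_ind: A => [|A q IH]; first by rewrite comp_poly0 !rmorph0.
by rewrite comp_polyD comp_polyM comp_polyX comp_polyC !rmorphD !rmorphM /= IH ev2X !ev2C.
Qed.

Section Bivariate.
Variable K : fieldType.
Implicit Types (A F G : {poly {poly K}}) (x : K).

Definition dY A := map_poly (@deriv K) A.
Definition at_Y0 A : {poly K} := map_poly (horner_eval 0) A.
Definition ev_at x : {poly {poly K}} -> K := ev2 idfun x 0.
HB.instance Definition _ x := GRing.RMorphism.on (ev_at x).
Definition gen : {poly {poly K}} -> ratfun K 2 := ev2 (@rC K 2) (rX K 0) (rX K 1).
HB.instance Definition _ := GRing.RMorphism.on gen.

Lemma ev_atE x A : ev_at x A = (at_Y0 A).[x].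
Proof.
rewrite /ev_at /ev2 /at_Y0; congr (_.[x]); apply: eq_map_poly => q /=.
by rewrite map_poly_id.
Qed.

Lemma ev_at_deriv x A : ev_at x A^`() = (at_Y0 A)^`().[x].
Proof. by rewrite ev_atE /at_Y0 deriv_map. Qed.

(** Extended by 0 to exponents in Z^2 with a negative entry, so that affine integral maps can act on
    exponents. *)
Definition cf A (u : 'rV[int]_2) : K :=
  if (0 <= u 0 0) && (0 <= u 0 1) then A`_(`|(u 0 0)%R|%N)`_(`|(u 0 1)%R|%N) else 0.

Lemma ev2_sum (R : comNzRingType) (phi : {rmorphism K -> R}) a b A n :
    (size A <= n)%N -> (forall i, size (A`_i)%R <= n)%N ->
  ev2 phi a b A = \sum_(p : 'I_n * 'I_n) phi A`_(p.1)`_(p.2) * (a ^+ p.1 * b ^+ p.2).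
Proof.
move=> h1 h2; rewrite /ev2 (@horner_coef_wide _ n); last first.
  exact: leq_trans (size_poly _ _) h1.
rewrite -(pair_bigA _ (fun i j : 'I_n => phi A`_i`_j * (a ^+ i * b ^+ j))) /=.
apply: eq_bigr => i _.
rewrite (coef_map (horner_eval b \o map_poly phi)) /= /horner_eval.
rewrite (@horner_coef_wide _ n) ?mulr_suml; last first.
  exact: leq_trans (size_poly _ _) (h2 _).
by apply: eq_bigr => j _; rewrite coef_map; ring.
Qed.

Definition pair_exp n (p : 'I_n * 'I_n) : 'rV[int]_2 :=
  \row_i (if i == 0 then (p.1 : nat)%:Z else (p.2 : nat)%:Z).

Lemma pair_expE n (p : 'I_n * 'I_n) (L : fieldType) (z : 'I_2 -> L) :
  monom z (pair_exp p) = z 0 ^+ p.1 * z 1 ^+ p.2.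
Proof. by rewrite monom2E !mxE. Qed.

Lemma row2P (R : Type) (u v : 'rV[R]_2) : u 0 0 = v 0 0 -> u 0 1 = v 0 1 -> u = v.
Proof.
move=> h0 h1; apply/rowP=> i; case: (unliftP 0 i) => [j|] -> //.
by rewrite (ord1 j) (_ : lift _ _ = 1) //; apply: val_inj.
Qed.

Lemma cf_sum A n u :
    (size A <= n)%N -> (forall i, size (A`_i)%R <= n)%N ->
  \sum_(p : 'I_n * 'I_n | pair_exp p == u) A`_(p.1)`_(p.2) = cf A u.
Proof.
move=> h1 h2; rewrite /cf; case: ifP => [/andP[u0 u1]|hu]; last first.
  apply: big1 => p /eqP E; move: hu; rewrite -E !mxE //=.
have [hi|hi] := ltnP `|(u 0 0)%R|%N n; last first.
  rewrite (nth_default _ (leq_trans h1 hi)) coef0; apply: big1 => p /eqP E.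
  by move: hi; rewrite -E mxE /= leqNgt ltn_ord.
have [hj|hj] := ltnP `|(u 0 1)%R|%N n; last first.
  rewrite (nth_default _ (leq_trans (h2 _) hj)); apply: big1 => p /eqP E.
  by move: hj; rewrite -E mxE /= leqNgt ltn_ord.
rewrite (big_pred1 (Ordinal hi, Ordinal hj)) // => -[i j] /=.
apply/eqP/eqP=> [E|[-> ->]]; last first.
  by apply: row2P; rewrite !mxE /= ?gez0_abs.
by congr pair; apply: val_inj; rewrite /= -E mxE.
Qed.

Lemma bound2 A : exists n, (size A <= n)%N /\ forall i, (size (A`_i)%R <= n)%N.
Proof.
exists (maxn (size A) (\max_(i < size A) size (A`_i)%R)); rewrite leq_maxl; split=> // i.
have [hi|hi] := ltnP i (size A); last by rewrite nth_default // size_poly0.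
apply: leq_trans (leq_maxr _ _).
exact: (@leq_bigmax _ (fun i : 'I_(size A) => size (A`_i)%R) (Ordinal hi)).
Qed.

Lemma cf_bound A : exists n : nat, forall u, cf A u != 0 ->
  [/\ 0 <= u 0 0, 0 <= u 0 1, u 0 0 < n%:Z & u 0 1 < n%:Z].
Proof.
have [n [h1 h2]] := bound2 A; exists n => u; rewrite /cf.
case: ifP => [/andP[u0 u1]|_]; last by rewrite eqxx.
have [hi|hi] := ltnP `|(u 0 0)%R|%N n; last first.
  by rewrite (nth_default _ (leq_trans h1 hi)) coef0 eqxx.
have [hj|hj] := ltnP `|(u 0 1)%R|%N n; last first.
  by rewrite (nth_default _ (leq_trans (h2 _) hj)) eqxx.
by move=> _; split=> //; [move: (u 0 0 : int) u0 hi|move: (u 0 1 : int) u1 hj] => z; lia.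
Qed.

Lemma det2 (R : comNzRingType) (M : 'M[R]_2) : \det M = M 0 0 * M 1 1 - M 0 1 * M 1 0.
Proof.
rewrite (expand_det_row _ 0) !big_ord_recl big_ord0 addr0 /cofactor !det_mx11 !mxE /=.
rewrite expr0 mul1r expr1 mulN1r mulrN.
congr (M _ _ * M _ _ - M _ _ * M _ _); exact: val_inj.
Qed.

Lemma mul2_tr (M : 'M[int]_2) (u : 'rV[int]_2) i :
  (u *m M^T) 0 i = M i 0 * u 0 0 + M i 1 * u 0 1.
Proof.
rewrite mxE !big_ord_recl big_ord0 addr0 !mxE mulrC [X in _ + X]mulrC.
by congr (M _ _ * u _ _ + M _ _ * u _ _); apply: val_inj.
Qed.

(** The substitution sends the exponent u to w + u M^T. This map is injective because M is
    invertible, so exactly one monomial of A contributes to each such coefficient of G. *)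
Lemma gen_coef G A (k : K) (w : 'rV[int]_2) (M : 'M[int]_2) :
    \det M = 1 ->
    gen G = rC 2 k * monom (@rX K 2) w
            * ev2 (@rC K 2) (act (@rX K 2) M 0) (act (@rX K 2) M 1) A ->
  forall u, cf G (w + u *m M^T) = k * cf A u.
Proof.
move=> dM E u.
have [n1 [h1 h1']] := bound2 G; have [n2 [h2 h2']] := bound2 A.
pose n := maxn n1 n2.
have hG : (size G <= n)%N by rewrite (leq_trans h1) ?leq_maxl.
have hG' i : (size (G`_i)%R <= n)%N by rewrite (leq_trans (h1' i)) ?leq_maxl.
have hA : (size A <= n)%N by rewrite (leq_trans h2) ?leq_maxr.
have hA' i : (size (A`_i)%R <= n)%N by rewrite (leq_trans (h2' i)) ?leq_maxr.
(* The difference of the two sides is a single vanishing sum of monomials, indexed by those of G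
   and, with a minus sign, those of A. *)
pose c (p : 'I_n * 'I_n + 'I_n * 'I_n) :=
  match p with inl p => G`_(p.1)`_(p.2) | inr p => - (k * A`_(p.1)`_(p.2)) end.
pose e (p : 'I_n * 'I_n + 'I_n * 'I_n) :=
  match p with inl p => pair_exp p | inr p => w + pair_exp p *m M^T end.
have /laurent_coef/(_ (w + u *m M^T)) : \sum_p rC 2 (c p) * monom (@rX K 2) (e p) = 0.
  rewrite big_sumType /=.
  under eq_bigr => p _ do rewrite pair_expE.
  rewrite -(ev2_sum _ _ _ hG hG') -/(gen G) E (ev2_sum _ _ _ hA hA') mulr_sumr -big_split.
  apply: big1 => p _ /=; rewrite monomD; last exact: rX_neq0.
  rewrite -monom_actE; last exact: rX_neq0.
  by rewrite pair_expE rmorphN rmorphM /=; ring.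
rewrite big_sumType /= cf_sum // => /eqP.
under eq_bigl => p.
  have -> : (w + pair_exp p *m M^T == w + u *m M^T) = (pair_exp p == u).
    rewrite (inj_eq (addrI _)); apply/eqP/eqP=> [|-> //].
    by apply: (can_inj (mulmxK _)); rewrite unitmx_tr unitmxE dM unitr1.
  over.
by rewrite sumrN -mulr_sumr cf_sum // subr_eq0 => /eqP.
Qed.

Lemma gen_inj A : gen A = 0 -> A = 0.
Proof.
have [n [h1 h2]] := bound2 A.
rewrite /gen (ev2_sum _ _ _ h1 h2) => E.
have {}E : \sum_(p : 'I_n * 'I_n) rC 2 (A`_(p.1)`_(p.2)) * monom (@rX K 2) (pair_exp p) = 0.
  by rewrite -[RHS]E; apply: eq_bigr => p _; rewrite pair_expE.
apply/polyP=> i; apply/polyP=> j.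
have := laurent_coef E (\row_l (if l == 0 then i%:Z else j%:Z)).
by rewrite cf_sum // /cf !mxE /= !coef0.
Qed.
End Bivariate.

(** * The effect of an elementary step on N and r *)

(* With [fX], [fY] the partial derivatives of Phi in coordinates (X - c(Y), Y),
   [gX], [gY] those of [g] in coordinates (x, y), X = x^a y^p and Y = x^b y^q,
   the chain rule equations express X fX and Y fY through g, x gX and y gY. *)
Lemma step_identity (L : comNzRingType) (x y X Y cp fX fY Phi g gX gY mu a b p q w0 w1 YN E A B C : L) :
    a * q - b * p = 1 -> g = mu * Phi ->
    gX * x = w0 * mu * Phi + mu * (fX * (a * X - cp * (b * Y)) + fY * (b * Y)) ->
    gY * y = w1 * mu * Phi + mu * (fX * (p * X - cp * (q * Y)) + fY * (q * Y)) ->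
    YN * E = A * Phi + B * fX + C * (Y * fY) ->
  mu * YN * X * E =
    (A * X + (B + C * cp * Y) * (b * w1 - q * w0) + C * X * (p * w0 - a * w1)) * g
    + (((B + C * cp * Y) * q - C * X * p) * x) * gX
    + (C * X * a - (B + C * cp * Y) * b) * (y * gY).
Proof.
move=> det -> e0 e1 hN.
have -> : mu * YN * X * E = mu * X * (YN * E) by ring.
rewrite hN.
have h1 : q * (gX * x) - b * (gY * y)
    = (q * w0 - b * w1) * mu * Phi + mu * (fX * X) * (a * q - b * p).
  by rewrite e0 e1; ring.
have h2 : a * (gY * y) - p * (gX * x)
    = (a * w1 - p * w0) * mu * Phi + mu * (Y * fY - fX * cp * Y) * (a * q - b * p).
  by rewrite e0 e1; ring.
rewrite det mulr1 in h1; rewrite det mulr1 in h2.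
have {h1} h1 : mu * (fX * X) = q * (gX * x) - b * (gY * y) - (q * w0 - b * w1) * mu * Phi.
  by rewrite h1; ring.
have {h2} h2 : mu * (Y * fY) = a * (gY * y) - p * (gX * x) - (a * w1 - p * w0) * mu * Phi
    + mu * fX * cp * Y.
  by rewrite h2; ring.
transitivity (A * X * (mu * Phi) + B * (mu * (fX * X)) + C * X * (mu * (Y * fY))); first by ring.
rewrite h2 mulrDr [C * X * (mu * fX * cp * Y)](_ : _ = C * cp * Y * (mu * (fX * X))); last by ring.
by rewrite h1; ring.
Qed.

Lemma ev2_XsubC (K : fieldType) (R : comNzRingType) (phi : {rmorphism K -> R}) a b
    (c : {poly K}) :
  ev2 phi a b ('X - c%:P) = a - (map_poly phi c).[b].
Proof. by rewrite ev2B ev2X ev2C. Qed.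

(** The origin of the new exponent q N + p + w1 of y: q N comes from Y^N, w1 from the monomial
    factor of the new equation, and p from the extra factor X in [step_identity]. The power of x is
    a unit at the points considered and is absorbed into the cofactor. *)
Lemma step_exponents (L : fieldType) (x y k l : L) (a b p q w0 w1 : int) (N : nat) :
    x != 0 -> y != 0 ->
  y ^ (q * N%:Z + p + w1) * (k * (x ^ (w0 + b * N%:Z + a) * l))
  = k * (x ^ w0 * y ^ w1) * (x ^ b * y ^ q) ^+ N * (x ^ a * y ^ p) * l.
Proof. by move=> x0 y0; rewrite exprMn !exprnP !exprz_exp !expfzDr //; ring. Qed.

Section Descent.
Variable K : fieldType.
Implicit Types (A F G : {poly {poly K}}) (x k : K) (c : {poly K}).

(* Y^N lies in the ideal generated by F, F_X and Y F_Y in the local ring of the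
   plane at (x, 0). For a multiple root x of F(X, 0) the least such N measures
   how far F is from being reduced at (x, 0). *)
Definition ncond F x (N : nat) : Prop :=
  exists E A B C, ev_at x E != 0 /\
    ('X ^+ N)%:P * E = A * F + B * F^`() + C * ('X%:P * dY F).

Lemma genD A B : gen (A + B) = gen A + gen B.
Proof. exact: rmorphD. Qed.
Lemma genM A B : gen (A * B) = gen A * gen B.
Proof. exact: rmorphM. Qed.
Lemma ev_atM x A B : ev_at x (A * B) = ev_at x A * ev_at x B.
Proof. exact: rmorphM. Qed.
Lemma genI A B : gen A = gen B -> A = B.
Proof.
move=> E; apply/eqP; rewrite -subr_eq0; apply/eqP/gen_inj.
by apply: (@addIr _ (gen B)); rewrite -genD subrK add0r.
Qed.
Lemma gen_CC k : gen (k%:P%:P) = rC 2 k.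
Proof. exact: ev2CC. Qed.
Lemma gen_YX n : gen ('X^n)%:P = rX K 1 ^+ n.
Proof. by rewrite /gen ev2C map_polyXn hornerXn. Qed.
Lemma gen_X : gen 'X = rX K 0.
Proof. exact: ev2X. Qed.
Lemma gen_Y : gen ('X%:P) = rX K 1.
Proof. exact: ev2Y. Qed.
Lemma ev_at_X x : ev_at x 'X = x.
Proof. exact: ev2X. Qed.
Lemma ev_at_Y x : ev_at x ('X%:P) = 0.
Proof. exact: ev2Y. Qed.
Lemma ev_at_CC x k : ev_at x k%:P%:P = k.
Proof. exact: ev2CC. Qed.

Lemma germ_ev2 (L : fieldType) (R : comNzRingType) (ev : {rmorphism R -> L}) (ev0 : {rmorphism R -> K})
    (phi : {rmorphism K -> L}) a va b vb A :
    (forall k, germ ev ev0 (phi k) k) -> germ ev ev0 a va -> germ ev ev0 b vb ->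
  germ ev ev0 (ev2 phi a b A) (ev2 idfun va vb A).
Proof.
move=> hk ha hb; elim/poly2_ind: A => [k|||A B IHA IHB|A B IHA IHB].
- by rewrite !ev2CC.
- by rewrite !ev2X.
- by rewrite !ev2Y.
- by rewrite !rmorphD; apply: germD.
- by rewrite !rmorphM; apply: germM.
Qed.

Local Notation germ_at x := (@germ K (ratfun K 2) {poly {poly K}} (@gen K) (ev_at x)).

Lemma germ_gen x A : germ_at x (gen A) (ev_at x A).
Proof. exact: germ_ev. Qed.
Lemma germ_gen_const x k : germ_at x (rC 2 k) k.
Proof. by have := germ_gen x k%:P%:P; rewrite gen_CC ev_at_CC. Qed.
Lemma germ_gen_X x : germ_at x (rX K 0) x.
Proof. by have := germ_gen x 'X; rewrite gen_X ev_at_X. Qed.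
Lemma germ_gen_Y x : germ_at x (rX K 1) 0.
Proof. by have := germ_gen x ('X%:P); rewrite gen_Y ev_at_Y. Qed.
Lemma gen_ker x A : gen A = 0 -> ev_at x A = 0.
Proof. by move/gen_inj->; rewrite rmorph0. Qed.

(** If N <= 0, dividing by Y^N would express [l] through F, F_X and Y F_Y with germs as
    coefficients. All three vanish at (x, 0), whereas [l] has the value v <> 0 there. *)
Lemma ncond_of_germ F x (N : int) l v a va b vb e ve :
    ev_at x F = 0 -> ev_at x F^`() = 0 -> v != 0 ->
    germ_at x l v -> germ_at x a va ->
    germ_at x b vb -> germ_at x e ve ->
    rX K 1 ^ N * l = a * gen F + b * gen F^`() + e * (rX K 1 * gen (dY F)) ->
  0 < N /\ ncond F x `|N|%N.
Proof.
move=> F0 F0' v0 hl ha hb he E.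
have y0 : rX K 1 != 0 :> ratfun K 2 by apply: rX_neq0.
have Npos : 0 < N.
  have [//|N0] := boolP (0 < N); case/eqP: v0.
  have {}E : l = rX K 1 ^+ `|N|%N * (a * gen F + b * gen F^`() + e * (rX K 1 * gen (dY F))).
    by rewrite -E mulrA exprnP -expfzDr // (_ : _ + _ = 0) ?expr0z ?mul1r //; lia.
  apply: (germ_inj (@gen_ker x) hl); rewrite E -[X in germ _ _ _ X](mulr0 (0 ^+ `|N|%N)).
  apply: germM; first by apply: germX; apply: germ_gen_Y.
  rewrite (_ : 0 = va * ev_at x F + vb * ev_at x F^`() + ve * (0 * ev_at x (dY F))).
    apply: germD; last by do !apply: germM => //; [exact: germ_gen_Y|exact: germ_ev].
    by apply: germD; apply: germM => //; apply: germ_ev.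
  by rewrite F0 F0' !(mulr0, mul0r, addr0).
split=> //; move: hl ha hb he => [h1 [s1 [n1 e1 e1']]] [h2 [s2 [n2 e2 _]]].
move=> [h3 [s3 [n3 e3 _]]] [h4 [s4 [n4 e4 _]]].
(* All four germs are cleared by the common denominator s1 s2 s3 s4, which does not vanish at (x,
   0). *)
exists (h1 * s2 * s3 * s4), (h2 * s1 * s3 * s4), (h3 * s1 * s2 * s4), (h4 * s1 * s2 * s3).
split; first by rewrite !ev_atM e1' !mulf_neq0.
apply: genI; rewrite !(genD, genM) gen_YX gen_Y -e1 -e2 -e3 -e4.
have -> : rX K 1 ^+ `|N|%N = rX K 1 ^ N :> ratfun K 2 by rewrite exprnP gtz0_abs.
transitivity (rX K 1 ^ N * l * (gen s1 * gen s2 * gen s3 * gen s4)); first by ring.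
by rewrite E; ring.
Qed.

Lemma mupP_ge2 x F : at_Y0 F != 0 -> (2 <= mup x (at_Y0 F))%N ->
  ev_at x F = 0 /\ ev_at x F^`() = 0.
Proof.
move=> F0; rewrite mup_geq // ev_atE ev_at_deriv => /dvdpP[q ->].
by rewrite expr2 !derivM derivXsubC; split;
  rewrite !(hornerXsubC, hornerM, hornerD) subrr !(mulr0, mul0r, addr0).
Qed.

Section Step.
Variables (F G : {poly {poly K}}) (c : {poly K}) (x0 x k : K).
Variables (w : 'rV[int]_2) (M : 'M[int]_2).
Let X_ := act (@rX K 2) M 0.
Let Y_ := act (@rX K 2) M 1.
Hypotheses (dM : \det M = 1) (M10 : 0 < M 1 0) (M11 : 0 < M 1 1).
Hypotheses (xn0 : x != 0) (kn0 : k != 0) (hx0 : x0 = - c.[0]).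
Hypothesis hG : gen G = rC 2 k * monom (@rX K 2) w
  * ev2 (@rC K 2) X_ Y_ (F \Po ('X - c%:P)).

Let cY := (map_poly (@rC K 2) c).[Y_].
Let xi := X_ - cY.

(** Both entries of the last row of M are positive, so each monomial contains a positive power of Y;
    the power of X may be negative but is harmless at x1 <> 0. *)
Lemma germ_act x1 (j : 'I_2) : x1 != 0 -> germ_at x1 (act (@rX K 2) M j) 0.
Proof.
move=> n1; rewrite act2E -[X in germ _ _ _ X](mulr0 (x1 ^ M 0 j)).
apply: germM; first by apply: (germXz (@gen_ker x1)) => //; apply: germ_gen_X.
have hM : 0 < M 1 j.
  case: (unliftP 0 j) => [j'|] -> //.
  by rewrite (ord1 j') (_ : lift _ _ = 1) //; apply: val_inj.
have -> : rX K 1 ^ M 1 j = rX K 1 ^+ `|M 1%R j|%N :> ratfun K 2.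
  by rewrite exprnP gtz0_abs.
rewrite (_ : 0 = 0 ^+ `|M 1%R j|%N :> K); first by apply: germX; apply: germ_gen_Y.
by rewrite expr0n absz_eq0; case: eqP hM => // ->.
Qed.

Lemma germ_cY x1 (p : {poly K}) : x1 != 0 ->
  germ_at x1 (map_poly (@rC K 2) p).[Y_] p.[0].
Proof.
move=> n1; have := germ_ev2 p%:P (germ_gen_const x1) (germ_act 0 n1) (germ_act 1 n1).
by rewrite !ev2C (@map_poly_id _ idfun p).
Qed.

Lemma germ_xi x1 : x1 != 0 -> germ_at x1 xi x0.
Proof.
by move=> n1; rewrite hx0 -[- _]add0r; apply: germB; [exact: germ_act|exact: germ_cY].
Qed.

Lemma ncond_step N : ev_at x G = 0 -> ev_at x G^`() = 0 -> ncond F x0 N ->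
  let N' := M 1 1 * N%:Z + M 1 0 + w 0 1 in 0 < N' /\ ncond G x `|N'|%N.
Proof.
move=> G0 G0' [E [A [B [C [En0 hN]]]]] N'.
have z0 i : rX K i != 0 :> ratfun K 2 by apply: rX_neq0.
set mu := rC 2 k * monom (@rX K 2) w.
have comp A' : ev2 (@rC K 2) X_ Y_ (A' \Po ('X - c%:P)) = ev2 (@rC K 2) xi Y_ A'.
  by rewrite ev2_comp ev2_XsubC.
have hG1 := hG; rewrite comp in hG1.
have [D0 [d0 dc0 dX0]] := log_derivation K (0 : 'I_2).
have [D1 [d1 dc1 dX1]] := log_derivation K (1 : 'I_2).
have emu (D : ratfun K 2 -> ratfun K 2) (i : 'I_2) : derivation D -> (forall e : K, D (rC 2 e) = 0) ->
    (forall j, eigen D (rX K j) (i == j)%:Z) -> D mu = (w 0 i)%:~R * mu.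
  move=> h1 h2 h3; rewrite /mu h1.2 h2 mul0r add0r (eigen_monom h1 h2 w z0 h3).
  rewrite (bigD1 i) //= eqxx mul1r big1 ?addr0 => [|j /negPf ne]; first by ring.
  by rewrite eq_sym ne mul0r.
have dxi (D : ratfun K 2 -> ratfun K 2) : derivation D -> (forall e : K, D (rC 2 e) = 0) ->
    D xi = D X_ - (map_poly (@rC K 2) c^`()).[Y_] * D Y_.
  by move=> h1 h2; rewrite /xi h1.1 (deriv_opp h1 h2) (deriv_horner h1 h2).
have dgX (D : ratfun K 2 -> ratfun K 2) i : derivation D -> (forall e : K, D (rC 2 e) = 0) ->
    (forall j, eigen D (rX K j) (i == j)%:Z) ->
    D (gen G) = (if i == 0 then gen G^`() * rX K 0 else gen (dY G) * rX K 1).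
  move=> h1 h2 h3; rewrite [LHS](deriv_ev2 h1 h2) !h3.
  case: (unliftP 0 i) => [i'|] ->; last by rewrite mul1r mul0r mulr0 addr0.
  rewrite (ord1 i') (_ : lift _ _ = 1); last exact: val_inj.
  by rewrite mul1r mul0r mulr0 add0r.
have eqX (D : ratfun K 2 -> ratfun K 2) i : derivation D -> (forall e : K, D (rC 2 e) = 0) ->
    (forall j, eigen D (rX K j) (i == j)%:Z) ->
    D (gen G) = (w 0 i)%:~R * mu * ev2 (@rC K 2) xi Y_ F + mu *
     (ev2 (@rC K 2) xi Y_ F^`() * ((M i 0)%:~R * X_ - (map_poly (@rC K 2) c^`()).[Y_] * ((M i 1)%:~R * Y_))
      + ev2 (@rC K 2) xi Y_ (dY F) * ((M i 1)%:~R * Y_)).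
  move=> h1 h2 h3; rewrite hG1 h1.2 (emu D i) //; congr (_ + _ * _).
  rewrite (deriv_ev2 h1 h2) (dxi D) //.
  by rewrite [D X_](eigen_act_rX M 0 h1 h2 h3) [D Y_](eigen_act_rX M 1 h1 h2 h3).
(* Applying X d/dX and Y d/dY to the two expressions for G yields the two chain rule hypotheses of
   [step_identity]. *)
have e0 := eqX D0 0 d0 dc0 dX0; rewrite (dgX D0 0) //= in e0.
have e1 := eqX D1 1 d1 dc1 dX1; rewrite (dgX D1 1) //= in e1.
have hN' := congr1 (ev2 (@rC K 2) xi Y_) hN.
rewrite !rmorphD !rmorphM /= !ev2C map_polyXn map_polyX hornerXn hornerX in hN'.
have det : (M 0 0)%:~R * (M 1 1)%:~R - (M 0 1)%:~R * (M 1 0)%:~R = 1 :> ratfun K 2.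
  by rewrite -!intrM -intrB -det2 dM.
have key := step_identity det hG1 e0 e1 hN'.
have gact j : germ_at x (act (@rX K 2) M j) 0 by exact: germ_act.
have gpol A' : germ_at x (ev2 (@rC K 2) xi Y_ A') (ev_at x0 A').
  exact: germ_ev2 (germ_gen_const x) (germ_xi xn0) (gact 1).
have gint (z : int) : germ_at x z%:~R z%:~R.
  by have := germ_gen_const x z%:~R; rewrite rmorph_int.
have gc : germ_at x (map_poly (@rC K 2) c^`()).[Y_] (c^`()).[0] by exact: germ_cY.
(* The total power of X in the left-hand side of [key]; it is a unit at (x, 0). *)
pose z := w 0 0 + M 0 1 * N%:Z + M 0 0.
have gl : germ_at x (rC 2 k * (rX K 0 ^ z * ev2 (@rC K 2) xi Y_ E)) (k * (x ^ z * ev_at x0 E)).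
  apply: germM; first exact: germ_gen_const.
  apply: germM => //; apply: (germXz (@gen_ker x)) => //; exact: germ_gen_X.
have vn0 : k * (x ^ z * ev_at x0 E) != 0 by rewrite !mulf_neq0 ?expfz_neq0.
apply: (ncond_of_germ G0 G0' vn0 gl _ _ _ (etrans _ key)).
- by do ?[exact: gpol|exact: gact|exact: gc|exact: gint|apply: germD|apply: germN|apply: germM].
- by do ?[exact: gpol|exact: gact|exact: gc|exact: gint|exact: germ_gen_X
         |apply: germD|apply: germN|apply: germM].
- by do ?[exact: gpol|exact: gact|exact: gc|exact: gint|apply: germD|apply: germN|apply: germM].
have EX : X_ = rX K 0 ^ M 0 0 * rX K 1 ^ M 1 0 := act2E _ _ _.
have EY : Y_ = rX K 0 ^ M 0 1 * rX K 1 ^ M 1 1 := act2E _ _ _.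
rewrite /mu monom2E EX EY; exact: step_exponents (z0 0) (z0 1).
Qed.
End Step.
End Descent.

(** A root x <> 0 is a root of P / X^m with the same multiplicity, so this multiplicity is at most
    the distance between the extreme exponents of P: the lattice length of an edge. *)
Lemma mup_sparse (K : fieldType) (P : {poly K}) (x : K) m :
    P != 0 -> x != 0 -> (forall i, P`_i != 0 -> (m <= i)%N) ->
  (mup x P + m <= (size P).-1)%N.
Proof.
move=> P0 x0 hm; set Q := drop_poly m P.
have EP : P = Q * 'X^m.
  rewrite -[LHS](poly_take_drop m) (_ : take_poly m P = 0) ?add0r //.
  apply/polyP=> i; rewrite coef_take_poly coef0; case: ltnP => // lt_im.
  by apply/eqP; apply: contraLR lt_im => /hm; rewrite -leqNgt.
have Q0 : Q != 0 by apply: contraNneq P0 => E; rewrite EP E mul0r.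
have Xr : ~~ root ('X^m : {poly K}) x by rewrite rootE hornerXn expf_neq0.
have hdvd : ('X - x%:P) ^+ mup x Q %| Q by rewrite -mup_geq.
have := dvdp_leq Q0 hdvd; rewrite size_exp_XsubC => hs.
rewrite EP mupMl // size_mulXn //; by case: (size Q) hs => // s; rewrite ltnS addnS addnC leq_add2l.
Qed.

(** * The multiplicity r and the edges of the Newton polygon *)

Section MultiplicityStep.
Variable K : fieldType.
Implicit Types (A F G : {poly {poly K}}).

Definition mk2 (i j : int) : 'rV[int]_2 := \row_l (if l == 0 then i else j).

Lemma cf_mk2 A (i j : nat) : cf A (mk2 i j) = A`_i`_j.
Proof. by rewrite /cf !mxE. Qed.

Lemma cf_Y0 A (i : nat) : cf A (mk2 i 0) = (at_Y0 A)`_i.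
Proof.
rewrite (cf_mk2 A i 0) /at_Y0 (coef_map (horner_eval 0)) /= /horner_eval.
by rewrite horner_coef0.
Qed.

Lemma at_Y0_comp F (c : {poly K}) :
  at_Y0 (F \Po ('X - c%:P)) = at_Y0 F \Po ('X - c.[0]%:P).
Proof.
rewrite /at_Y0 map_comp_poly rmorphB /= map_polyX (map_polyC (horner_eval 0)).
by [].
Qed.

(** The translation moves the root x0 to the origin: (X - x0)^r Q becomes X^r Q(X + x0) with Q(x0)
    <> 0, which places the point (r, 0) in the Newton polygon. *)
Lemma coef_mup F (c : {poly K}) x0 :
    at_Y0 F != 0 -> x0 = - c.[0] ->
  cf (F \Po ('X - c%:P)) (mk2 (mup x0 (at_Y0 F)) 0) != 0.
Proof.
move=> F0 hx; rewrite cf_Y0 at_Y0_comp; set P := at_Y0 F; set r := mup x0 P.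
have /dvdpP[Q EQ] : ('X - x0%:P) ^+ r %| P by rewrite -mup_geq.
have Qr : Q.[x0] != 0.
  apply/negP=> /eqP/rootP; rewrite -dvdp_XsubCl => /dvdpP[Q' E].
  have : (r < r)%N by rewrite -[X in (_ < X)%N]/(mup x0 P) mup_geq // EQ E -mulrA -exprS dvdp_mull.
  by rewrite ltnn.
rewrite EQ comp_polyM rmorphXn /= comp_polyB comp_polyX comp_polyC.
rewrite (_ : 'X - _ - _ = 'X); last by rewrite hx polyCN opprK subrK.
by rewrite coefMXn ltnn subnn -horner_coef0 horner_comp hornerXsubC sub0r -hx.
Qed.

Section Step.
Variables (A G : {poly {poly K}}) (k : K) (w : 'rV[int]_2) (M : 'M[int]_2).
Hypotheses (dM : \det M = 1) (M10 : 0 < M 1 0) (M11 : 0 < M 1 1) (kn0 : k != 0).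
Hypothesis hG : gen G = rC 2 k * monom (@rX K 2) w
  * ev2 (@rC K 2) (act (@rX K 2) M 0) (act (@rX K 2) M 1) A.

Let det : M 0 0 * M 1 1 - M 0 1 * M 1 0 = 1.
Proof. by rewrite -det2. Qed.

(* The exponents (pre_i, pre_j) of the monomial of A that yields X^e in G(X, 0). *)
Definition pre_i (e : int) : int := M 1 1 * (e - w 0 0) + M 0 1 * w 0 1.
Definition pre_j (e : int) : int := - (M 1 0 * (e - w 0 0)) - M 0 0 * w 0 1.

Lemma coef_pre (e : nat) : (at_Y0 G)`_e = k * cf A (mk2 (pre_i e) (pre_j e)).
Proof.
rewrite -cf_Y0 -(gen_coef dM hG); congr cf; apply: row2P.
  rewrite [RHS]mxE mul2_tr !mxE /= /pre_i /pre_j.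
  transitivity (w 0 0 + (M 0 0 * M 1 1 - M 0 1 * M 1 0) * (e%:Z - w 0 0)).
    by rewrite det; ring.
  by ring.
rewrite [RHS]mxE mul2_tr !mxE /= /pre_i /pre_j.
transitivity (w 0 1 - (M 0 0 * M 1 1 - M 0 1 * M 1 0) * w 0 1); first by rewrite det; ring.
by ring.
Qed.

(** The monomials of A that survive in G(X, 0) lie on one line, with normal vector the last row of
    M. *)
Lemma pre_line e : M 1 0 * pre_i e + M 1 1 * pre_j e = - w 0 1.
Proof.
rewrite /pre_i /pre_j.
transitivity (- (M 0 0 * M 1 1 - M 0 1 * M 1 0) * w 0 1); last by rewrite det; ring.
by ring.
Qed.

(** The image of (r, 0) is an exponent of the polynomial G, so its Y-entry w 0 1 + M 1 0 * r is
    nonnegative. The line of [pre_line] therefore meets the X-axis at or before r. *)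
Lemma pre_bounds (r e : nat) : cf A (mk2 r 0) != 0 -> (at_Y0 G)`_e != 0 ->
  [/\ 0 <= pre_i e, pre_i e <= r%:Z, 0 <= pre_j e & 0 <= w 0 1 + M 1 0 * r%:Z].
Proof.
move=> hr; rewrite coef_pre mulf_eq0 negb_or => /andP[_ he].
have [n /(_ _ he)] := cf_bound A; rewrite !mxE /= => -[h1 h2 _ _].
have : cf G (w + mk2 r 0 *m M^T) != 0 by rewrite (gen_coef dM hG) mulf_neq0.
have [n' h] := cf_bound G; case/h=> _ h3 _ _ {h}.
have {}h3 : 0 <= w 0 1 + M 1 0 * r%:Z.
  by move: h3; rewrite [X in 0 <= X]mxE mul2_tr !mxE /= mulr0 addr0.
move: (pre_line e) h1 h2 h3 M10 M11; move: (pre_i e) (pre_j e) (M 1 0) (M 1 1) (w 0 1).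
move=> i j p q w1 hl i0 j0 hw p0 q0.
by split=> //; nia.
Qed.

(** Let (b1, b2) be the last row of M. Raising the exponent in G(X, 0) by 1 moves along the edge by
    (b2, -b1), and the edge stays in 0 <= i <= r. Thus b2 r' <= r, by [mup_sparse]. If r' = r > 0,
    then b2 = 1 and the edge runs from i = 0 to (r, 0), which determines [w 0 1]. *)
Lemma mult_step (r : nat) (x : K) :
    cf A (mk2 r 0) != 0 -> at_Y0 G != 0 -> x != 0 ->
  let r' := mup x (at_Y0 G) in
  (r' <= r)%N /\ (r' = r -> (0 < r)%N -> w 0 1 = - (M 1 0 * r%:Z) /\ M 1 1 = 1).
Proof.
move=> hr G0 x0 r'.
have hex : exists i, (at_Y0 G)`_i != 0.
  by exists (size (at_Y0 G)).-1; rewrite -lead_coefE lead_coef_eq0.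
have [m hm hmin] := ex_minnP hex.
have := mup_sparse G0 x0 hmin; rewrite -/r'; set d := (size _).-1 => hd.
have hdn : (at_Y0 G)`_d != 0 by rewrite -lead_coefE lead_coef_eq0.
have [hi1 hi2 hj1 hw] := pre_bounds hr hm.
have [hi1' hi2' hj1' _] := pre_bounds hr hdn.
have hl := pre_line d; have hq := M11; have hp := M10.
have hdm : pre_i d = pre_i m + M 1 1 * (d%:Z - m%:Z) by rewrite /pre_i; ring.
move: (pre_i d) (pre_i m) (pre_j d) (pre_j m) (w 0 1) (M 1 0) (M 1 1)
  hi1 hi2 hj1 hw hi1' hi2' hj1' hl hq hp hdm => i i' j j' w1 p q.
move=> *; split; first by nia.
move=> Er r0; have ? : q = 1 by nia.
by subst q; split=> //; nia.
Qed.

(** A nonzero root forces two distinct monomials in G(X, 0). Their preimages differ by a positive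
    multiple of (b2, -b1) and lie in a box of side n. This leaves finitely many charts over each
    centre. *)
Lemma edge_bound x : at_Y0 G != 0 -> x != 0 -> root (at_Y0 G) x ->
  forall n : nat, (forall u, cf A u != 0 -> [/\ 0 <= u 0 0, 0 <= u 0 1, u 0 0 < n%:Z & u 0 1 < n%:Z]) ->
  M 1 0 < n%:Z /\ M 1 1 < n%:Z.
Proof.
move=> G0 x0 rx n hn.
have hex : exists i, (at_Y0 G)`_i != 0.
  by exists (size (at_Y0 G)).-1; rewrite -lead_coefE lead_coef_eq0.
have [m hm hmin] := ex_minnP hex.
have := mup_sparse G0 x0 hmin; set d := (size _).-1 => hd.
have hdn : (at_Y0 G)`_d != 0 by rewrite -lead_coefE lead_coef_eq0.
have hmup : (0 < mup x (at_Y0 G))%N by rewrite -XsubC_dvd // dvdp_XsubCl.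
have hb (e : nat) : (at_Y0 G)`_e != 0 ->
    [/\ 0 <= pre_i e, 0 <= pre_j e, pre_i e < n%:Z & pre_j e < n%:Z].
  rewrite coef_pre mulf_eq0 negb_or => /andP[_ he].
  by have := hn _ he; rewrite !mxE.
have [h1 h2 h3 h4] := hb _ hm; have [h1' h2' h3' h4'] := hb _ hdn.
have hq := M11; have hp := M10.
have hdi : pre_i d = pre_i m + M 1 1 * (d%:Z - m%:Z) by rewrite /pre_i; ring.
have hdj : pre_j d = pre_j m - M 1 0 * (d%:Z - m%:Z) by rewrite /pre_j; ring.
have hlt : (m < d)%N by apply: leq_trans hd; rewrite -add1n leq_add2r.
move: (pre_i d) (pre_i m) (pre_j d) (pre_j m) (M 1 0) (M 1 1)
  h1 h2 h3 h4 h1' h2' h3' h4' hq hp hdi hdj => i i' j j' p q *.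
by split; nia.
Qed.
End Step.
End MultiplicityStep.

(** * Existence of N on the first charts *)

Lemma two_coefs_root (K : closedFieldType) (P : {poly K}) i j :
  (i < j)%N -> P`_i != 0 -> P`_j != 0 -> exists x, x != 0 /\ P.[x] = 0.
Proof.
move=> lt_ij Pi Pj.
have [m Pm hmin] := ex_minnP (ex_intro (fun i => P`_i != 0) i Pi).
set Q := drop_poly m P.
have EP : P = Q * 'X^m.
  rewrite -[LHS](poly_take_drop m) (_ : take_poly m P = 0) ?add0r //.
  apply/polyP=> l; rewrite coef_take_poly coef0; case: ltnP => // lt_lm.
  by apply/eqP; apply: contraLR lt_lm => /hmin; rewrite -leqNgt.
have le_mi := hmin i Pi.
have Q0 : Q`_0 != 0 by rewrite coef_drop_poly add0n.
have sQ : size Q != 1%N.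
  apply/negP=> /eqP sQ; move: Pj; rewrite -(subnK (ltnW (leq_ltn_trans le_mi lt_ij))).
  rewrite -coef_drop_poly nth_default ?eqxx // sQ subn_gt0.
  exact: leq_ltn_trans lt_ij.
have /closed_rootP[x rx] := sQ; exists x; split.
  by apply: contraTneq rx => ->; rewrite rootE horner_coef0.
by rewrite EP hornerM (rootP rx) mul0r.
Qed.

Lemma nonroot (K : closedFieldType) (P : {poly K}) : P != 0 -> exists x, P.[x] != 0.
Proof. by case/closed_nonrootP=> x; exists x. Qed.

Section BaseCondition.
Variable K : closedFieldType.
Implicit Types F G : {poly {poly K}}.

Lemma single_coef G : G != 0 ->
    (forall i j, (i < j)%N -> G`_i != 0 -> G`_j != 0 -> False) ->
  exists m, G = (lead_coef G)%:P * 'X^m.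
Proof.
move=> G0 h; exists (size G).-1; apply/polyP=> i; rewrite coefCM coefXn.
have Gl : G`_(size G).-1 != 0 by rewrite -lead_coefE lead_coef_eq0.
case: eqP => [->|ne]; first by rewrite mulr1.
rewrite mulr0; apply/eqP/negPn/negP=> Gi.
have [lt|lt|//] := ltngtP i (size G).-1; first exact: h lt Gi Gl.
exact: h lt Gl Gi.
Qed.

Lemma dvdp_eval G F x y (r : {poly K}) (Q : {poly {poly K}}) :
    r *: F = Q * G -> r.[y] != 0 -> ev2 idfun x y G = 0 -> ev2 idfun x y F = 0.
Proof.
move=> E ry G0; have := congr1 (ev2 idfun x y) E.
rewrite -mul_polyC !rmorphM /= G0 mulr0 ev2C map_poly_id // => /eqP.
by rewrite mulf_eq0 (negPf ry) => /eqP.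
Qed.

Lemma ncond_base F x : F != 0 -> x != 0 ->
    (forall x0 y0, x0 != 0 -> y0 != 0 -> ev2 idfun x0 y0 F = 0 ->
       ev2 idfun x0 y0 F^`() = 0 -> ev2 idfun x0 y0 ('X%:P * dY F) = 0 -> False) ->
  exists N, ncond F x N.
Proof.
move=> F0 x0 nosing; set H := 'X%:P * dY F in nosing *.
set g1 := gcdp F F^`(); set G := gcdp g1 H.
have G0 : G != 0 by rewrite gcdp_eq0 gcdp_eq0 !negb_and F0.
have d1 : G %| F by apply: dvdp_trans (dvdp_gcdl _ _) (dvdp_gcdl _ _).
have d2 : G %| F^`() by apply: dvdp_trans (dvdp_gcdl _ _) (dvdp_gcdr _ _).
have d3 : G %| H by apply: dvdp_gcdr.
have [m EG] : exists m, G = (lead_coef G)%:P * 'X^m.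
  apply: single_coef => // i j lt_ij Gi Gj.
  case/Pdiv.WeakIdomain.dvdpP: d1 => [[r1 Q1] /= n1 E1].
  case/Pdiv.WeakIdomain.dvdpP: d2 => [[r2 Q2] /= n2 E2].
  case/Pdiv.WeakIdomain.dvdpP: d3 => [[r3 Q3] /= n3 E3].
  (* The divisibilities hold only up to the factors r1, r2, r3 in K[Y]. Away from their zeros they
     specialize at Y = y, and G(X, y) keeps two terms, hence has a nonzero root: a singular point in
     the torus. *)
  have [y] : exists y, ('X * G`_i * G`_j * r1 * r2 * r3).[y] != 0.
    by apply: nonroot; rewrite !mulf_neq0 ?polyX_eq0.
  rewrite !hornerM hornerX !mulf_eq0 !negb_or -!andbA => /and5P[y0 hi hj h1 /andP[h2 h3]].
  have [|||x1 [x10 rx1]] := @two_coefs_root K (map_poly (horner_eval y) G) i j.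
  - by [].
  - by rewrite coef_map.
  - by rewrite coef_map.
  have EG : ev2 idfun x1 y G = 0.
    rewrite -[RHS]rx1 /ev2; congr (_.[_]); apply: eq_map_poly => q.
    by rewrite map_poly_id.
  apply: (nosing x1 y) => //; [exact: dvdp_eval E1 h1 EG|exact: dvdp_eval E2 h2 EG|].
  exact: dvdp_eval E3 h3 EG.
have [[u v] /eqpP[[a1 b1] /= /andP[a10 b10] E1]] := Bezoutp F F^`().
have [[u' v'] /eqpP[[a2 b2] /= /andP[a20 b20] E2]] := Bezoutp g1 H.
(* The scalars of the two Bezout identities times the coefficient of G: R(Y) X^m lies in the ideal.
   Writing R = h Y^N with h(0) <> 0 leaves the cofactor h X^m, a unit at (x, 0) because x <> 0. *)
pose R := b1 * b2 * lead_coef G.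
have R0 : R != 0 by rewrite !mulf_neq0 ?lead_coef_eq0.
have [N [h hR Rh]] : exists N, exists2 h, ~~ root h 0 & R = h * 'X ^+ N.
  have [N [h hr E]] := multiplicity_XsubC R 0; exists N, h; last by rewrite E subr0.
  by move: hr; rewrite R0.
exists N, (h%:P * 'X^m), (a2%:P * u' * a1%:P * u), (a2%:P * u' * a1%:P * v), (b1%:P * a2%:P * v').
split; first by rewrite /ev_at rmorphM rmorphXn /= ev2X ev2C map_poly_id // mulf_neq0 ?expf_neq0.
rewrite -!mul_polyC in E1 E2.
have -> : ('X ^+ N)%:P * (h%:P * 'X^m) = b1%:P * (b2%:P * G).
  by rewrite [in RHS]EG !mulrA -!polyCM -/R Rh ['X^N * h]mulrC.
rewrite -E2 -/H.
transitivity (a2%:P * u' * (b1%:P * g1) + b1%:P * a2%:P * v' * H); first by ring.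
by rewrite -E1; ring.
Qed.
End BaseCondition.

Lemma laurent_fun_int (K : fieldType) n (m : int) :
  laurent_fun (fun (L : fieldType) (_ : {rmorphism K -> L}) (_ : 'I_n -> L) => m%:~R : L).
Proof.
apply: eq_laurent_fun (laurent_fun_const n (m%:~R : K)) => L phi z _.
by rewrite rmorph_int.
Qed.

Section TorusChange.
Variables (K : closedFieldType) (f : laurent K 2) (F : {poly {poly K}}) (k : K).
Variables (w : 'rV[int]_2) (M : 'M[int]_2).
Hypotheses (dM : \det M = 1) (kn0 : k != 0) (hf : smooth_curve f).
Hypothesis hF : gen F = rC 2 k * monom (@rX K 2) w * leval (@rC K 2) f (act (@rX K 2) M).

(** The logarithmic derivative, in the i-th new variable, of f after the substitution by M: the
    monomial u acquires the exponent u M^T. *)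
Definition log_leval (i : 'I_2) (L : fieldType) (phi : {rmorphism K -> L}) (z : 'I_2 -> L) : L :=
  \sum_(u <- finsupp f) phi (f u) * ((u *m M^T) 0 i)%:~R * monom (act z M) u.

Lemma log_deriv_leval i (D : ratfun K 2 -> ratfun K 2) :
    derivation D -> (forall e : K, D (rC 2 e) = 0) ->
    (forall j, eigen D (rX K j) (i == j)%:Z) ->
  D (gen F) = (w 0 i)%:~R * gen F
    + rC 2 k * monom (@rX K 2) w * log_leval i (@rC K 2) (@rX K 2).
Proof.
move=> h1 h2 h3; have z0 := @rX_neq0 K 2; have z0' := act_neq0 M z0.
rewrite hF h1.2 h1.2 h2 mul0r add0r (eigen_monom h1 h2 w z0 h3).
rewrite (bigD1 i) //= eqxx mul1r big1 ?addr0 => [|j /negPf ne]; last first.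
  by rewrite eq_sym ne mul0r.
congr (_ + _ * _); first by ring.
have D0 : D 0 = 0 by have := h2 0; rewrite rmorph0.
rewrite /leval /log_leval (big_morph D h1.1 D0); apply: eq_bigr => u _.
rewrite h1.2 h2 mul0r add0r.
rewrite (eigen_monom h1 h2 u z0' (fun j => eigen_act_rX M j h1 h2 h3)).
rewrite mulrA; congr (_ * _%:~R * _).
by rewrite mul2_tr !big_ord_recl big_ord0 addr0; congr (M _ _ * u _ _ + M _ _ * u _ _); apply: val_inj.
Qed.

Lemma laurent_fun_log_leval i : laurent_fun (log_leval i).
Proof.
apply: laurent_fun_sum => u; apply: laurent_funM; first apply: laurent_funM.
- exact: laurent_fun_const.
- exact: laurent_fun_int.
apply: eq_laurent_fun (laurent_fun_monom K (u *m M^T)) => L phi z z0.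
by rewrite monom_actE.
Qed.

(** At a singular point of F in the torus, f and both logarithmic derivatives of f in the new
    variables vanish. As M has determinant 1 in K, so do the logarithmic derivatives in the old
    variables, against smoothness at the image point. *)
Lemma no_singular_point x y : x != 0 -> y != 0 -> ev2 idfun x y F = 0 ->
  ev2 idfun x y F^`() = 0 -> ev2 idfun x y ('X%:P * dY F) = 0 -> False.
Proof.
move=> x0 y0 F0 FX0 FY0.
pose z (i : 'I_2) := if i == 0 then x else y.
have zn0 i : z i != 0 by rewrite /z; case: ifP.
have lX := laurent_fun_var K (0 : 'I_2); have lY := laurent_fun_var K (1 : 'I_2).
have lev A := laurent_fun_ev2 A lX lY.
have lmu := laurent_funM (laurent_fun_const 2 k) (laurent_fun_monom K w).
have mu0 : k * monom z w != 0 by rewrite mulf_neq0 ?monom_neq0.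
have h0 := transport (lev F) (laurent_funM lmu (laurent_fun_leval f M)) hF idfun zn0.
have fP : leval id f (act z M) = 0.
  by move/eqP: h0; rewrite /= F0 eq_sym mulf_eq0 (negPf mu0) => /eqP.
have hlog i : log_leval i idfun z = 0.
  have [D [d1 d2 d3]] := log_derivation K i.
  have key := log_deriv_leval d1 d2 d3.
  rewrite [D (gen F)](deriv_ev2 d1 d2) !d3 in key.
  have lL := laurent_funD (laurent_funM (lev F^`()) (laurent_funM (laurent_fun_int K 2 (i == 0)%:Z) lX))
     (laurent_funM (lev (dY F)) (laurent_funM (laurent_fun_int K 2 (i == 1)%:Z) lY)).
  have lR := laurent_funD (laurent_funM (laurent_fun_int K 2 (w 0 i)) (lev F))
     (laurent_funM lmu (laurent_fun_log_leval i)).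
  have /= := transport lL lR key idfun zn0; move/eqP.
  rewrite F0 mulr0 add0r FX0 mul0r add0r.
  have -> : ev2 idfun (z 0) (z 1) (dY F) = 0.
    move/eqP: FY0; rewrite rmorphM /= ev2Y mulf_eq0 (negPf y0) => /eqP.
    by [].
  by rewrite mul0r eq_sym mulf_eq0 (negPf mu0) => /eqP.
have an0 := act_neq0 M zn0.
(* The j-th coordinate of the image point times the j-th partial derivative of f there; [hS] says
   that M annihilates the vector (S 0, S 1). *)
pose S j := \sum_(u <- finsupp f) f u * (u 0 j)%:~R * monom (act z M) u.
have hS i : (M i 0)%:~R * S 0 + (M i 1)%:~R * S 1 = 0.
  rewrite -[RHS](hlog i) /log_leval !mulr_sumr -big_split; apply: eq_bigr => u _ /=.
  by rewrite mul2_tr intrD !intrM; ring.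
have det : (M 0 0)%:~R * (M 1 1)%:~R - (M 0 1)%:~R * (M 1 0)%:~R = 1 :> K.
  by rewrite -!intrM -intrB -det2 dM.
have S0 : S 0 = 0.
  rewrite -[LHS]mul1r -det; transitivity ((M 1 1)%:~R * ((M 0 0)%:~R * S 0 + (M 0 1)%:~R * S 1)
    - (M 0 1)%:~R * ((M 1 0)%:~R * S 0 + (M 1 1)%:~R * S 1)); first by ring.
  by rewrite !hS; ring.
have S1 : S 1 = 0.
  rewrite -[LHS]mul1r -det; transitivity ((M 0 0)%:~R * ((M 1 0)%:~R * S 0 + (M 1 1)%:~R * S 1)
    - (M 1 0)%:~R * ((M 0 0)%:~R * S 0 + (M 0 1)%:~R * S 1)); first by ring.
  by rewrite !hS; ring.
have [i /negP[]] := hf.2 _ an0 fP; apply/eqP.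
have Si : S i = 0.
  case: (unliftP 0 i) => [i'|] -> //.
  by rewrite (ord1 i') (_ : lift _ _ = 1) //; apply: val_inj.
apply: (mulIf (an0 i)); rewrite mul0r -[RHS]Si /lderiv_at mulr_suml; apply: eq_bigr => u _.
rewrite monomD // monomN // (_ : monom _ (delta_mx 0 i) = act z M i).
  by rewrite -mulrzr -!mulrA mulVf ?mulr1.
rewrite /monom (bigD1 i) //= mxE !eqxx expr1z big1 ?mulr1 // => j /negPf ne.
by rewrite mxE ne andbF.
Qed.
End TorusChange.

(** * Charts *)

Lemma germ_mmap (K L : fieldType) (R : comNzRingType) (ev : {rmorphism R -> L})
    (ev0 : {rmorphism R -> K}) (phi : {rmorphism K -> L}) n (z : 'I_n -> L) (v : 'I_n -> K)
    (h : {mpoly K[n]}) :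
    (forall k, germ ev ev0 (phi k) k) -> (forall i, germ ev ev0 (z i) (v i)) ->
  germ ev ev0 (mmap phi z h) (mmap idfun v h).
Proof.
move=> hk hz; elim/mpolyind: h => [|c m q _ _ IH]; first by rewrite !rmorph0; apply: germ0.
rewrite !rmorphD /= !mmapZ !mmapX; apply: germD => //; apply: germM => //.
rewrite /mmap1; apply: (big_ind2 (germ ev ev0)) => [|*|i _]; first exact: germ1.
  exact: germM.
exact: germX.
Qed.

Lemma cancel_unit (F : fieldType) (c m x b : F) : c != 0 -> m != 0 ->
  x * b = c * m * x * (c^-1 * m^-1 * b).
Proof. by move=> c0 m0; field; apply/andP. Qed.

Section Charts.
Variables (K : fieldType) (f : laurent K 2).
Implicit Types (a e : chart K).

Definition fL : ratfun K 2 := leval (@rC K 2) f (@rX K 2).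

Definition tf : {mpoly K[2]} -> ratfun K 2 := @tofrac {mpoly K[2]}.
HB.instance Definition _ := GRing.RMorphism.on tf.

Definition zs a (i : 'I_(cdim a).+2) : ratfun K 2 := tf (tnth (czs a) i).
Arguments zs : clear implicits.
Definition nz a : Prop := forall i, zs a i != 0 :> ratfun K 2.
Arguments nz : clear implicits.
Definition Xs a : 'I_(cdim a).+2 -> ratfun K 2 := act (zs a) (invmx (cM a)).
Arguments Xs : clear implicits.
Definition Xj a : ratfun K 2 := Xs a (xindex (cj a)).
Definition Yc a : ratfun K 2 := Xs a ord_max.
Arguments Xj : clear implicits.
Arguments Yc : clear implicits.

(* Regular functions on C_{0,a}, before reduction modulo f. *)
Definition zreg a (l : ratfun K 2) : Prop :=
  exists N q, l * (\prod_i zs a i) ^+ N = tf q.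
Arguments zreg : clear implicits.

Lemma zregM a l l' : zreg a l -> zreg a l' -> zreg a (l * l').
Proof.
move=> [N [q E]] [N' [q' E']]; exists (N + N')%N, (q * q').
by rewrite rmorphM /= -E -E' exprD; ring.
Qed.

Lemma zreg_tf a q : zreg a (tf q).
Proof. by exists 0, q; rewrite mulr1. Qed.

Lemma mmap_tf n (g : 'I_n -> {mpoly K[2]}) (q : {mpoly K[n]}) :
  mmap (@rC K 2) (fun i => tf (g i)) q = tf (mmap (@mpolyC 2 K) g q).
Proof.
elim/mpolyind: q => [|c m q _ _ IH]; first by rewrite !rmorph0.
rewrite !rmorphD /= IH !mmapZ !mmapX rmorphM /mmap1 rmorph_prod; congr (_ * _ + _).
by apply: eq_bigr => i _; rewrite rmorphXn.
Qed.

Lemma zreg_laurent a (F : torus_fun K (cdim a).+2) :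
  nz a -> laurent_fun F -> zreg a (F _ (@rC K 2) (zs a)).
Proof.
move=> z0 [N [q hq]]; exists N, (mmap (@mpolyC 2 K) (tnth (czs a)) q).
by rewrite hq // mmap_tf.
Qed.

Lemma Xs_neq0 a i : nz a -> Xs a i != 0.
Proof. by move=> z0; apply: act_neq0. Qed.

Definition evC a : {mpoly K[(cdim a).+2]} -> ratfun K 2 := mmap (@rC K 2) (Xs a).
HB.instance Definition _ a := GRing.RMorphism.on (@evC a).
Definition evP a (P : point a) : {mpoly K[(cdim a).+2]} -> K := mmap idfun (fun i => P 0 i).
HB.instance Definition _ a P := GRing.RMorphism.on (@evP a P).

Lemma Cideal_zreg a h : nz a ->
  Cideal f h <-> exists l, zreg a l /\ @evC a h = fL * l.
Proof.
move=> z0; have Z0 : \prod_i zs a i != 0 by apply/prodf_neq0 => i _.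
have EZ : tofrac (\prod_i tnth (czs a) i) = \prod_i zs a i by rewrite rmorph_prod.
split=> [[N [q]]|[l [[N [q E]] El]]].
  rewrite EZ -/(tf q) -/(evC h) -/fL => E.
  have ZN0 := expf_neq0 N Z0.
  exists (tf q / (\prod_i zs a i) ^+ N); split.
    by exists N, q; rewrite (mulfVK ZN0).
  by rewrite mulrA -E (mulfK ZN0).
by exists N, q; rewrite EZ -/(tf q) -/(evC h) -/fL El -mulrA E.
Qed.

Lemma Cbar_idealW a h : @Cideal K f a h -> Cbar_ideal f h.
Proof. by move=> hh; exists h, 0; rewrite mulr0 addr0. Qed.

(** If some coordinate were zero in k(x_1, y), one power of the product of all of them would kill
    everything, so 1 would lie in the ideal and bar C_a would be empty. *)
Lemma Cbar_nz a (P : point a) : in_Cbar f P -> nz a.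
Proof.
case=> _ hP i; apply/eqP=> zi; have /hP : Cbar_ideal f (1 : {mpoly K[(cdim a).+2]}).
  apply: Cbar_idealW; exists 1%N, 0; rewrite rmorph0 mulr0 expr1 rmorph_prod.
  by rewrite (bigD1 i) //= -/(tf _) [tf _]zi mul0r mulr0.
by move/eqP; rewrite /mevalp meval1 oner_eq0.
Qed.

Lemma evP_Y a (P : point a) : in_Cbar f P -> P 0 ord_max = 0.
Proof.
case=> _ hP; have /hP : Cbar_ideal f ('X_ord_max : {mpoly K[(cdim a).+2]}).
  exists 0, 1; split; last by rewrite add0r mulr1.
  by exists 0, 0; rewrite !rmorph0 mulr0 mulr1.
by rewrite /mevalp mevalXU.
Qed.

Lemma evP_fL a (P : point a) h l : in_Cbar f P -> zreg a l -> evC h = fL * l -> evP P h = 0.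
Proof.
move=> hP hl E; have z0 := Cbar_nz hP; apply: hP.2; apply: Cbar_idealW.
by apply/(Cideal_zreg _ z0); exists l.
Qed.

Lemma evP_ker a (P : point a) : in_Cbar f P -> forall h, evC h = 0 -> evP P h = 0.
Proof.
move=> hP h E; apply: (evP_fL hP (zreg_tf a 0)).
by rewrite E rmorph0 mulr0.
Qed.

(* Germs at a point of C_alpha, and germs at (x, 0) in the (X_j, Y)-plane. *)
Definition germP a (P : point a) := @germ K (ratfun K 2) {mpoly K[(cdim a).+2]} (@evC a) (evP P).
Definition evXY a : {poly {poly K}} -> ratfun K 2 := ev2 (@rC K 2) (Xj a) (Yc a).
Arguments evXY : clear implicits.
HB.instance Definition _ a := GRing.RMorphism.on (evXY a).
Definition germXY a (x : K) := @germ K (ratfun K 2) {poly {poly K}} (evXY a) (ev_at x).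
Arguments germXY : clear implicits.

Definition emb a : {poly {poly K}} -> {mpoly K[(cdim a).+2]} :=
  ev2 (@mpolyC (cdim a).+2 K) 'X_(xindex (cj a)) 'X_ord_max.
Arguments emb : clear implicits.
HB.instance Definition _ a := GRing.RMorphism.on (emb a).

Lemma evC_X a i : evC ('X_i) = Xs a i.
Proof. by rewrite /evC mmapX mmap1U. Qed.
Lemma evP_X a (P : point a) i : evP P ('X_i) = P 0 i.
Proof. by rewrite /evP mmapX mmap1U. Qed.
Lemma evC_C a k : evC (mpolyC (cdim a).+2 k) = rC 2 k.
Proof. exact: mmapC. Qed.
Lemma evP_C a (P : point a) k : evP P (mpolyC (cdim a).+2 k) = k.
Proof. exact: mmapC. Qed.

Lemma evC_emb a A : evC (emb a A) = evXY a A.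
Proof.
rewrite /emb (ev2_morph (psi := @evC a) (phi' := @rC K 2)) /= ?evC_X //.
by move=> k; rewrite evC_C.
Qed.

Lemma evP_emb a (P : point a) A : in_Cbar f P -> evP P (emb a A) = ev_at (P 0 (xindex (cj a))) A.
Proof.
move=> hP; rewrite /emb (ev2_morph (psi := evP P) (phi' := idfun)) /= ?evP_X ?(evP_Y hP) //.
by move=> k; rewrite evP_C.
Qed.

Lemma germP_X a (P : point a) i : germP P (Xs a i) (P 0 i).
Proof. by rewrite -evC_X -(evP_X P i); apply: germ_ev. Qed.

Lemma germP_const a (P : point a) k : germP P (rC 2 k) k.
Proof. by have := @germ_ev K (ratfun K 2) _ (@evC a) (evP P) (mpolyC _ k); rewrite /= evC_C evP_C. Qed.

Lemma germXY_P a (P : point a) l v : in_Cbar f P ->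
  germXY a (P 0 (xindex (cj a))) l v -> germP P l v.
Proof.
move=> hP [h [s [s0 E E0]]]; exists (emb a h), (emb a s).
by rewrite /= !evC_emb !(evP_emb _ hP).
Qed.

Lemma germP_inj a (P : point a) l v v' : in_Cbar f P -> germP P l v -> germP P l v' -> v = v'.
Proof. by move=> hP; apply: germ_inj; apply: evP_ker. Qed.

Lemma evXY_X a : evXY a 'X = Xj a. Proof. exact: ev2X. Qed.
Lemma evXY_Y a : evXY a 'X%:P = Yc a. Proof. exact: ev2Y. Qed.
Lemma evXY_CC a k : evXY a k%:P%:P = rC 2 k. Proof. exact: ev2CC. Qed.
Lemma evXYD a A B : evXY a (A + B) = evXY a A + evXY a B. Proof. exact: rmorphD. Qed.
Lemma evXYM a A B : evXY a (A * B) = evXY a A * evXY a B. Proof. exact: rmorphM. Qed.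

Lemma evXYB a A B : evXY a (A - B) = evXY a A - evXY a B. Proof. exact: ev2B. Qed.

Lemma germXY_ev a x A : germXY a x (evXY a A) (ev_at x A).
Proof. exact: germ_ev. Qed.
Lemma germXY_X a x : germXY a x (Xj a) x.
Proof. by have := germXY_ev a x 'X; rewrite evXY_X ev_at_X. Qed.
Lemma germXY_Y a x : germXY a x (Yc a) 0.
Proof. by have := germXY_ev a x 'X%:P; rewrite evXY_Y ev_at_Y. Qed.
Lemma germXY_const a x k : germXY a x (rC 2 k) k.
Proof. by have := germXY_ev a x k%:P%:P; rewrite evXY_CC ev_at_CC. Qed.

(** What a chart retains along a resolution. By [inv_eq], f is F_a(X_j, Y) up to a unit on C_{0,a}.
    [inv_germ] does the work of the embedding of R_a into k(X_j, Y): at a point of bar C_a all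
    coordinates are germs in X_j and Y, so that local questions move to the plane. *)
Record chart_inv a : Prop := ChartInv {
  inv_unit : cM a \in unitmx;
  inv_eq : nz a -> exists c w, c != 0 /\ fL = rC 2 c * monom (zs a) w * evXY a (cF a);
  inv_Y0 : at_Y0 (cF a) != 0;
  inv_germ : forall P : point a, in_Cbar f P ->
    forall i, exists v, germXY a (P 0 (xindex (cj a))) (Xs a i) v;
  inv_ncond : forall P : point a, in_Cbar f P ->
    (2 <= mup (P 0%R (xindex (cj a))) (at_Y0 (cF a)))%N ->
    exists N, ncond (cF a) (P 0 (xindex (cj a))) N }.

(** Since f and F_a differ by a unit of C_{0,a}, every multiple of F_a by a polynomial in the chart
    coordinates belongs to the ideal of C_a. *)
Lemma evXY_fL a (B : {mpoly K[(cdim a).+2]}) : chart_inv a -> nz a ->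
  exists l, zreg a l /\ evXY a (cF a) * evC B = fL * l.
Proof.
move=> ha z0; have [c [w [c0 E]]] := inv_eq ha z0.
exists (rC 2 c^-1 * monom (zs a) (- w) * evC B); split.
  apply: zregM; first apply: zregM.
  - exact: (zreg_tf a (mpolyC 2 c^-1)).
  - exact: zreg_laurent z0 (laurent_fun_monom K _).
  - exact: zreg_laurent z0 (laurent_fun_mmap _ _).
rewrite E monomN // fmorphV; apply: cancel_unit; first by rewrite fmorph_eq0.
exact: monom_neq0.
Qed.

Lemma split_Y (A : {poly {poly K}}) :
  exists A', A = map_poly polyC (at_Y0 A) + 'X%:P * A'.
Proof.
exists (map_poly (fun q : {poly K} => (q - q.[0]%:P) %/ 'X) A).
apply/polyP=> i; rewrite coefD coefCM coef_map_id0 ?polyC0 //.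
rewrite (coef_map (horner_eval 0)) /= coef_map_id0; last by rewrite horner0 polyC0 subrr div0p.
rewrite [_ * (_ %/ _)]mulrC divpK; first by rewrite /horner_eval addrC subrK.
rewrite -['X]subr0 -polyC0 dvdp_XsubCl.
by apply/rootP; rewrite hornerD hornerN hornerC subrr.
Qed.

Lemma split_ideal (A : {poly {poly K}}) x : ev_at x A = 0 ->
  exists A1 A2, A = ('X - x%:P%:P) * A1 + 'X%:P * A2.
Proof.
move=> A0; have [A' E] := split_Y A.
have /dvdpP[B EB] : 'X - x%:P %| at_Y0 A by rewrite dvdp_XsubCl; apply/rootP; rewrite -ev_atE.
exists (map_poly polyC B), A'; rewrite {1}E EB rmorphM /= mulrC; congr (_ * _ + _).
by rewrite rmorphB /= map_polyX map_polyC.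
Qed.

Lemma Cbar_root a (P : point a) : chart_inv a -> in_Cbar f P ->
  ev_at (P 0 (xindex (cj a))) (cF a) = 0.
Proof.
move=> ha hP; rewrite -evP_emb //.
have [l [hl E]] := evXY_fL 1 ha (Cbar_nz hP); apply: (evP_fL hP hl).
by rewrite evC_emb -E rmorph1 mulr1.
Qed.

Lemma germ_evC a (P : point a) (h : {mpoly K[(cdim a).+2]}) : chart_inv a -> in_Cbar f P ->
  exists v, germXY a (P 0 (xindex (cj a))) (evC h) v.
Proof.
move=> ha hP; pose x := P 0 (xindex (cj a)).
have hi (i : 'I_(cdim a).+2) : exists v, germXY a x (Xs a i) v by exact: inv_germ.
have [v hv] := fin_all_exists hi.
by exists (mmap idfun v h); apply: germ_mmap => // k; apply: germXY_const.
Qed.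

(** At a simple root, F = (X - x) E + Y F2 with E(x, 0) <> 0. A function vanishing at P is, up to a
    unit s, of the form (X - x) H1 + Y H2, and E times this is F H1 + Y (E H2 - F2 H1), which is
    zero on bar C_a. *)
Lemma simple_root_regular a (P : point a) : chart_inv a -> in_Cbar f P ->
  (mup (P 0%R (xindex (cj a))) (at_Y0 (cF a)) < 2)%N -> regular_at f P.
Proof.
move=> ha hP; set x := P 0 (xindex (cj a)) => hmu h hP0.
have F0 := inv_Y0 ha; have z0 := Cbar_nz hP.
have [v hv] := germ_evC h ha hP.
have v0 : v = 0.
  have h0 : germP P (evC h) (mevalp P h) := germ_ev (@evC a) (evP P) h.
  rewrite hP0 in h0.
  exact: germP_inj hP (germXY_P hP hv) h0.
have [H [s [s0 EH H0]]] := hv; rewrite v0 mul0r in H0.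
have [H1 [H2 EH12]] := split_ideal H0.
have Fx := Cbar_root ha hP; rewrite -/x in Fx.
have [F2 EF] := split_Y (cF a).
have rx : root (at_Y0 (cF a)) x by apply/rootP; rewrite -ev_atE.
have /dvdpP[E0 EE0] : 'X - x%:P %| at_Y0 (cF a) by rewrite dvdp_XsubCl.
have E0x : E0.[x] != 0.
  apply/negP=> /eqP/rootP; rewrite -dvdp_XsubCl => /dvdpP[Q EQ].
  by move: hmu; rewrite ltnNge mup_geq // EE0 EQ -mulrA -expr2 dvdp_mull.
pose E := map_poly polyC E0.
have EFE : cF a = ('X - x%:P%:P) * E + 'X%:P * F2.
  rewrite [LHS]EF EE0 rmorphM /= mulrC; congr (_ * _ + _).
  by rewrite rmorphB /= map_polyX map_polyC.
have ExE : ev_at x E = E0.[x].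
  rewrite ev_atE /E /at_Y0; congr (_.[x]); apply/polyP=> i.
  by rewrite !coef_map /= /horner_eval hornerC.
pose u := emb a (E * s); exists u; split.
  by rewrite -[mevalp P u]/(evP P u) evP_emb // rmorphM /= ExE mulf_neq0.
pose q := emb a (E * H2 - F2 * H1).
exists (u * h - 'X_ord_max * q), q; split; last by rewrite subrK.
have [l [hl El]] := evXY_fL (emb a H1) ha z0.
apply/(Cideal_zreg _ z0); exists l; split=> //; rewrite -El.
rewrite rmorphB !rmorphM /= evC_X !evC_emb -/(Yc a) -(evXY_Y a).
rewrite (evXYM _ E s) -mulrA [evXY a s * _]mulrC EH -!evXYM -evXYB EH12 EFE.
by congr (evXY a _); ring.
Qed.

Lemma Sing_mup a (P : point a) : chart_inv a -> in_Sing f P ->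
  (2 <= mup (P 0%R (xindex (cj a))) (at_Y0 (cF a)))%N.
Proof.
move=> ha [hP hreg]; rewrite leqNgt; apply/negP=> hmu; apply: hreg.
exact: simple_root_regular.
Qed.
End Charts.

Arguments zs {K} a i.
Arguments Xs {K} a i.

(** * Elementary steps *)

Lemma eq_mmap (K L : fieldType) (phi : {rmorphism K -> L}) n (z z' : 'I_n -> L) (p : {mpoly K[n]}) :
  z =1 z' -> mmap phi z p = mmap phi z' p.
Proof. by move=> E; apply: eq_bigr => m _; rewrite (mmap1_eq m E). Qed.

Lemma newiE d : newi d = d.+1 :> nat.
Proof. by rewrite /newi inordK. Qed.

Lemma lift_newi_max d : lift (newi d) ord_max = ord_max :> 'I_d.+3.
Proof. by apply: val_inj; rewrite /= /bump newiE leqnn. Qed.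

Lemma lift_newi_small d (i : 'I_d.+2) : (i < d.+1)%N -> lift (newi d) i = i :> nat.
Proof. by move=> lt_id; rewrite /= /bump newiE leqNgt lt_id. Qed.

Lemma lift_newi_xindex d (j : 'I_d.+1) :
  lift (newi d) (xindex j) = xindex (widen_ord (leqnSn _) j : 'I_d.+2).
Proof. by apply: ord_inj; rewrite lift_newi_small //=. Qed.

Lemma newi_neq_max d : newi d != ord_max.
Proof. by rewrite -val_eqE /= newiE neq_ltn ltnSn. Qed.

Lemma xindex_neq_max d (j : 'I_d.+1) : xindex j != ord_max.
Proof. by rewrite -val_eqE /= neq_ltn ltn_ord. Qed.

Lemma lift_newi_neq_max d (i : 'I_d.+2) : i != ord_max -> lift (newi d) i != ord_max.
Proof. by rewrite -lift_newi_max (inj_eq lift_inj). Qed.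

Lemma det_ext_mx d (M : 'M[int]_d.+2) n : \det (ext_mx M n) = \det M.
Proof.
rewrite (expand_det_row _ (newi d)) (bigD1 (newi d)) //= big1 ?addr0 => [|j ne].
  rewrite mxE unlift_none eqxx mul1r /cofactor -signr_odd oddD addbb mul1r.
  by congr (\det _); apply/matrixP=> i j; rewrite !mxE !liftK.
by rewrite mxE unlift_none (negPf ne) mul0r.
Qed.

(** * Adjoining the coordinate given by g, for an arbitrary new vector, matrix and equation *)

Section Extension.
Variables (K : fieldType) (f : laurent K 2) (a : chart K).
Variables (g : {mpoly K[(cdim a).+2]}) (n : 'rV[int]_(cdim a).+2) (G : {poly {poly K}}).
Variables (v' : 'rV[int]_(cdim a).+3) (M' : 'M[int]_((cdim a).+3)) (j' : 'I_(cdim a).+2).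
Variable F' : {poly {poly K}}.
Hypotheses (uM : cM a \in unitmx) (hexp : is_exponent_of G g n).

Let e : chart K := @Chart K (cdim a).+1 v' (ext_g g) M' j' F'.
Let new : 'I_(cdim e).+2 := newi (cdim a).

Lemma zs_lift i : zs e (lift new i) = zs a i.
Proof.
rewrite /zs !(tnth_nth 0) /=; congr tf.
have [lt_i|ge_i] := ltnP i (cdim a).+1.
  rewrite /bump newiE leqNgt lt_i add0n.
  case: (nat_of_ord i) lt_i => // m; rewrite ltnS /= => lt_m.
  by rewrite !nth_rcons !size_rcons !size_tuple lt_m ltnS ltnW.
have -> : i = ord_max by apply: val_inj; apply/eqP; rewrite eqn_leq -ltnS ltn_ord.
rewrite /= /bump newiE leqnn add1n /= !nth_rcons !size_rcons !size_tuple /=.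
by rewrite !ltnn !eqxx.
Qed.

Lemma zs_new : zs e new = tf (g \mPo czs a).
Proof.
rewrite /zs (tnth_nth 0) /= newiE /= !nth_rcons !size_rcons !size_tuple.
by rewrite ltnSn ltnn eqxx.
Qed.

Lemma nz_ext : nz e -> nz a.
Proof. by move=> h i; rewrite -zs_lift; apply: h. Qed.

Lemma zreg_ext l : zreg a l -> zreg e l.
Proof.
move=> [N [q E]]; exists N, (q * (g \mPo czs a) ^+ N).
rewrite (bigD1_ord new) //= zs_new.
under eq_bigr => i _ do rewrite zs_lift.
by rewrite exprMn mulrCA mulrC E rmorphM rmorphXn.
Qed.

Definition is_monom (c : chart K) (l : ratfun K 2) := exists u, l = monom (zs c) u.

Lemma is_monom_ext l : is_monom a l -> is_monom e l.
Proof.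
move=> [u ->]; exists (\row_i (if unlift new i is Some i' then u 0 i' else 0)).
rewrite /monom [RHS](bigD1_ord new) //= mxE unlift_none expr0z mul1r.
by apply: eq_bigr => i _; rewrite mxE liftK zs_lift.
Qed.

Lemma g_eval : nz a -> tf (g \mPo czs a) = monom (Xs a) n * evXY a G.
Proof.
move=> z0; rewrite -[_ \mPo _]/(mmap _ _ _) -mmap_tf.
have X0 i := @Xs_neq0 K a i z0.
have lhs := laurent_fun_mmap g (cM a).
have rhs := laurent_funM (laurent_fun_monom K n)
  (laurent_fun_ev2 G (laurent_fun_var K (xindex (cj a))) (laurent_fun_var K ord_max)).
rewrite -[RHS](transport lhs rhs hexp.2 (@rC K 2) X0).
by apply: eq_mmap => i; rewrite /Xs (act_mul _ _ z0) (mulVmx uM) act1.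
Qed.

(* The coordinates X_1, ..., X_m, X_(m+1), Y attached to [ext_mx]: X_(m+1) is G. *)
Definition Xt (i : 'I_(cdim a).+3) : ratfun K 2 :=
  if unlift (newi (cdim a)) i is Some i' then Xs a i' else evXY a G.

Lemma Xt_act : nz e -> act Xt (ext_mx (cM a) n) =1 zs e.
Proof.
move=> z0 k; rewrite /act (bigD1_ord new) //=.
rewrite {1}/Xt unlift_none; under eq_bigr => i _ do rewrite /Xt liftK.
have [k'|] := unliftP new k => ->.
  rewrite zs_lift mxE unlift_none eq_sym (negPf (neq_lift _ _)) expr0z mul1r.
  rewrite -[RHS](act1 (zs a)) -(mulVmx uM) -act_mul; last exact: nz_ext.
  by apply: eq_bigr => i _; rewrite mxE !liftK.
rewrite mxE unlift_none eqxx expr1z zs_new g_eval; last exact: nz_ext.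
by rewrite mulrC; congr (_ * _); apply: eq_bigr => i _; rewrite mxE liftK unlift_none.
Qed.

Lemma Xt_neq0 i : nz e -> Xt i != 0.
Proof.
move=> z0; rewrite /Xt; case: (unlift new i) => [i'|].
  by apply: Xs_neq0; apply: nz_ext.
have := z0 new; rewrite zs_new g_eval; last exact: nz_ext.
by rewrite mulf_eq0 negb_or => /andP[].
Qed.

(** A function in the ideal of C_a is f times a regular function. Its numerator as a germ at Q is
    again such a multiple of f, hence vanishes at Q, so the value at P is zero. This shows that
    points of the new charts lie over points of the old one. *)
Lemma pullback (Q : point e) (P : point a) : in_Cbar f Q ->
    (forall i : 'I_(cdim a).+2, i != ord_max -> P 0 i != 0) -> P 0 ord_max = 0 ->
    (forall i, germP Q (Xs a i) (P 0 i)) ->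
  in_Cbar f P.
Proof.
move=> hQ P0 PY hg; split=> // h [h0 [q [hh0 ->]]].
have z0 := nz_ext (Cbar_nz hQ).
suff E0 : evP P h0 = 0.
  by rewrite -[LHS]/(evP P _) rmorphD rmorphM /= E0 evP_X PY mul0r addr0.
have [l [hl El]] := (Cideal_zreg _ _ z0).1 hh0.
have hgP : germP Q (evC h0) (evP P h0).
  by apply: germ_mmap => // k; apply: germP_const.
have [h' [s [s0 E1 E2]]] := hgP.
have : evP Q h' = 0.
  apply: (evP_fL hQ (l := l * evC s)).
    apply: zregM; first exact: zreg_ext.
    exact: zreg_laurent (Cbar_nz hQ) (laurent_fun_mmap _ _).
  by rewrite -E1 El mulrA.
move/eqP; rewrite E2 mulf_eq0 (negPf s0) orbF => /eqP.
by [].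
Qed.
End Extension.

(** * The matrices I_m (+) Mb and their action on coordinates *)

Section DirectSum.
Variable d : nat.
Implicit Types (i j : 'I_d.+3) (Mb : 'M[int]_2).

Lemma ord_cases i : (i <= d)%N \/ (i = newi d \/ i = ord_max).
Proof.
have [h|h] := leqP i d; [by left|right].
have := ltn_ord i; rewrite ltnS leq_eqVlt => /orP[/eqP E|h'].
  by right; apply: ord_inj.
by left; apply: ord_inj; rewrite newiE; apply/eqP; rewrite eqn_leq h -ltnS h'.
Qed.

Lemma dsumE_small Mb i j : (i <= d)%N || (j <= d)%N -> dsum_mx d Mb i j = (i == j)%:R.
Proof. by rewrite mxE ![(d < _)%N]ltnNge; case: (i <= d)%N; case: (j <= d)%N. Qed.

Lemma dsumE Mb :
  [/\ dsum_mx d Mb (newi d) (newi d) = Mb 0 0, dsum_mx d Mb (newi d) ord_max = Mb 0 1,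
      dsum_mx d Mb ord_max (newi d) = Mb 1 0 & dsum_mx d Mb ord_max ord_max = Mb 1 1].
Proof.
have h0 : inord (d.+1 - d.+1) = 0 :> 'I_2 by apply: ord_inj; rewrite subnn inordK.
have h1 : inord (d.+2 - d.+1) = 1 :> 'I_2 by apply: ord_inj; rewrite subSnn inordK.
by rewrite !mxE !newiE /= !ltnS !leqnn !leqW // !h0 !h1.
Qed.

Lemma big_dsum (R : Type) (idx : R) (op : Monoid.com_law idx) (F : 'I_d.+3 -> R) :
  (forall j, (j <= d)%N -> F j = idx) ->
  \big[op/idx]_j F j = op (F (newi d)) (F ord_max).
Proof.
move=> h; rewrite (bigD1 (newi d)) //= (bigD1 ord_max) /=; last first.
  by rewrite eq_sym newi_neq_max.
rewrite big1 ?Monoid.mulm1 // => j /andP[/eqP h1 /eqP h2].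
by case: (ord_cases j) => [/h //|[]].
Qed.

Lemma dsum_mul Mb Mb' : dsum_mx d Mb *m dsum_mx d Mb' = dsum_mx d (Mb *m Mb').
Proof.
apply/matrixP=> i k; rewrite mxE.
have [hi|hi] := boolP (i <= d)%N.
  rewrite (bigD1 i) //= big1 ?addr0 => [|j ne]; last first.
    by rewrite dsumE_small ?hi // eq_sym (negPf ne) mul0r.
  by rewrite !dsumE_small ?hi // eqxx mul1r.
have [hk|hk] := boolP (k <= d)%N.
  rewrite (bigD1 k) //= big1 ?addr0 => [|j ne]; last first.
    by rewrite (dsumE_small Mb') ?hk ?orbT // (negPf ne) mulr0.
  by rewrite !dsumE_small ?hk ?orbT // eqxx mulr1.
rewrite big_dsum => [|j hj]; last first.
  rewrite dsumE_small ?hj ?orbT //; case: eqP => [E|]; last by rewrite mul0r.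
  by rewrite E hj in hi.
have E (A B : 'M[int]_2) s t : (A *m B) s t = A s 0 * B 0 t + A s 1 * B 1 t.
  rewrite mxE !big_ord_recl big_ord0 addr0.
  by congr (A _ _ * B _ _ + A _ _ * B _ _); apply: val_inj.
have [e1 e2 e3 e4] := dsumE Mb; have [e1' e2' e3' e4'] := dsumE Mb'.
have [e1'' e2'' e3'' e4''] := dsumE (Mb *m Mb').
case: (ord_cases i) => [|[]] Ei; first by rewrite Ei in hi.
all: case: (ord_cases k) => [|[]] Ek; first by rewrite Ek in hk.
all: by rewrite Ei Ek ?e1 ?e2 ?e3 ?e4 ?e1' ?e2' ?e3' ?e4' ?e1'' ?e2'' ?e3'' ?e4'' E.
Qed.

Lemma dsum1 : dsum_mx d 1%:M = 1%:M.
Proof.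
apply/matrixP=> i k; have [e1 e2 e3 e4] := dsumE 1%:M.
case: (ord_cases i) => [hi|hi]; first by rewrite dsumE_small ?hi // mxE.
case: (ord_cases k) => [hk|hk]; first by rewrite dsumE_small ?hk ?orbT // mxE.
have ne := newi_neq_max d; have ne' : ord_max != newi d by rewrite eq_sym.
by case: hi hk => -> [] ->; rewrite ?e1 ?e2 ?e3 ?e4 !mxE ?eqxx ?(negPf ne) ?(negPf ne').
Qed.

Lemma dsum_unit Mb : \det Mb = 1 -> dsum_mx d Mb \in unitmx.
Proof.
move=> dM; have uM : Mb \in unitmx by rewrite unitmxE dM unitr1.
by case: (mulmx1_unit (_ : dsum_mx d Mb *m dsum_mx d (invmx Mb) = 1%:M)) => //;
  rewrite dsum_mul mulmxV // dsum1.
Qed.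

Variables (L : fieldType) (z : 'I_d.+3 -> L).

Lemma act_dsum_small Mb i : (i <= d)%N -> act z (dsum_mx d Mb) i = z i.
Proof.
move=> hi; rewrite /act (bigD1 i) //= dsumE_small ?hi // eqxx expr1z big1 ?mulr1 // => j ne.
by rewrite dsumE_small ?hi ?orbT // (negPf ne).
Qed.

Lemma act_dsum_new Mb :
  act z (dsum_mx d Mb) (newi d) = z (newi d) ^ Mb 0 0 * z ord_max ^ Mb 1 0.
Proof.
have [e1 e2 e3 e4] := dsumE Mb; rewrite /act big_dsum ?e1 ?e3 // => j hj.
rewrite dsumE_small ?hj //; case: eqP => // E; move: hj; rewrite E newiE.
by rewrite ltnn.
Qed.

Lemma act_dsum_max Mb :
  act z (dsum_mx d Mb) ord_max = z (newi d) ^ Mb 0 1 * z ord_max ^ Mb 1 1.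
Proof.
have [e1 e2 e3 e4] := dsumE Mb; rewrite /act big_dsum ?e2 ?e4 // => j hj.
rewrite dsumE_small ?hj //; case: eqP => // E; move: hj; rewrite E /=.
by rewrite ltnNge leqnSn.
Qed.
End DirectSum.

Lemma act_inj (L : fieldType) n (z z' : 'I_n -> L) (M : 'M[int]_n) :
    M \in unitmx -> (forall i, z i != 0) -> (forall i, z' i != 0) ->
  act z M =1 act z' M -> z =1 z'.
Proof.
move=> uM z0 z0' E i; rewrite -[LHS](act1 z) -[RHS](act1 z') -(mulmxV uM) -!act_mul //.
exact: eq_act.
Qed.

Lemma germXY_eq (K : fieldType) (a e : chart K) x l v :
  Xj e = Xj a -> Yc e = Yc a -> germXY a x l v -> germXY e x l v.
Proof.
move=> EX EY [h [s [s0 E E0]]]; exists h, s; split=> //.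
by move: E; rewrite /= /evXY EX EY.
Qed.

(** * The chart that keeps the points outside the centre *)

Section Tilde.
Variables (K : fieldType) (f : laurent K 2) (a : chart K).
Variables (g : {mpoly K[(cdim a).+2]}) (n : 'rV[int]_(cdim a).+2) (G : {poly {poly K}}).
Hypotheses (ha : chart_inv f a) (hexp : is_exponent_of G g n).

Let e := tilde_chart g n.
Let uM := inv_unit ha.

Lemma tilde_Xs : nz e -> Xs e =1 @Xt K a G.
Proof.
move=> z0 i; rewrite /Xs -(eq_act _ (Xt_act uM hexp z0)) act_mul; last first.
  by move=> j; apply: (Xt_neq0 uM hexp _ z0).
rewrite mulmxV ?act1 //.
by rewrite unitmxE det_ext_mx -unitmxE.
Qed.

Lemma tilde_Xs_lift i : nz e -> Xs e (lift (newi (cdim a)) i) = Xs a i.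
Proof. by move=> z0; rewrite tilde_Xs // /Xt liftK. Qed.

Lemma tilde_Xj : nz e -> Xj e = Xj a.
Proof.
by move=> z0; rewrite -[RHS](tilde_Xs_lift _ z0) lift_newi_xindex.
Qed.

Lemma tilde_Yc : nz e -> Yc e = Yc a.
Proof. by move=> z0; rewrite -[RHS](tilde_Xs_lift _ z0) lift_newi_max. Qed.

Lemma tilde_point (Q : point e) : in_Cbar f Q ->
  exists P : point a, in_Cbar f P /\ P 0 (xindex (cj a)) = Q 0 (xindex (cj e)).
Proof.
move=> hQ; have z0 := Cbar_nz hQ.
exists (\row_i Q 0 (lift (newi (cdim a)) i)); split.
  apply: (pullback hQ) => [i hi||i]; rewrite ?mxE.
  - by apply: hQ.1; apply: lift_newi_neq_max.
  - by rewrite lift_newi_max; apply: evP_Y hQ.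
  - by rewrite -tilde_Xs_lift //; apply: germP_X.
by rewrite mxE lift_newi_xindex.
Qed.

(** The new coordinate X_(m+1) is invertible on the ambient scheme and equals G(X_j, Y), so the
    zeros of G are removed; with G the product over the centre, these include the centre itself. *)
Lemma tilde_avoids (Q : point e) : in_Cbar f Q -> ev_at (Q 0 (xindex (cj e))) G != 0.
Proof.
move=> hQ; have z0 := Cbar_nz hQ.
have := hQ.1 _ (newi_neq_max (cdim a)).
suff -> : Q 0 (newi (cdim a)) = ev_at (Q 0 (xindex (cj e))) G by [].
apply: (germP_inj hQ (germP_X Q _)).
have -> : Xs e (newi (cdim a)) = evXY e G.
  by rewrite tilde_Xs // /Xt unlift_none /evXY tilde_Xj // tilde_Yc.
exact/(germXY_P hQ)/germXY_ev.
Qed.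

Lemma tilde_inv : chart_inv f e.
Proof.
split.
- by rewrite unitmxE det_ext_mx -unitmxE.
- move=> z0; have [c [w [c0 E]]] := inv_eq ha (nz_ext z0).
  have [w' Ew] : is_monom e (monom (zs a) w) by apply: is_monom_ext; exists w.
  by exists c, w'; split=> //; rewrite E -Ew /evXY tilde_Xj // tilde_Yc.
- exact: inv_Y0 ha.
- move=> Q hQ i; have z0 := Cbar_nz hQ; have [P [hP <-]] := tilde_point hQ.
  rewrite tilde_Xs // /Xt; case: (unlift _ i) => [i'|].
    have [v hv] := inv_germ ha hP i'; exists v.
    by apply: germXY_eq hv; [exact: tilde_Xj|exact: tilde_Yc].
  exists (ev_at (P 0 (xindex (cj a))) G).
  by apply: germXY_eq (germXY_ev _ _ _); [exact: tilde_Xj|exact: tilde_Yc].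
move=> Q hQ; have [P [hP EP]] := tilde_point hQ.
by have := inv_ncond ha hP; rewrite EP.
Qed.
End Tilde.

Lemma is_monomM (K : fieldType) (c : chart K) l l' : nz c ->
  is_monom c l -> is_monom c l' -> is_monom c (l * l').
Proof. by move=> z0 [u ->] [u' ->]; exists (u + u'); rewrite monomD. Qed.

Lemma is_monomV (K : fieldType) (c : chart K) l : nz c -> is_monom c l -> is_monom c l^-1.
Proof. by move=> z0 [u ->]; exists (- u); rewrite monomN. Qed.

Lemma is_monomXz (K : fieldType) (c : chart K) l (m : int) : nz c ->
  is_monom c l -> is_monom c (l ^ m).
Proof.
move=> z0 hl; have hn k : is_monom c (l ^+ k).
  elim: k => [|k IH]; first by exists 0; rewrite monom0.
  by rewrite exprS; apply: is_monomM.
by case: m => k; [exact: hn|rewrite NegzE -exprnN; apply: is_monomV; first exact: z0; exact: hn].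
Qed.

Lemma is_monom_Xs (K : fieldType) (c : chart K) i : is_monom c (Xs c i).
Proof. by exists (col i (invmx (cM c)))^T; rewrite -monomE_act. Qed.

(** A lexicographic order on (r, N) that never names the least N: each admissible N of the old pair
    must yield a smaller one for the new pair. The first clause provides a starting value for the
    inner induction, so well-foundedness also covers pairs without any admissible N. *)
Definition site_lt (K : fieldType) (s' s : {poly {poly K}} * K) : Prop :=
  (exists N, ncond s'.1 s'.2 N) /\
  ((mup s'.2 (at_Y0 s'.1) < mup s.2 (at_Y0 s.1))%N \/
   mup s'.2 (at_Y0 s'.1) = mup s.2 (at_Y0 s.1) /\
   forall N, ncond s.1 s.2 N -> exists N', (N' < N)%N /\ ncond s'.1 s'.2 N').

Lemma site_lt_wf (K : fieldType) : well_founded (@site_lt K).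
Proof.
suff H r : forall s, mup s.2 (at_Y0 s.1) = r -> Acc (@site_lt K) s by move=> s; apply: H erefl.
elim/ltn_ind: r => r IHr.
have hN N : forall s, mup s.2 (at_Y0 s.1) = r -> ncond s.1 s.2 N -> Acc (@site_lt K) s.
  elim/ltn_ind: N => N IHN s Es hs; constructor=> s' [_ [lt|[E hlt]]].
    by apply: IHr erefl; rewrite -Es.
  by have [N' [ltN hN']] := hlt _ hs; apply: IHN ltN _ _ hN'; rewrite E.
move=> s Es; constructor=> s' [[N hN'] [lt|[E _]]].
  by apply: IHr erefl; rewrite -Es.
by apply: hN hN'; rewrite E.
Qed.

Lemma cancel_units (F : fieldType) (a b c d x : F) : b != 0 -> d != 0 ->
  a * c * x = a * b^-1 * (c * d^-1) * (b * d * x).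
Proof. by move=> b0 d0; field; apply/andP. Qed.

(** * The charts over a point of the centre *)

Section Gamma.
Variables (K : fieldType) (f : laurent K 2) (a : chart K).
Variables (g : {mpoly K[(cdim a).+2]}) (n : 'rV[int]_(cdim a).+2) (c : {poly K}).
Variables (b w : 'rV[int]_2) (Mb : 'M[int]_2) (F : {poly {poly K}}) (k : K).
Hypotheses (ha : chart_inv f a) (hexp : is_exponent_of ('X + c%:P) g n).
Hypotheses (dM : \det Mb = 1) (M10 : 0 < Mb 1 0) (M11 : 0 < Mb 1 1) (kn0 : k != 0).
Hypothesis hF : gen F = rC 2 k * monom (@rX K 2) w
  * ev2 (@rC K 2) (act (@rX K 2) Mb 0) (act (@rX K 2) Mb 1) (cF a \Po ('X - c%:P)).
Hypothesis F0 : at_Y0 F != 0.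

Let e := beta_chart g n b Mb F.
Let x0 := - c.[0].
Let new : 'I_(cdim a).+3 := newi (cdim a).
Let uM := inv_unit ha.

Lemma gamma_unit : cM e \in unitmx.
Proof. by rewrite unitmx_mul dsum_unit // unitmxE det_ext_mx -unitmxE. Qed.

(** The matrix of e is (I_m (+) Mb) times [ext_mx]. Both sides are carried by the second factor to
    the coordinates x_1, g_2, ..., y, and that factor is invertible. *)
Lemma gamma_act : nz e -> act (Xs e) (dsum_mx (cdim a) Mb) =1 @Xt K a ('X + c%:P).
Proof.
move=> z0; have X0 i : Xs e i != 0 by apply: Xs_neq0.
apply: (@act_inj _ _ _ _ (ext_mx (cM a) n)).
- by rewrite unitmxE det_ext_mx -unitmxE.
- exact: act_neq0.
- by move=> i; apply: (Xt_neq0 uM hexp _ z0).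
move=> i; rewrite (Xt_act uM hexp z0) (act_mul _ _ X0) (act_mul _ _ z0).
by rewrite (mulVmx gamma_unit) act1.
Qed.

Lemma gamma_Xj : Xj e = Xs e new.
Proof. by congr (Xs e _); apply: ord_inj; rewrite newiE. Qed.

Lemma gamma_Xs i : nz e -> i != ord_max -> Xs e (lift new i) = Xs a i.
Proof.
move=> z0 hi; have := gamma_act z0 (lift new i).
rewrite /Xt liftK act_dsum_small // lift_newi_small //.
  by have := ltn_ord i; rewrite ltnS leq_eqVlt -val_eqE /= in hi *; rewrite (negPf hi).
by have := ltn_ord i; rewrite ltnS leq_eqVlt -val_eqE /= in hi *; rewrite (negPf hi).
Qed.

Lemma gamma_Yc : nz e -> Yc a = Xs e new ^ Mb 0 1 * Yc e ^ Mb 1 1.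
Proof.
move=> z0; have := gamma_act z0 ord_max; rewrite act_dsum_max => ->.
by rewrite -lift_newi_max /Xt liftK.
Qed.

Lemma gamma_Xt : nz e -> Xj a + (map_poly (@rC K 2) c).[Yc a]
  = Xs e new ^ Mb 0 0 * Yc e ^ Mb 1 0.
Proof.
move=> z0; have := gamma_act z0 new; rewrite act_dsum_new => ->.
by rewrite /Xt unlift_none evXYD evXY_X /evXY ev2C.
Qed.

Lemma gamma_eq : nz e -> exists c0 w0, c0 != 0 /\ fL f = rC 2 c0 * monom (zs e) w0 * evXY e F.
Proof.
move=> z0; have [c1 [w1 [c10 E]]] := inv_eq ha (nz_ext z0).
pose z (i : 'I_2) := if i == 0 then Xj e else Yc e.
have zn0 i : z i != 0 by rewrite /z; case: ifP => _; apply: Xs_neq0.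
have lX := laurent_fun_var K (0 : 'I_2); have lY := laurent_fun_var K (1 : 'I_2).
have lact j := laurent_fun_act K j Mb.
have rhs := laurent_funM (laurent_funM (laurent_fun_const 2 k) (laurent_fun_monom K w))
   (laurent_fun_ev2 (cF a \Po ('X - c%:P)) (lact 0) (lact 1)).
have EF : ev2 (@rC K 2) (z 0) (z 1) F = rC 2 k * monom z w
    * ev2 (@rC K 2) (act z Mb 0) (act z Mb 1) (cF a \Po ('X - c%:P)).
  exact: (transport (laurent_fun_ev2 F lX lY) rhs hF (@rC K 2) zn0).
have Ez0 : z 0 = Xs e new by exact: gamma_Xj.
have Ez1 : z 1 = Yc e by [].
have EY : act z Mb 1 = Yc a by rewrite act2E Ez0 Ez1 gamma_Yc.
have EX : act z Mb 0 = Xj a + (map_poly (@rC K 2) c).[Yc a].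
  by rewrite act2E Ez0 Ez1 gamma_Xt.
rewrite ev2_comp ev2_XsubC EX EY addrK in EF.
have [u Eu] : is_monom e (monom (zs a) w1 * (monom z w)^-1).
  apply: is_monomM => //; first by apply: is_monom_ext; exists w1.
  apply: is_monomV => //; rewrite monom2E Ez0 Ez1; apply: is_monomM => //.
    by apply: is_monomXz => //; apply: is_monom_Xs.
  by apply: is_monomXz => //; apply: is_monom_Xs.
exists (c1 / k), u; split; first by rewrite mulf_neq0 ?invr_eq0.
have -> : evXY e F = rC 2 k * monom z w * evXY a (cF a) by exact: EF.
rewrite -Eu E rmorphM fmorphV.
have k0 : rC 2 k != 0 by rewrite fmorph_eq0.
have m0 := monom_neq0 w zn0.
exact: cancel_units k0 m0.
Qed.

(** The old Y and the old X_j + c(Y) are monomials with a positive power of the new Y, so they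
    vanish on it: all of bar C_e lies over X_j = x0. *)
Lemma gamma_germs x : nz e -> x != 0 ->
  [/\ germXY e x (Xs e new) x, germXY e x (Yc a) 0 & germXY e x (Xj a) x0].
Proof.
move=> z0 xn0; have gX : germXY e x (Xs e new) x by rewrite -gamma_Xj; apply: germXY_X.
have Xn0 : Xs e new != 0 by apply: Xs_neq0.
(* [germXz] would require control of the kernel of [evXY e]; [germ_div] only requires the coordinate
   to be a nonzero rational function. *)
have gXz (m : int) : germXY e x (Xs e new ^ m) (x ^ m).
  have gXn l : germXY e x (Xs e new ^+ l) (x ^+ l) by apply: germX.
  case: m => l; first exact: gXn.
  rewrite NegzE -!exprnN -[(x ^+ _)^-1]mul1r.
  apply: (@germ_div _ _ _ _ _ _ (Xs e new ^+ l.+1) 1 _ _ _ (gXn l.+1)); last exact: germ1.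
    exact: mulVf (expf_neq0 _ Xn0).
  exact: expf_neq0.
have gY (m : int) : 0 < m -> germXY e x (Yc e ^ m) 0.
  case: m => // -[//|l] _; have E : 0 = 0 ^+ l.+1 :> K by rewrite expr0n.
  by rewrite E; exact: (germX l.+1 (germXY_Y e x)).
have gprod m m' : 0 < m' -> germXY e x (Xs e new ^ m * Yc e ^ m') 0.
  by move=> h; rewrite -[X in germXY _ _ _ X](mulr0 (x ^ m)); exact: germM (gXz m) (gY m' h).
have gYa : germXY e x (Yc a) 0 by rewrite gamma_Yc //; apply: gprod.
split=> //.
have -> : Xj a = Xs e new ^ Mb 0 0 * Yc e ^ Mb 1 0 - ev2 (@rC K 2) (Xj a) (Yc a) c%:P.
  by rewrite -gamma_Xt // ev2C addrK.
rewrite /x0 -[- c.[0]]add0r; apply: germB; first exact: gprod.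
rewrite !ev2C.
have := germ_ev2 c%:P (germXY_const e x) gX gYa.
by rewrite !ev2C (@map_poly_id _ idfun c).
Qed.

Lemma gamma_point (Q : point e) : in_Cbar f Q ->
  exists P : point a, in_Cbar f P /\ P 0 (xindex (cj a)) = x0.
Proof.
move=> hQ; have z0 := Cbar_nz hQ.
pose P : point a := \row_i (if i == ord_max then 0 else Q 0 (lift new i)).
have Qn0 : Q 0 (xindex (cj e)) != 0 by apply: hQ.1; apply: xindex_neq_max.
have [_ gY gX] := gamma_germs z0 Qn0.
have gP i : germP Q (Xs a i) (P 0 i).
  rewrite mxE; case: eqP => [->|/eqP hi]; first exact: germXY_P hQ gY.
  by rewrite -gamma_Xs //; apply: germP_X.
exists P; split.
  apply: (pullback hQ) => [i hi||]; rewrite ?mxE ?eqxx // ?(negPf hi).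
  by apply: hQ.1; apply: lift_newi_neq_max.
exact: germP_inj hQ (gP _) (germXY_P hQ gX).
Qed.

Lemma gamma_mup x : x != 0 ->
  let r := mup x0 (at_Y0 (cF a)) in let r' := mup x (at_Y0 F) in
  (r' <= r)%N /\ (r' = r -> (0 < r)%N -> w 0 1 = - (Mb 1 0 * r%:Z) /\ Mb 1 1 = 1).
Proof.
move=> xn0; apply: (mult_step dM M10 M11 kn0 hF) => //.
by apply: coef_mup => //; exact: inv_Y0 ha.
Qed.

Lemma gamma_ncond x N : x != 0 -> (2 <= mup x (at_Y0 F))%N -> ncond (cF a) x0 N ->
  let N' := Mb 1 1 * N%:Z + Mb 1 0 + w 0 1 in 0 < N' /\ ncond F x `|N'|%N.
Proof.
move=> xn0 hx hN; have [h1 h2] := mupP_ge2 F0 hx.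
exact: (ncond_step dM M10 M11 xn0 kn0 erefl hF h1 h2 hN).
Qed.

Lemma gamma_inv : chart_inv f e.
Proof.
split.
- exact: gamma_unit.
- exact: gamma_eq.
- exact: F0.
- move=> Q hQ i; have z0 := Cbar_nz hQ.
  have Qn0 : Q 0 (xindex (cj e)) != 0 by apply: hQ.1; apply: xindex_neq_max.
  have [gXn gY gX] := gamma_germs z0 Qn0.
  have [P [hP EP]] := gamma_point hQ.
  have [i' ->|->] := unliftP new i; last by exists (Q 0 (xindex (cj e))).
  have [->|hi] := eqVneq i' ord_max.
    by exists 0; rewrite lift_newi_max; apply: germXY_Y.
  have [v] := inv_germ ha hP i'; rewrite EP => -[h [s [s0 E _]]].
  exists (ev_at x0 h / ev_at x0 s); rewrite gamma_Xs //.
  have gev A : germXY e (Q 0 (xindex (cj e))) (evXY a A) (ev_at x0 A).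
    exact: germ_ev2 (germXY_const e _) gX gY.
  exact: germ_div E (gev s) s0 (gev h).
move=> Q hQ h2; have Qn0 : Q 0 (xindex (cj e)) != 0 by apply: hQ.1; apply: xindex_neq_max.
have [P [hP EP]] := gamma_point hQ; have [hr _] := gamma_mup Qn0.
have [|N hN] := inv_ncond ha hP; first by rewrite EP (leq_trans h2).
rewrite EP in hN; have [_ hN'] := gamma_ncond Qn0 h2 hN.
by eexists; exact: hN'.
Qed.

Lemma gamma_site_lt (Q : point e) : in_Cbar f Q -> let x := Q 0 (xindex (cj e)) in
  (2 <= mup x (at_Y0 F))%N -> site_lt (F, x) (cF a, x0).
Proof.
move=> hQ x h2; have xn0 : x != 0 by apply: hQ.1; apply: xindex_neq_max.
have [hr hEr] := gamma_mup xn0.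
split; first exact: (inv_ncond gamma_inv hQ h2).
move: hr; rewrite leq_eqVlt => /orP[/eqP E|]; [right|by left]; split=> // N hN.
have [Npos hN'] := gamma_ncond xn0 h2 hN; rewrite -E in hEr.
have [|hw hq] := hEr erefl; first by rewrite ltnW.
eexists; split; last exact: hN'.
(* Now the new exponent is N - (r - 1) p. Its positivity makes the absolute value harmless, and r >=
   2 makes it smaller than N. *)
move: h2 Npos; rewrite hw hq; move: (mup x _) (Mb 1 0) M10 => r p p0 r2; nia.
Qed.
End Gamma.

(** * First charts and finiteness *)

Lemma dvdY_at_Y0 (K : fieldType) (F : {poly {poly K}}) : ~ dvdY F -> at_Y0 F != 0.
Proof.
move=> h; apply/eqP=> E; apply: h; have [A EA] := split_Y F.
by exists A; rewrite EA E rmorph0 add0r.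
Qed.

Lemma leval_eq (K L : fieldType) n (phi : K -> L) (f : laurent K n) x y :
  x =1 y -> leval phi f x = leval phi f y.
Proof. by move=> E; apply: eq_bigr => u _; rewrite (eq_monom _ E). Qed.

Lemma ord2P (P : 'I_2 -> Prop) : P 0 -> P 1 -> forall i, P i.
Proof.
move=> h0 h1 i; case: (unliftP 0 i) => [j|] -> //.
by rewrite (ord1 j) (_ : lift _ _ = 1) //; apply: val_inj.
Qed.

Lemma unit_cancel (F : fieldType) (c m x : F) : c != 0 -> m != 0 ->
  x = c^-1 * m^-1 * (c * m * x).
Proof. by move=> c0 m0; field; apply/andP. Qed.

Section FirstChart.
Variables (K : closedFieldType) (f : laurent K 2) (b : 'rV[int]_2) (M : 'M[int]_2).
Variable F : {poly {poly K}}.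
Hypotheses (hf : smooth_curve f) (hM : attached M b) (hY : ~ dvdY F).
Hypothesis hF : eq_upto_monom (eval2 (@rC K 2) F (rX K 0) (rX K 1))
  (leval (@rC K 2) f (act (@rX K 2) M)).

Let e := first_chart b M F.

Lemma first_zs : zs e =1 @rX K 2.
Proof. by apply: ord2P; rewrite /zs /tf /rX (tnth_nth 0). Qed.

Lemma first_Xj : Xj e = Xs e 0.
Proof. by congr (Xs e _); apply: ord_inj. Qed.

Lemma first_Yc : Yc e = Xs e 1.
Proof. by congr (Xs e _); apply: ord_inj. Qed.

Lemma first_unit : M \in unitmx.
Proof. by rewrite unitmxE hM.1 unitr1. Qed.

Lemma first_inv : chart_inv f e.
Proof.
have [c [w [c0 E]]] := hF.
split.
- exact: first_unit.
- move=> z0; have X0 i : Xs e i != 0 by apply: Xs_neq0.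
  have lX := laurent_fun_var K (0 : 'I_2); have lY := laurent_fun_var K (1 : 'I_2).
  have rhs := laurent_funM (laurent_funM (laurent_fun_const 2 c) (laurent_fun_monom K w))
    (laurent_fun_leval f M).
  have EF : ev2 (@rC K 2) (Xs e 0) (Xs e 1) F
      = rC 2 c * monom (Xs e) w * leval (@rC K 2) f (act (Xs e) M).
    exact: (transport (laurent_fun_ev2 F lX lY) rhs E (@rC K 2) X0).
  have Ef : leval (@rC K 2) f (act (Xs e) M) = fL f.
    by apply: leval_eq => i; rewrite /Xs (act_mul _ _ z0) (mulVmx first_unit) act1 first_zs.
  exists c^-1, (- w *m (invmx M)^T); split; first by rewrite invr_eq0.
  rewrite -(monom_actE _ _ z0) (monomN _ X0) /evXY first_Xj first_Yc EF Ef fmorphV.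
  have k0 : rC 2 c != 0 by rewrite fmorph_eq0.
  exact: unit_cancel k0 (monom_neq0 w X0).
- exact: dvdY_at_Y0.
- move=> P hP; apply: ord2P.
    by exists (P 0 (xindex (cj e))); rewrite -first_Xj; apply: germXY_X.
  by exists 0; rewrite -first_Yc; apply: germXY_Y.
move=> P hP _; apply: ncond_base.
- by apply: contraNneq (dvdY_at_Y0 hY) => E0; rewrite -[F]/(cF e) E0 /at_Y0 map_poly0.
- by apply: hP.1; apply: xindex_neq_max.
exact: no_singular_point hM.1 c0 hf E.
Qed.
End FirstChart.

Section Finiteness.

(** [List.In] is used on the side of [Y] because it will be a type of charts, which carries no
    decidable equality. *)
Lemma collect (X : eqType) (Y : Type) (s : seq X) (Q : X -> Y -> Prop) :
    (forall x, x \in s -> exists l : seq Y, forall y, Q x y -> List.In y l) ->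
  exists l : seq Y, forall x, x \in s -> forall y, Q x y -> List.In y l.
Proof.
elim: s => [|x s IH] h; first by exists [::].
have [|l hl] := IH; first by move=> y ys; apply: h; rewrite inE ys orbT.
have [l' hl'] := h x (mem_head _ _).
exists (List.app l' l) => y; rewrite inE => /orP[/eqP->|ys] z hz; apply: List.in_or_app.
  by left; apply: hl'.
by right; apply: hl hz.
Qed.

Lemma int_box (N : nat) : exists l : seq 'rV[int]_2,
  forall b : 'rV[int]_2, (`|b 0%R 0%R| <= N)%N -> (`|b 0%R 1%R| <= N)%N -> b \in l.
Proof.
pose r := [seq (m%:Z - N%:Z) | m <- iota 0 (N + N).+1].
have hr (z : int) : (`|z| <= N)%N -> z \in r.
  move=> hz; apply/mapP; exists `|(z + N%:Z)%R|%N; last by lia.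
  by rewrite mem_iota; lia.
exists [seq mk2 i j | i <- r, j <- r] => b h0 h1.
apply/allpairsP; exists (b 0 0, b 0 1); split; [exact: hr|exact: hr|].
by apply: row2P; rewrite !mxE.
Qed.

Lemma coprime_bound (p q x y : int) : coprimez p q -> p * x = q * y ->
  (x != 0) || (y != 0) -> (`|p| <= `|y|)%N /\ (`|q| <= `|x|)%N.
Proof.
move=> hc E hxy; split.
  have [y0|y0] := eqVneq y 0.
    rewrite y0 orbF in hxy; move/eqP: E; rewrite y0 mulr0 mulf_eq0 (negPf hxy) orbF.
    by move=> /eqP->.
  have : (p %| y)%Z by rewrite -(Gauss_dvdzr _ hc) -E dvdz_mulr.
  by rewrite dvdzE; apply: dvdn_leq; rewrite absz_gt0.
have [x0|x0] := eqVneq x 0.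
  rewrite x0 eqxx /= in hxy; move/esym/eqP: E; rewrite x0 mulr0 mulf_eq0 (negPf hxy) orbF.
  by move=> /eqP->.
rewrite coprimez_sym in hc.
have : (q %| x)%Z by rewrite -(Gauss_dvdzr _ hc) E dvdz_mulr.
by rewrite dvdzE; apply: dvdn_leq; rewrite absz_gt0.
Qed.

(** A normal vector is orthogonal to the difference of two distinct exponents of f. Being primitive,
    it has entries bounded by those of the difference, hence by 2 B. *)
Lemma edge_normal_finite (K : fieldType) (f : laurent K 2) :
  exists l : seq 'rV[int]_2, forall b, edge_normal f b -> b \in l.
Proof.
pose B := \max_(u <- finsupp f) (`|u 0%R 0%R| + `|u 0%R 1%R|)%N.
have hB u : f u != 0 -> (`|u 0%R 0%R| + `|u 0%R 1%R| <= B)%N.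
  by move=> hu; apply: leq_bigmax_seq; rewrite // mem_finsupp.
have [l hl] := int_box (B + B); exists l => b [hb [c [_ [u [u' [ne fu fu' E E']]]]]].
have dotE v : dot b v = b 0 0 * v 0 0 + b 0 1 * v 0 1.
  rewrite /dot !big_ord_recl big_ord0 addr0.
  by congr (b _ _ * v _ _ + b _ _ * v _ _); apply: val_inj.
have [||h1 h2] := @coprime_bound (b 0 0) (b 0 1) (u 0 0 - u' 0 0) (u' 0 1 - u 0 1) hb.
- have : dot b u = dot b u' by apply: (addIr c); rewrite E E'.
  rewrite !dotE => /eqP; rewrite -subr_eq0 => /eqP h.
  by apply/eqP; rewrite -subr_eq0 -[X in _ == X]h; apply/eqP; ring.
- apply: contraR ne; rewrite negb_or !negbK !subr_eq0 => /andP[/eqP h0 /eqP h1].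
  by apply/eqP; apply: row2P.
have := hB _ fu; have := hB _ fu'.
move: (u 0 0 : int) (u 0 1 : int) (u' 0 0 : int) (u' 0 1 : int) h1 h2 => x y x' y' h1 h2 h3 h4.
by apply: hl; lia.
Qed.
End Finiteness.

Section Nodes.
Variables (K : closedFieldType) (f : laurent K 2).

(* A point of bar C_a is recorded by its X_j-coordinate. Multiplicity at least 2
   is only necessary for a singularity (see [Sing_mup]), which is all that is
   needed to follow the points in the tree. *)
Definition node (a : chart K) (x : K) : Prop :=
  (exists P : point a, in_Cbar f P /\ P 0 (xindex (cj a)) = x) /\
  (2 <= mup x (at_Y0 (cF a)))%N.

Lemma nodes_finite (s : seq (chart K)) : exists l : seq (chart K * K),
  forall a x, List.In a s -> chart_inv f a -> node a x -> List.In (a, x) l.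
Proof.
elim: s => [|a s [l hl]]; first by exists [::].
have [r hr] : exists r : seq K, forall x, chart_inv f a -> node a x -> List.In x r.
  have [r hr] := closed_field_poly_normal (at_Y0 (cF a)); exists r => x ha [_ hx].
  have hx' : root (at_Y0 (cF a)) x.
    by rewrite -dvdp_XsubCl XsubC_dvd ?(inv_Y0 ha) // ltnW.
  have {hx'} : x \in r.
    by move: hx'; rewrite hr rootZ ?root_prod_XsubC // lead_coef_eq0 (inv_Y0 ha).
  elim: (r) => //= y t IH; rewrite inE => /orP[/eqP->|/IH]; by [left|right].
exists (List.app (List.map (pair a) r) l) => e x [<-|he] hi hx; apply: List.in_or_app.
  by left; apply: List.in_map; apply: hr.
by right; apply: hl.
Qed.

Lemma row_attached (M : 'M[int]_2) b : attached M b ->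
  [/\ \det M = 1, M 1 0 = b 0 0 & M 1 1 = b 0 1].
Proof.
have E : ord_max = 1 :> 'I_2 by apply: ord_inj.
by case=> dM <-; rewrite !mxE E.
Qed.

(** The two alternatives become the idle and the hit steps of the tree: a point outside the centre
    survives unchanged on the chart [t], and any other node lies over a centre with a smaller key.
    [t] and [l] depend on neither the chart [e] nor the point [y], which gives uniqueness and
    finiteness of continuations. *)
Lemma elementary_children (a : chart K) (S : seq (point a)) (T : chart_set K) :
    chart_inv f a -> (forall p, p \in S -> in_Sing f p) -> elementary_step f S T ->
  (forall e, T e -> chart_inv f e) /\
  exists (t : chart K) (l : seq (chart K)), forall e, T e -> forall y, node e y ->
    [/\ e = t, node a y, cF e = cF a & forall p, p \in S -> p 0 (xindex (cj a)) <> y] \/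
    (List.In e l /\
     exists p, p \in S /\ site_lt (cF e, y) (cF a, p 0 (xindex (cj a)))).
Proof.
move=> ha hS [c [g [n [nS [M [F [hp hexpS hM hF hT]]]]]]].
set GS := \prod_(p <- S) ('X + (c p)%:P) in hexpS.
set t := tilde_chart (\prod_(p <- S) g p) nS.
pose gam p b := beta_chart (g p) (n p) b (M p b) (F p b).
pose pos (b : 'rV[int]_2) := [&& primitive2 b, 0 < b 0 0 & 0 < b 0 1].
have hgam p b : p \in S -> pos b -> C0_proper f (gam p b) ->
    exists k w, [/\ \det (M p b) = 1, M p b 1 0 = b 0 0, M p b 1 1 = b 0 1 & k != 0] /\
    [/\ 0 < M p b 1 0, 0 < M p b 1 1, at_Y0 (F p b) != 0,
     gen (F p b) = rC 2 k * monom (@rX K 2) w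
       * ev2 (@rC K 2) (act (@rX K 2) (M p b) 0) (act (@rX K 2) (M p b) 1)
           (cF a \Po ('X - (c p)%:P)) & is_exponent_of ('X + (c p)%:P) (g p) (n p)].
  move=> pS hb hC; have [dM E0 E1] := row_attached (hM p b pS hb).
  have [nY [k [w [k0 E]]]] := hF p b pS (conj hb hC).
  have [_ _ _ hexp] := hp p pS; have /and3P[_ b0 b1] := hb.
  by exists k, w; split; split; rewrite ?E0 ?E1 //; exact: dvdY_at_Y0.
have hinv p b : p \in S -> pos b -> C0_proper f (gam p b) -> chart_inv f (gam p b).
  move=> pS hb hC; have [k [w [[dM E0 E1 k0] [h0 h1 h2 h3 h4]]]] := hgam p b pS hb hC.
  exact: (gamma_inv b ha h4 dM h0 h1 k0 h3 h2).
split=> [e /hT[->|[p [b [pS [hb hC] ->]]]]|].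
- exact: tilde_inv ha hexpS.
- exact: hinv.
have [l hl] : exists l : seq (chart K), forall p, p \in S -> forall e,
    (exists b, [/\ pos b, C0_proper f (gam p b) & e = gam p b]) -> List.In e l.
  apply: collect => p pS.
  have [N hN] := cf_bound (cF a \Po ('X - (c p)%:P)).
  have [bs hbs] := int_box N.
  have [l hl] : exists l : seq (chart K), forall b, b \in bs -> forall e, e = gam p b -> List.In e l.
    by apply: collect => b _; exists [:: gam p b] => e ->; left.
  exists l => e [b [hb hC Ee]]; apply: (hl b) => //.
  (* A point of bar C_e is a nonzero root of F_e(X, 0), so b is normal to an actual edge and
     [edge_bound] confines it to the box. *)
  have [k [w [[dM E0 E1 k0] [h0 h1 h2 h3 h4]]]] := hgam p b pS hb hC.
  have hi := hinv p b pS hb hC; have [Q hQ] := hC.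
  have Qn0 : Q 0 (xindex (cj (gam p b))) != 0 by apply: hQ.1; apply: xindex_neq_max.
  have rQ : root (at_Y0 (F p b)) (Q 0 (xindex (cj (gam p b)))).
    by apply/rootP; rewrite -ev_atE; exact: (Cbar_root hi hQ).
  have := edge_bound dM h0 h1 k0 h3 h2 Qn0 rQ hN; rewrite E0 E1.
  have /and3P[_ b0 b1] := hb.
  move=> [u0 u1]; apply: hbs; first by move: (b 0 0 : int) b0 u0 => z; lia.
  by move: (b 0 1 : int) b1 u1 => z; lia.
exists t, l => e /hT[->|[p [b [pS [hb hC] ->]]]] y [[Q [hQ Qy]] hy].
  left; split=> //.
    split=> //; have [P [hP EP]] := tilde_point ha hexpS hQ.
    by exists P; rewrite EP.
  (* If y were the coordinate of a centre p, the factor X + c_p(Y) of [GS] would vanish at (y,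
     0). *)
  move=> p pS Ep; have := tilde_avoids ha hexpS hQ; rewrite Qy /GS /ev_at rmorph_prod /=.
  rewrite (big_rem p pS) /= rmorphD /= ev2X ev2C (@map_poly_id _ idfun (c p)) //.
  by have [-> _ _ _] := hp p pS; rewrite -Ep subrr mul0r eqxx.
right; split; first by apply: (hl p pS); exists b.
exists p; split=> //.
have [k [w [[dM E0 E1 k0] [h0 h1 h2 h3 h4]]]] := hgam p b pS hb hC.
have Ex : p 0 (xindex (cj a)) = - (c p).[0] by have [-> _ _ _] := hp p pS; rewrite opprK.
by rewrite Ex -Qy; apply: (gamma_site_lt ha h4 dM h0 h1 k0 h3 h2 hQ); rewrite Qy.
Qed.
End Nodes.

(** * The tree of centres *)

Section Resolution.
Variables (K : closedFieldType) (f : laurent K 2).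
Variables (Sigma : nat -> chart_set K) (S : nat -> center K).
Hypotheses (hf : smooth_curve f) (hB : baker_resolution f Sigma S).

Definition site (v : chart K * K) : {poly {poly K}} * K := (cF v.1, v.2).
Definition live n (v : chart K * K) : Prop := Sigma n v.1 /\ node f v.1 v.2.
Definition hit n (v : chart K * K) : Prop :=
  exists p, p \in S n v.1 /\ p 0 (xindex (cj v.1)) = v.2.

(** Describing steps by a function [succ] and a list-valued function [next] makes the hypotheses
    [step_idle] and [fin_hit] of the tree hold by form. *)
Definition follows (succ : nat -> chart K -> chart K)
    (next : nat -> chart K -> seq (chart K * K)) n (u v : chart K * K) : Prop :=
  (~ hit n u /\ v = (succ n u.1, u.2) /\ site v = site u) \/
  (hit n u /\ List.In v (next n u.1) /\ site_lt (site v) (site u)).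

Lemma resolution_children n : (0 < n)%N -> (forall a, Sigma n a -> chart_inv f a) ->
  (forall e, Sigma n.+1 e -> chart_inv f e) /\
  exists sn : (chart K -> chart K) * (chart K -> seq (chart K * K)),
    forall v, live n.+1 v -> exists u, live n u /\
      follows (fun _ => sn.1) (fun _ => sn.2) n u v.
Proof.
move=> n0 hinv; have [_ hS hR] := hB; have [T [hT hSigma]] := hR n n0.
have hch a (aS : Sigma n a) (nS : S n a != [::]) :=
  elementary_children (hinv a aS) (hS n a n0 aS).2 (hT a aS nS).
have hinv' e : Sigma n.+1 e -> chart_inv f e.
  case/hSigma=> a [aS]; case: ifP => [_ ->|/negbT nS he]; first exact: hinv.
  exact: (hch a aS nS).1.
split=> //.
pose replaces a (t : chart K * seq (chart K)) :=
    Sigma n a -> S n a != [::] -> forall e, T a e -> forall y, node f e y ->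
    [/\ e = t.1, node f a y, cF e = cF a
      & forall p, p \in S n a -> p 0 (xindex (cj a)) <> y] \/
    (List.In e t.2 /\
     exists p, p \in S n a /\ site_lt (cF e, y) (cF a, p 0 (xindex (cj a)))).
have [tl htl] : exists tl, forall a, replaces a (tl a).
  apply: (functional_choice replaces) => a.
  have [[aS nS]|h] := classic (Sigma n a /\ S n a != [::]).
    by have [_ [t [l h]]] := hch a aS nS; exists (t, l) => _ _; exact: h.
  by exists (a, [::]) => aS nS; case: (h (conj aS nS)).
have [nx hnx] : exists nx : chart K -> seq (chart K * K), forall a e y,
    List.In e (tl a).2 -> chart_inv f e -> node f e y -> List.In (e, y) (nx a).
  apply: (functional_choice (fun a l => forall e y, List.In e (tl a).2 ->
    chart_inv f e -> node f e y -> List.In (e, y) l)) => a.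
  exact: nodes_finite.
exists (fun a => if S n a == [::] then a else (tl a).1, nx) => -[e y] [/= he hy].
have := he; case/hSigma=> a [aS]; case: ifP => [/eqP nS Ee|nS hTe].
  exists (a, y); split; first by split=> //; rewrite -Ee.
  left; split; first by case=> p []; rewrite nS.
  by rewrite /= nS eqxx Ee.
have [[Ee hay EF hp]|[hl [p [pS hlt]]]] := htl a aS (negbT nS) e hTe y hy.
  exists (a, y); split=> //; left; split; first by case=> p [pS /hp]; apply.
  by rewrite /site /= nS -Ee EF.
exists (a, p 0 (xindex (cj a))); split.
  have hp := (hS n a n0 aS).2 p pS; split=> //; split; first by exists p; case: hp.
  exact: Sing_mup (hinv a aS) hp.
right; split; first by exists p.
by split=> //; apply: hnx => //; apply: hinv'.
Qed.

Lemma first_children :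
  (forall a, Sigma 1%N a -> chart_inv f a) /\
  exists s, forall v, live 1 v -> List.In v s.
Proof.
have [[M [F [hMF hSigma]]] _ _] := hB.
have hinv a : Sigma 1%N a -> chart_inv f a.
  by case/hSigma=> b [hb ->]; have [h1 h2 h3] := hMF b hb; apply: first_inv.
split=> //; have [bs hbs] := edge_normal_finite f.
have [l hl] : exists l : seq (chart K), forall b, b \in bs -> forall e,
    e = first_chart b (M b) (F b) -> List.In e l.
  by apply: collect => b _; exists [:: first_chart b (M b) (F b)] => e ->; left.
have [s hs] := nodes_finite f l; exists s => -[a x] [/= ha hx]; apply: hs => //.
  by have [b [hb ->]] := (hSigma a).1 ha; apply: (hl b) => //; apply: hbs.
exact: hinv.
Qed.

Lemma resolution_inv n a : (0 < n)%N -> Sigma n a -> chart_inv f a.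
Proof.
case: n => // n _; elim: n a => [|n IH] a; first exact: first_children.1.
by apply: (resolution_children _ _).1 => // e; apply: IH.
Qed.

(** A centre is a singular point, hence has multiplicity at least 2 and is a live vertex that is
    hit; [finite_tree] excludes this from some time on. *)
Lemma finitely_many_centers : exists N, forall n a, (N <= n)%N -> Sigma n a -> S n a = [::].
Proof.
have [sn hsn] : exists sn : nat -> (chart K -> chart K) * (chart K -> seq (chart K * K)),
    forall n, (0 < n)%N -> forall v, live n.+1 v ->
    exists u, live n u /\ follows (fun m => (sn m).1) (fun m => (sn m).2) n u v.
  apply: (functional_choice (fun n sn => (0 < n)%N -> forall v, live n.+1 v ->
    exists u, live n u /\ follows (fun _ => sn.1) (fun _ => sn.2) n u v)) => n.
  have [n0|n0] := boolP (0 < n)%N; last by exists (id, fun=> [::]).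
  have [_ [sn hsn]] := resolution_children n0 (fun a => @resolution_inv n a n0).
  by exists sn.
have [_ [s hs]] := first_children.
pose st := follows (fun m => (sn m).1) (fun m => (sn m).2).
have idle n u v v' : ~ hit n u -> st n u v -> st n u v' -> v = v'.
  by move=> nh [[_ [-> _]]|[]//] [[_ [-> _]]|[]].
have key_idle n u v : ~ hit n u -> st n u v -> site v = site u.
  by move=> nh [[_ []]|[]].
have key_hit n u v : hit n u -> st n u v -> site_lt (site v) (site u).
  by move=> h [[]|[_ []]].
have fin n u : hit n u -> exists l : seq (chart K * K), forall v, st n u v -> List.In v l.
  by move=> h; exists ((sn n).2 u.1) => v [[]|[_ []]].
have hlive n v : (1 <= n)%N -> live n.+1 v -> exists u, live n u /\ st n u v.
  by move=> n0; apply: hsn.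
have [N hN] := finite_tree (@site_lt_wf K) idle key_idle key_hit fin hs hlive.
exists N.+1 => -[//|n] a ltN aS; case E : (S n.+1 a) => [//|p s'].
have pS : p \in S n.+1 a by rewrite E mem_head.
have [_ hS _] := hB; have hp := (hS n.+1 a isT aS).2 p pS.
case: (hN n.+1 (ltnW ltN) (a, p 0 (xindex (cj a)))); last by exists p.
split=> //; split; first by exists p; case: hp.
by apply: Sing_mup hp; apply: resolution_inv aS.
Qed.
End Resolution.

Local Close Scope ring_scope.

Local Close Scope ring_scope.
Theorem theorem1p1 (k : fieldType) (kbar : closedFieldType)
    (iota : {rmorphism k -> kbar})
    (hk : perfect_field k) (hkbar : algebraic_closure iota)
    (f : laurent k 2) (hf : smooth_curve (map_laurent iota f))
    (Sigma : nat -> chart_set kbar) (S : nat -> center kbar)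
    (hB : baker_resolution (map_laurent iota f) Sigma S)
    (hG : galois_equivariant iota Sigma S)
    (hS : forall n, 0 < n -> ~ outer_regular (map_laurent iota f) (Sigma n) ->
      exists a, Sigma n a /\ S n a <> nil) :
  exists N, forall n, N <= n -> outer_regular (map_laurent iota f) (Sigma n).
Proof.
(* [N.+1] rather than [N] ensures n > 0, where [hS] applies. *)
have [N hN] := finitely_many_centers hf hB; exists N.+1 => n ltN; apply: NNPP => hreg.
have [|a [aS]] := hS n _ hreg; first exact: leq_trans ltN.
by apply; apply: hN aS; apply: ltnW.
Qed.
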